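(* For real $x$ let $X=(\log\log x)^{1/2}(\log\log\log x)^2$, and for any positive integer $n$ define $$P_n(x)=\log 2\cdot\omega(\phi(n))+\frac14\sum_{q\le X}\omega_q(n)^2\Lambda(q).$$ Then there is an absolute constant $K>0$ such that, for all sufficiently large $x$, for all but at most $K x/\log\log\log x$ positive integers $n\le x$, $$\Big|\log G(n)-P_n(x)\Big|\le K\,\frac{(\log\log x)^{3/2}}{\log\log\log x}.$$
   Context: $G(n)$ is the number of subgroups (counted as sets) of $(\mathbb{Z}/n\mathbb{Z})^\times$. $\phi$ is Euler's totient function, $\omega(m)$ is the number of distinct prime factors of $m$, and $\Lambda$ is the von Mangoldt function. For a positive integer $q$, $\omega_q(n)$ is the number of distinct primes $p\mid n$ with $p\equiv1\pmod q$. The sum over $q$ is over positive integers $q\le X$ (only prime powers contribute). *)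

(* Defs.v *)
From HB Require Import structures.
From mathcomp Require Import all_boot all_order all_algebra all_fingroup.
From mathcomp Require Import all_classical all_reals all_analysis.
Set Implicit Arguments.
Unset Strict Implicit.
Unset Printing Implicit Defensive.
Import Order.TTheory GRing.Theory Num.Theory.
Import numFieldNormedType.Exports.
Local Open Scope ring_scope.

(* 'Z_1 denotes Z/2, whose unit group is trivial, as is (Z/1)^x; hence the
   value is the intended one for every n >= 1. *)
Definition nb_subgroups_unitsZ (n : nat) : nat :=
  #|subgroups [set: {unit 'Z_n}]|.

Definition nb_prime_divisors (m : nat) : nat := size (primes m).

Definition nb_prime_divisors1 (q n : nat) : nat :=
  count (fun p => p == 1 %[mod q])%N (primes n).

(* n is a prime power p ^ k, k >= 1, exactly when p is its only prime factor. *)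
Definition vonMangoldt (R : realType) (n : nat) : R :=
  if primes n is [:: p] then ln p%:R else 0.

Lemma vonMangoldt_prime_power (R : realType) (p k : nat) :
  prime p -> (0 < k)%N -> vonMangoldt R (p ^ k) = ln p%:R.
Proof. by move=> pp k0; rewrite /vonMangoldt primesX // primes_prime. Qed.

Lemma vonMangoldt_not_prime_power (R : realType) (n : nat) :
  (forall p k, prime p -> (0 < k)%N -> n <> (p ^ k)%N) -> vonMangoldt R n = 0.
Proof.
move=> h; rewrite /vonMangoldt; case E: (primes n) => [//|p [|//]].
have : p \in primes n by rewrite E mem_head.
rewrite mem_primes => /and3P[pp n0 pn].
have k0 : (0 < logn p n)%N by rewrite logn_gt0 mem_primes pp n0.
case: (h p (logn p n) pp k0).
by rewrite [LHS](prod_prime_decomp n0) prime_decompE E /= big_seq1.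
Qed.

Section Approximation.
Context {R : realType}.
Implicit Type x : R.

Definition lnln x : R := ln (ln x).

Definition lnlnln x : R := ln (lnln x).

Definition cutoff x : R := lnln x `^ (1 / 2) * lnlnln x ^+ 2.

Definition approx_ln_nb_subgroups x (n : nat) : R :=
  ln 2 * (nb_prime_divisors (totient n))%:R +
  1 / 4 * \sum_(1 <= q < (Num.truncn (cutoff x)).+1)
            ((nb_prime_divisors1 q n)%:R ^+ 2 * vonMangoldt R q).

End Approximation.

(* Main.v *)
Require Import Defs.
From HB Require Import structures.
From mathcomp Require Import all_boot all_order all_algebra all_fingroup.
From mathcomp Require Import all_solvable.
From mathcomp Require Import zify ring lra.
Set Implicit Arguments.
Unset Strict Implicit.
Unset Printing Implicit Defensive.

(** Let w_j be the number of primes p | n with p = 1 mod q^j, and let A be the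
Sylow q-subgroup of the group of units modulo n. Since the group is the product
of its Sylow subgroups, ln G(n) is the sum over q of the logarithm of the number
of subgroups of A ([ln_nb_subgroups_sum]).

The number of subgroups of an abelian q-group depends on its torsion. If A has
q^(a_1 + ... + a_m) elements of order dividing q^m for every m, then A has
q^(sum_j a_j^2 / 4) subgroups up to a factor q^(O(sum_j a_j))
([card_subgroups_lower], [card_subgroups_upper]). By the Chinese remainder
theorem a_j = w_j + e_j, where the e_j come from the powers of q dividing n and
have sum at most v = max(v_q(n) - 1, 0) ([card_Ldiv_units_prime_power]); in the
lemmas below the index j starts at 0. Summing (ln q / 4) w_j^2 over the prime
powers q^j <= X gives the second term of P_n(x). For q > X the group A is usually
trivial or of order q, and has 1 or 2 subgroups: this is the term ln 2 for each q
dividing phi(n). Hence the error is at most a sum of nonnegative terms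
([error_bound]): for small q multiples of ln q w_j, for large q multiples of
ln q w_1 (w_1 - 1), and terms in v and in the proper prime powers, which are
negligible.

The mean of each term over n <= x is found by counting multiples, and is expressed
through beta_m, the sum of 1 / p over the primes p <= x with p = 1 mod m. The
decisive term is the sum over the primes q > X of ln q beta_q^2. Selberg's sieve
([selberg_sieve]) gives beta_m = O((ln ln x + ln m) / m) uniformly in the prime
power m ([recip_primes_1mod_ln]), and also that the sum of ln q / q^2 over the
primes q > X is O(1 / X) ([sum_primes_ln_sqr_tail]). So the decisive term is
O((ln ln x)^2 / X) = O((ln ln x)^(3/2) / (ln ln ln x)^2), and the choice of X
leaves no room for losing a logarithm in either bound. Markov's inequality
([count_exceptional_le]) spends one factor ln ln ln x on the exceptional set and
leaves the other one in the error term. *)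

Local Open Scope group_scope.

(** * Counting the subgroups of a finite abelian group *)

Lemma abelian_pcoreS (gT : finGroupType) (G H : {group gT}) (pi : nat_pred) :
  abelian G -> H \subset G -> 'O_pi(H) \subset 'O_pi(G).
Proof.
move=> abG sHG; apply: pcore_max; first exact: pcore_pgroup.
have sOG : 'O_pi(H) \subset G := subset_trans (pcore_sub _ _) sHG.
by rewrite /normal sOG sub_abelian_norm.
Qed.

(** A subgroup of an abelian group is the product of its pi-part and its
pi'-part, and the two parts can be prescribed independently. *)
Lemma card_subgroups_pcore (gT : finGroupType) (G : {group gT}) (pi : nat_pred) :
  abelian G ->
  #|subgroups G| = (#|subgroups 'O_pi(G)| * #|subgroups 'O_pi^'(G)|)%N.
Proof.
move=> abG; rewrite -cardsX; apply/eqP; rewrite eqn_leq; apply/andP; split.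
  pose f (H : {group gT}) := ('O_pi(H)%G, 'O_pi^'(H)%G).
  have injf : {in subgroups G &, injective f}.
    move=> H K; rewrite !inE => sHG sKG [/= E1 E2]; apply: val_inj => /=.
    have nH : nilpotent H by apply: abelian_nil; apply: abelianS abG.
    have nK : nilpotent K by apply: abelian_nil; apply: abelianS abG.
    rewrite -(dprodW (nilpotent_pcoreC pi nH)) -(dprodW (nilpotent_pcoreC pi nK)).
    by rewrite E1 E2.
  rewrite -(card_in_imset injf); apply: subset_leq_card.
  apply/subsetP=> _ /imsetP[H + ->]; rewrite !inE /= => sHG.
  by rewrite !abelian_pcoreS.
pose g (AB : {group gT} * {group gT}) := (AB.1 <*> AB.2)%G.
have gE (AB : {group gT} * {group gT}) : 
    AB \in setX (subgroups 'O_pi(G)) (subgroups 'O_pi^'(G)) ->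
    'O_pi(g AB) = AB.1 /\ 'O_pi^'(g AB) = AB.2.
  case: AB => A B; rewrite !inE /= => /andP[sA sB].
  have sAG := subset_trans sA (pcore_sub _ _).
  have sBG := subset_trans sB (pcore_sub _ _).
  have pA : pi.-group A by apply: pgroupS sA (pcore_pgroup _ _).
  have pB : pi^'.-group B by apply: pgroupS sB (pcore_pgroup _ _).
  have sgG : A <*> B \subset G by rewrite join_subG sAG sBG.
  have eAB : A * B = A <*> B.
    by rewrite norm_joinEr // (subset_trans sBG) ?(sub_abelian_norm abG).
  have nA : A <| A <*> B by rewrite /normal joing_subl (subset_trans sgG) ?(sub_abelian_norm abG).
  have nB : B <| A <*> B by rewrite /normal joing_subr (subset_trans sgG) ?(sub_abelian_norm abG).
  split; apply: normal_Hall_pcore => //.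
    exact: (coprime_mulpG_Hall eAB pA pB).1.
  exact: (coprime_mulpG_Hall eAB pA pB).2.
have injg : {in setX (subgroups 'O_pi(G)) (subgroups 'O_pi^'(G)) &, injective g}.
  move=> [A B] [A' B'] /gE[/= E1 E2] /gE[/= E3 E4] eg.
  have egs : A <*> B = A' <*> B' := congr1 val eg.
  congr (_, _); apply: val_inj => /=; first by rewrite -E1 -E3 egs.
  by rewrite -E2 -E4 egs.
rewrite -(card_in_imset injg); apply: subset_leq_card.
apply/subsetP=> _ /imsetP[[A B] + ->]; rewrite !inE /= => /andP[sA sB].
by rewrite join_subG (subset_trans sA) ?pcore_sub // (subset_trans sB) ?pcore_sub.
Qed.

Lemma card_subgroups_Sylow (gT : finGroupType) (G : {group gT}) :
  abelian G -> #|subgroups G| = (\prod_(q <- primes #|G|) #|subgroups 'O_q(G)|)%N.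
Proof.
move=> abG.
have -> : subgroups G = subgroups 'O_[pred p | p \in primes #|G|](G).
  rewrite pcore_pgroup_id //; apply/pnatP; rewrite ?cardG_gt0 // => p pp dp.
  by rewrite inE mem_primes pp cardG_gt0 dp.
elim: (primes #|G|) (primes_uniq #|G|) => [_|q r IH /= /andP[qr /IH{}IH]].
  rewrite big_nil (_ : subgroups _ = [set 1%G]) ?cards1 //.
  apply/setP=> H; rewrite !inE.
  suff -> : 'O_[pred p | p \in [::]](G) = 1 by rewrite subG1.
  apply: card1_trivg; apply/eqP; rewrite eqn_leq cardG_gt0 andbT leqNgt.
  apply/negP => /pdivP[p pp dp].
  by have /pnatP := pcore_pgroup [pred p | p \in [::]] G; move/(_ (cardG_gt0 _) p pp dp).
rewrite big_cons -IH.
rewrite (card_subgroups_pcore q) ?(abelianS (pcore_sub _ _)) // -!pcoreI.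
have e1 : [predI (q : nat_pred) & [pred p | p \in q :: r]] =i (q : nat_pred).
  by move=> p; rewrite !inE; case: eqP.
have e2 : [predI (q^' : nat_pred) & [pred p | p \in q :: r]] =i [pred p | p \in r].
  by move=> p; rewrite !inE; case: eqP => [->|//] /=; rewrite (negbTE qr).
by rewrite (eq_pcore G e1) (eq_pcore G e2).
Qed.

Section PowerMap.
Variables (gT : finGroupType) (G : {group gT}) (abG : abelian G) (n : nat).

Fact expg_morphic : {in G &, {morph (fun x => x ^+ n) : x y / x * y}}.
Proof. by move=> x y Gx Gy; rewrite expgMn //; apply: (centsP abG). Qed.

Definition expg_morphism : {morphism G >-> gT} := Morphism expg_morphic.

Lemma ker_expg_morphism : 'ker expg_morphism = 'Ldiv_n(G).
Proof. by apply/setP=> x; rewrite !inE. Qed.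

(** The first isomorphism theorem for the map x |-> x^n. *)
Lemma card_Ldiv_expg : (#|'Ldiv_n(G)| * #|expg_morphism @* G| = #|G|)%N.
Proof.
rewrite -ker_expg_morphism card_morphim setIid.
by rewrite Lagrange // subsetIl.
Qed.

Lemma expg_morphism_sub : expg_morphism @* G \subset G.
Proof.
by apply/subsetP=> _ /morphimP[x _ Gx ->] /=; rewrite groupX.
Qed.

End PowerMap.

Lemma card_join_cycle_leq (gT : finGroupType) (A K : {group gT}) (x : gT) (d : nat) :
  abelian A -> K \subset A -> x \in A -> (0 < d)%N -> x ^+ d \in K ->
  (#|K <*> <[x]>| <= #|K| * d)%N.
Proof.
move=> abA sKA Ax d0 xdK.
rewrite norm_joinEr; last first.
  by rewrite cycle_subG (subsetP (sub_abelian_norm abA sKA)).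
pose f (u : gT * 'I_d) := u.1 * x ^+ u.2.
apply: (@leq_trans #|f @: setX K [set: 'I_d]|); last first.
  by apply: leq_trans (leq_imset_card _ _) _; rewrite cardsX cardsT card_ord.
apply: subset_leq_card; apply/subsetP=> _ /mulsgP[k _ Kk /cycleP[c ->] ->].
apply/imsetP; exists (k * x ^+ (c %/ d * d), Ordinal (ltn_pmod c d0)).
  by rewrite !inE andbT groupM // mulnC expgM groupX.
by rewrite /f /= -mulgA -expgD -divn_eq.
Qed.

(** Adjoining the generators one at a time, each of them multiplies the order by
at most the exponent that brings it back into K. *)
Lemma card_join_gen_leq (gT : finGroupType) (A K : {group gT}) (r : seq (gT * nat)) :
  abelian A -> K \subset A ->
  (forall u, u \in r -> [/\ u.1 \in A, (0 < u.2)%N & u.1 ^+ u.2 \in K]) ->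
  (#|K <*> <<[set x in map fst r]>>| <= #|K| * \prod_(u <- r) u.2)%N.
Proof.
move=> abA sKA; elim: r => [_|[x d] r IH hr].
  have -> : [set x in map fst ([::] : seq (gT * nat))] = set0
    by apply/setP=> x; rewrite !inE.
  by rewrite big_nil muln1 gen0 joingG1.
have [|Ax d0 xdK] := hr (x, d); first by rewrite mem_head.
have {}IH := IH (fun u ur => hr u (mem_behead (s := (x, d) :: r) ur)).
set S := [set x in map fst r] in IH.
have sSA : S \subset A.
  apply/subsetP=> y; rewrite inE => /mapP[u ur ->].
  by have [] := hr u (mem_behead (s := (x, d) :: r) ur).
have sKS : K <*> <<S>> \subset A by rewrite join_subG sKA gen_subG.
have -> : K <*> <<[set y in map fst ((x, d) :: r)]>> = (K <*> <<S>>) <*> <[x]>.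
  rewrite -joingA; congr (_ <*> _).
  by rewrite /= set_cons setUC /cycle joing_idl joing_idr.
have := @card_join_cycle_leq gT A (K <*> <<S>>) x d abA sKS Ax d0.
rewrite /= big_cons mulnCA => /(_ (subsetP (joing_subl _ _) _ xdK)) h.
by apply: leq_trans h _; rewrite mulnC leq_mul2l IH orbT.
Qed.

(** Put Q = q^m. The Q-torsion of a finite abelian group H has the order of H / H^Q,
and this quotient is generated by the images of the t i, each of order dividing
q^(min (m, mu i)). *)
Lemma card_Ldiv_gen_leq (gT : finGroupType) (A : {group gT}) (r q m : nat)
    (t : 'I_r -> gT) (mu : 'I_r -> nat) : 
  abelian A -> (0 < q)%N -> (forall i, t i \in 'Ldiv_(q ^ mu i)(A)) ->
  (#|'Ldiv_(q ^ m)(<<[set t i | i : 'I_r]>>)| <= q ^ (\sum_i minn m (mu i)))%N.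
Proof.
move=> abA q0 ht; pose H := <<[set t i | i : 'I_r]>>%G.
have sHA : H \subset A.
  by rewrite gen_subG; apply/subsetP=> _ /imsetP[i _ ->]; case/LdivP: (ht i).
have abH : abelian H := abelianS sHA abA.
have tH i : t i \in H by apply: mem_gen; apply: imset_f.
pose K := (expg_morphism abH (q ^ m) @* H)%G.
have sKH : K \subset H := expg_morphism_sub _ _.
have mon i : (0 < q ^ minn m (mu i))%N by rewrite expn_gt0 q0.
have tK i : t i ^+ (q ^ minn m (mu i)) \in K.
  case: leqP => _; first by apply: (@mem_morphim _ _ _ (expg_morphism abH (q ^ m))).
  by case/LdivP: (ht i) => _ ->.
pose s := [seq (t i, q ^ minn m (mu i))%N | i : 'I_r].
have := @card_join_gen_leq gT H K s abH sKH.
have -> : K <*> <<[set x in map fst s]>> = H.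
  apply/eqP; rewrite eqEsubset join_subG sKH /= gen_subG; apply/andP; split.
    by apply/subsetP=> x; rewrite inE => /mapP[_ /imageP[i _ ->] ->]; apply: tH.
  rewrite gen_subG; apply/subsetP=> _ /imsetP[i _ ->].
  apply: (subsetP (joing_subr _ _)); apply: mem_gen; rewrite inE -map_comp.
  by apply/mapP; exists i => //; rewrite mem_enum.
have hs u : u \in s -> [/\ u.1 \in H, (0 < u.2)%N & u.1 ^+ u.2 \in K].
  by move=> /imageP[i _ ->]; split; [exact: tH | exact: mon | exact: tK].
move=> /(_ hs); rewrite -(card_Ldiv_expg abH (q ^ m)) mulnC leq_pmul2l ?cardG_gt0 //.
by rewrite /s big_map expn_sum big_enum.
Qed.

(** Tuples t with t i of order dividing q^(mu i) are counted according to the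
subgroup H that they generate. [card_Ldiv_gen_leq], applied to any one such tuple,
bounds the number of choices for each entry inside H. *)
Lemma prod_Ldiv_leq_subgroups (gT : finGroupType) (A : {group gT}) (r q : nat)
    (mu : 'I_r -> nat) :
  abelian A -> (0 < q)%N ->
  (\prod_i #|'Ldiv_(q ^ mu i)(A)| <=
     #|subgroups A| * q ^ (\sum_i \sum_k minn (mu i) (mu k)))%N.
Proof.
move=> abA q0.
pose Fam := [set f : {ffun 'I_r -> gT} | [forall i, f i \in 'Ldiv_(q ^ mu i)(A)]].
pose F (f : {ffun 'I_r -> gT}) := <<[set f i | i : 'I_r]>>%G.
have -> : (\prod_i #|'Ldiv_(q ^ mu i)(A)| = #|Fam|)%N.
  rewrite -[RHS](_ : #|family (fun i => mem 'Ldiv_(q ^ mu i)(A))| = _).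
    by rewrite card_family foldrE big_map big_enum.
  by apply: eq_card => f; rewrite [RHS]inE; apply/familyP/forallP.
have FamP f : f \in Fam -> forall i, f i \in 'Ldiv_(q ^ mu i)(A).
  by rewrite inE => /forallP.
have sF f : f \in Fam -> F f \in subgroups A.
  move=> /FamP hf; rewrite inE gen_subG.
  by apply/subsetP=> _ /imsetP[i _ ->]; case/LdivP: (hf i).
rewrite -sum1_card (partition_big F (mem (subgroups A))) //=.
rewrite -sum_nat_const; apply: leq_sum => H _.
case: (pickP [pred f | (f \in Fam) && (F f == H)]) => [f0 /andP[f0F /eqP eH]|h]; last first.
  by rewrite big_pred0.
have hf0 := FamP _ f0F.
rewrite sum1_card expn_sum.
apply: (@leq_trans #|family (fun i => mem 'Ldiv_(q ^ mu i)(H))|).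
  apply: subset_leq_card; apply/subsetP=> f; rewrite inE => /andP[/FamP hf /eqP <-].
  apply/familyP=> i; have /LdivP[_ e] := hf i; apply/LdivP; split=> //.
  by apply: mem_gen; apply: imset_f.
rewrite card_family foldrE big_map big_enum; apply: leq_prod => i _.
by rewrite -eH; apply: (card_Ldiv_gen_leq (mu i) abA q0 hf0).
Qed.

(** P is the indicator of an initial segment of the integers, and the bound of
the left-hand sum is the length of that segment. *)
Lemma sum_initial_segment (P : pred nat) (g : nat -> nat) (L : nat) :
  (forall i j, i <= j -> P j -> P i)%N ->
  (\sum_(j < \sum_(i < L) P i) g j = \sum_(j < L) P j * g j)%N.
Proof.
move=> hP; elim: L => [|L IH]; first by rewrite !big_ord0.
rewrite [RHS]big_ord_recr /= -IH [in LHS]big_ord_recr /=.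
case PL: (P L); last by rewrite addn0 mul0n addn0.
have -> : (\sum_(i < L) P i = L)%N.
  rewrite -[RHS]card_ord -sum1_card; apply: eq_bigr => i _.
  by rewrite (hP i L) // ltnW.
by rewrite addn1 big_ord_recr /= mul1n.
Qed.

Lemma sum_ltn_nat (r b : nat) : (b <= r)%N -> (\sum_(i < r) (i < b) = b)%N.
Proof.
move=> br; rewrite -[RHS](minn_idPr br); elim: r {br} => [|r IH]; first by rewrite big_ord0 min0n.
by rewrite big_ord_recr /= IH; lia.
Qed.

(** The subgroups produced are generated by elements of orders dividing q^(mu i),
where mu is the partition conjugate to b_j = w_j / 2. In terms of b both exponents
of [prod_Ldiv_leq_subgroups] are sums over j, of w_j b_j and of b_j^2. The choice
of b_j makes b_j (w_j - b_j) as large as possible, about w_j^2 / 4. *)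
Lemma card_subgroups_lower (gT : finGroupType) (A : {group gT}) (q L : nat) (w : nat -> nat) :
  abelian A -> (1 < q)%N -> (forall i j, i <= j -> w j <= w i)%N ->
  (forall m, m <= L -> q ^ (\sum_(j < m) w j) <= #|'Ldiv_(q ^ m)(A)|)%N ->
  (q ^ (\sum_(j < L) (w j)./2 * (w j - (w j)./2)) <= #|subgroups A|)%N.
Proof.
move=> abA q1 wm hT; have q0 : (0 < q)%N by apply: ltnW.
pose b j := (w j)./2.
have bm i j : (i <= j)%N -> (b j <= b i)%N by move=> ij; apply: half_leq; apply: wm.
pose mu (i : 'I_(b 0)) := (\sum_(j < L) (i < b j))%N.
have seg (i : nat) k j : (k <= j)%N -> (i < b j)%N -> (i < b k)%N.
  by move=> kj /leq_trans; apply; apply: bm.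
have muL i : (mu i <= L)%N.
  by rewrite -[leqRHS]card_ord -sum1_card; apply: leq_sum => j _; case: (_ < _)%N.
have := @prod_Ldiv_leq_subgroups gT A (b 0) q mu abA q0.
have h1 : (q ^ (\sum_(j < L) b j * w j) <= \prod_i #|'Ldiv_(q ^ mu i)(A)|)%N.
  have -> : (\sum_(j < L) b j * w j = \sum_(i < b 0) \sum_(j < mu i) w j)%N.
    under [RHS]eq_bigr => i _ do rewrite (sum_initial_segment _ _ (seg i)).
    rewrite exchange_big /=; apply: eq_bigr => j _.
    by rewrite -big_distrl /= sum_ltn_nat // bm.
  by rewrite expn_sum; apply: leq_prod => i _; apply: hT.
have -> : (\sum_i \sum_k minn (mu i) (mu k) = \sum_(j < L) b j * b j)%N.
  have E i k : (minn (mu i) (mu k) = \sum_(j < L) (i < b j) * (k < b j))%N.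
    wlog ik : i k / (i <= k)%N => [th|].
      case/orP: (leq_total i k) => /th //; rewrite minnC => ->.
      by apply: eq_bigr => j _; rewrite mulnC.
    have lt (j : 'I_L) : ((i < b j) * (k < b j) = (k < b j))%N.
      by case: (ltnP k (b j)) => [/(leq_ltn_trans ik) ->|]; rewrite ?muln0.
    rewrite (eq_bigr _ (fun j _ => lt j)); apply/minn_idPr; apply: leq_sum => j _.
    by rewrite -lt; do 2!case: (_ < _)%N.
  under eq_bigr => i _ do under eq_bigr => k _ do rewrite E.
  under eq_bigr => i _ do rewrite exchange_big /=.
  rewrite exchange_big /=; apply: eq_bigr => j _.
  under eq_bigr => i _ do rewrite -big_distrr /= sum_ltn_nat ?bm //.
  by rewrite -big_distrl /= sum_ltn_nat ?bm.
move/(leq_trans h1).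
have -> : (\sum_(j < L) b j * w j = 
  \sum_(j < L) b j * (w j - b j) + \sum_(j < L) b j * b j)%N.
  rewrite -big_split /=; apply: eq_bigr => j _; rewrite -mulnDr subnK // /b.
  by rewrite -divn2 leq_div.
by rewrite expnD leq_pmul2r ?expn_gt0 ?q0.
Qed.

Definition gen_tuples (gT : finGroupType) (H K : {set gT}) b :=
  [set t : b.-tuple gT | K <*> <<[set x in t]>> == H].

Lemma card_proper_pgroup (gT : finGroupType) (H K : {group gT}) q :
  prime q -> q.-group H -> K \proper H -> (q * #|K| <= #|H|)%N.
Proof.
move=> pq qH prKH; have sKH := proper_sub prKH.
rewrite -(Lagrange sKH) mulnC leq_pmul2l ?cardG_gt0 //.
have i1 : (1 < #|H : K|)%N by rewrite indexg_gt1 proper_subn.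
have : q.-nat #|H : K| by apply: pnat_dvd qH; rewrite dvdn_indexg.
case/p_natP=> [[|e] e_]; rewrite e_ // in i1 *.
by rewrite expnS leq_pmulr // expn_gt0 prime_gt0.
Qed.

(** While K is a proper subgroup, at least half of the elements of H lie outside
K, and adjoining one of them multiplies the order of K by at least q. So after b
such choices H is reached. *)
Lemma card_gen_tuples (gT : finGroupType) (H : {group gT}) q b (K : {group gT}) :
  prime q -> q.-group H -> K \subset H -> (#|H| <= q ^ b * #|K|)%N ->
  (#|H| ^ b <= 2 ^ b * #|gen_tuples H K b|)%N.
Proof.
move=> pq qH; elim: b K => [|b IH] K sKH hc.
  rewrite !expn0 mul1n card_gt0; apply/set0Pn; exists [tuple].
  rewrite inE; have -> : [set x in [tuple of nil : seq gT]] = set0.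
    by apply/setP=> x; rewrite !inE.
  by rewrite gen0 joingG1 eqEcard sKH -[#|K|]mul1n.
(* The first entry of the tuple may be anything when K is already H. *)
pose U := if K == H then H : {set gT} else H :\: K.
have sUH : U \subset H by rewrite /U; case: ifP => _ //; apply: subsetDl.
have cU : (#|H| <= 2 * #|U|)%N.
  rewrite /U; case: ifP => [_|neq]; first by rewrite leq_pmull.
  have prKH : K \proper H.
    by rewrite properEneq sKH andbT; apply/eqP => /val_inj e; rewrite e eqxx in neq.
  have := card_proper_pgroup pq qH prKH; rewrite cardsD (setIidPr sKH).
  move=> hq; have : (2 * #|K| <= #|H|)%N.
    by apply: leq_trans hq; rewrite leq_mul2r prime_gt1 ?orbT.
  by move: #|K| #|H| => x y; lia.
have step h : h \in U -> (#|H| ^ b <= 2 ^ b * #|gen_tuples H (K <*> <[h]>) b|)%N.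
  move=> Uh; have Hh := subsetP sUH _ Uh.
  apply: IH; first by rewrite join_subG sKH cycle_subG.
  move: Uh; rewrite /U; case: ifP => [/eqP e _|neq].
    have e1 : K <*> <[h]> = H.
      by apply/eqP; rewrite eqEsubset join_subG sKH cycle_subG Hh /= e joing_subl.
    by rewrite /= e1 leq_pmull // expn_gt0 prime_gt0.
  rewrite inE => /andP[nKh _].
  have sK1 : K <*> <[h]> \subset H by rewrite join_subG sKH cycle_subG.
  have prK : K \proper K <*> <[h]>.
    rewrite properE joing_subl /=; apply/negP => /subsetP/(_ h) hh.
    by case/negP: nKh; apply: hh; apply: (subsetP (joing_subr _ _)); apply: cycle_id.
  have := card_proper_pgroup pq (pgroupS sK1 qH) prK.
  move: hc; rewrite expnSr -mulnA => hc hq; apply: leq_trans hc _.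
  by rewrite leq_mul2l hq orbT.
pose D := [set p : gT * b.-tuple gT | (p.1 \in U) && (p.2 \in gen_tuples H (K <*> <[p.1]>) b)].
have cD : (#|D| = \sum_(h in U) #|gen_tuples H (K <*> <[h]>) b|)%N.
  rewrite -sum1_card; under [RHS]eq_bigr => h _ do rewrite -sum1_card.
  by rewrite pair_big_dep /=; apply: eq_bigl => p; rewrite inE.
have sD : (#|D| <= #|gen_tuples H K b.+1|)%N.
  pose c (p : gT * b.-tuple gT) := cons_tuple p.1 p.2.
  have injc : injective c.
    by move=> [h t] [h' t'] /(congr1 val) [-> e]; congr (_, _); apply: val_inj.
  rewrite -(card_imset _ injc); apply: subset_leq_card.
  apply/subsetP=> _ /imsetP[[h t] + ->]; rewrite !inE /= => /andP[_ /eqP <-].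
  have -> : <<[set x in h :: t]>> = <[h]> <*> <<[set x in t]>>.
    by rewrite set_cons /cycle joing_idl joing_idr.
  by rewrite joingA.
apply: (@leq_trans (2 ^ b.+1 * #|D|)); last by rewrite leq_mul2l sD orbT.
rewrite cD expnS expnS -mulnA big_distrr /=.
apply: (@leq_trans (2 * #|U| * #|H| ^ b)); first by rewrite leq_mul2r cU orbT.
by rewrite -mulnA leq_mul2l /= -sum_nat_const; apply: leq_sum.
Qed.

Lemma leq_card_bigcup (I T : finType) (P : pred I) (F : I -> {set T}) :
  (#|\bigcup_(i | P i) F i| <= \sum_(i | P i) #|F i|)%N.
Proof.
elim/big_rec2: _ => [|i n U _ h]; first by rewrite cards0.
by apply: leq_trans (leq_card_setU _ _) _; rewrite leq_add2l.
Qed.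

Lemma mul_sub_leq_quarter a b : (b <= a)%N -> (b * (a - b) <= (a * a) %/ 4)%N.
Proof.
move=> ba; have := subnK ba; move: (a - b)%N => c <-; rewrite leq_divRL //.
have [bc|cb] := leqP b c.
  by have [d ->] : exists d, c = (b + d)%N; [exists (c - b)%N; lia | nia].
by have [d ->] : exists d, b = (c + d)%N; [exists (b - c)%N; lia | nia].
Qed.

Section UpperStep.
Variables (gT : finGroupType) (A : {group gT}) (q a : nat).
Hypotheses (abA : abelian A) (pq : prime q) (qA : q.-group A).
Hypothesis cardT : #|'Ldiv_q(A)| = (q ^ a)%N.
Let f := expg_morphism abA q.

Lemma card_expg_image (H : {group gT}) :
  H \subset A -> (#|'Ldiv_q(H)| * #|f @* H| = #|H|)%N.
Proof.
move=> sHA; rewrite -[RHS](card_Ldiv_expg (abelianS sHA abA) q).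
suff -> : f @* H = expg_morphism (abelianS sHA abA) q @* H by [].
apply/setP=> y; apply/morphimP/morphimP => [[x Ax Hx ->]|[x Hx _ ->]].
  by exists x.
by exists x => //; apply: (subsetP sHA).
Qed.

(** At least (|H| / 2)^b of the b-tuples of elements of H generate H over its
subgroup H' = H^q. Their entries lie in the set of x with x^q in H', which has
q^a |H'| elements, and a tuple determines H as the subgroup that it generates
together with H'. *)
Lemma card_subgroups_fiber (H' : {group gT}) b :
  H' \subset f @* A -> 
  (#|[set H in subgroups A | (f @* H == H') && (#|H| == q ^ b * #|H'|)]|
     <= 2 ^ b * q ^ (b * (a - b)))%N.
Proof.
move=> sH'; set Cls := [set _ in _ | _].
have [->|[H0]] := set_0Vmem Cls; first by rewrite cards0.
rewrite !inE => /andP[sH0 /andP[/eqP fH0 /eqP cH0]].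
have ba : (b <= a)%N.
  rewrite -(@leq_exp2l q) ?prime_gt1 // -cardT.
  have := card_expg_image sH0; rewrite fH0 cH0 => /eqP.
  rewrite eqn_pmul2r ?cardG_gt0 // => /eqP <-.
  by apply: subset_leq_card; apply: setSI.
pose Lq := f @*^-1 H'.
have cL : #|Lq| = (q ^ a * #|H'|)%N.
  by rewrite card_morphpre // ker_expg_morphism cardT.
pose X := [set t : b.-tuple gT | all (mem Lq) t].
have cX : (#|X| <= #|Lq| ^ b)%N.
  rewrite -(card_sig (mem Lq)) -card_tuple -cardsT.
  pose vals (t : b.-tuple {x | x \in Lq}) : b.-tuple gT := [tuple of map val t].
  apply: leq_trans (leq_imset_card vals _); apply: subset_leq_card.
  apply/subsetP=> t; rewrite inE => /allP ht; apply/imsetP.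
  have hti i : tnth t i \in Lq by apply: ht; apply: mem_tnth.
  exists [tuple exist _ (tnth t i) (hti i) | i < b]; rewrite ?inE //.
  by apply: eq_from_tnth => i; rewrite tnth_map tnth_mktuple.
have key : (#|Cls| * (q ^ b * #|H'|) ^ b <= 2 ^ b * #|X|)%N.
  rewrite -sum_nat_const.
  apply: (@leq_trans (\sum_(H in Cls) 2 ^ b * #|gen_tuples H H' b|)%N).
    apply: leq_sum => H; rewrite !inE => /andP[sH /andP[/eqP fH /eqP cH]].
    rewrite -cH; apply: card_gen_tuples pq (pgroupS sH qA) _ _; last by rewrite cH.
    rewrite -fH; apply/subsetP=> _ /morphimP[x _ Hx ->].
    exact: groupX.
  rewrite -big_distrr leq_mul2l /=; apply/orP; right.
  (* The sets of generating tuples of the various H are disjoint fibres of F. *)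
  pose F (t : b.-tuple gT) := (H' <*> <<[set x in t]>>)%G.
  rewrite -[leqRHS]sum1_card (bigID (fun t => F t \in Cls)) /=.
  apply: leq_trans (leq_addr _ _).
  rewrite (partition_big F (mem Cls)) /=; last by move=> t /andP[].
  apply: leq_sum => H CH; rewrite sum1_card; apply: subset_leq_card.
  apply/subsetP=> t; rewrite inE => /eqP eH.
  have FH : F t = H by apply: val_inj.
  rewrite unfold_in /= FH eqxx CH !andbT inE; apply/allP=> x xt.
  move: CH; rewrite !inE => /andP[sH /andP[/eqP fH _]].
  have Hx : x \in H.
    by rewrite -FH; apply: (subsetP (joing_subr _ _)); apply: mem_gen; rewrite inE.
  apply/andP; split; first exact: (subsetP sH).
  by rewrite -fH; apply: mem_morphim => //; apply: (subsetP sH).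
have {}key := leq_trans key (leq_mul (leqnn _) cX).
move: key; rewrite cL !expnMn mulnA mulnA leq_pmul2r ?expn_gt0 ?cardG_gt0 //.
rewrite -!expnM => key.
rewrite -(@leq_pmul2r (q ^ (b * b))) ?expn_gt0 ?prime_gt0 //.
by rewrite -mulnA -expnD -mulnDr subnK // (mulnC b a).
Qed.

(** Sum [card_subgroups_fiber] over H' and over b. Each b (a - b) is at most
a^2 / 4, and the factor 2^b and the a + 1 possible values of b each cost at most
a factor q^a. *)
Lemma card_subgroups_step :
  (#|subgroups A| <= q ^ ((a * a) %/ 4 + 2 * a) * #|subgroups (f @* A)%G|)%N.
Proof.
have q1 := prime_gt1 pq.
pose C (H' : {group gT}) (b : 'I_a.+1) :=
  [set H in subgroups A | (f @* H == H') && (#|H| == q ^ b * #|H'|)]%N.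
have cover : subgroups A \subset \bigcup_(H' in subgroups (f @* A)%G) \bigcup_b C H' b.
  apply/subsetP=> H; rewrite inE => sHA; apply/bigcupP.
  exists (f @* H)%G; first by rewrite inE morphimS.
  have := card_expg_image sHA.
  have qL : q.-group 'Ldiv_q(H).
    have sg := group_Ldiv q (abelianS sHA abA).
    apply: (@pgroupS _ _ _ (Group sg)) (pgroupS sHA qA).
    by apply: subsetIl.
  case/p_natP: qL => b eb; rewrite eb => e.
  have ba : (b < a.+1)%N.
    rewrite ltnS -(@leq_exp2l q) // -cardT -eb.
    by apply: subset_leq_card; apply: setSI.
  by apply/bigcupP; exists (Ordinal ba) => //; rewrite !inE sHA eqxx /= -e eqxx.
apply: leq_trans (subset_leq_card cover) _.
apply: (@leq_trans (\sum_(H' in subgroups (f @* A)%G) q ^ ((a * a) %/ 4 + 2 * a))%N); last first.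
  by rewrite sum_nat_const mulnC.
apply: leq_trans (leq_card_bigcup _ _) _; apply: leq_sum => H'; rewrite inE => sH'.
apply: leq_trans (leq_card_bigcup _ _) _.
apply: (@leq_trans (\sum_(b < a.+1) 2 ^ a * q ^ ((a * a) %/ 4))%N).
  apply: leq_sum => b _; apply: leq_trans (card_subgroups_fiber b sH') _.
  have ba : (b <= a)%N by rewrite -ltnS.
  apply: leq_mul; first by rewrite leq_exp2l.
  by rewrite leq_exp2l // mul_sub_leq_quarter.
rewrite sum_nat_const card_ord mulnA expnD mulnC leq_mul2l mul2n -addnn expnD.
apply/orP; right; apply: leq_mul.
  apply: (@leq_trans (2 ^ a)); first exact: ltn_expl.
  by case: (posnP a) => a0; [rewrite a0 | rewrite leq_exp2r].
by case: (posnP a) => a0; [rewrite a0 | rewrite leq_exp2r].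
Qed.
End UpperStep.

(** The map x |-> x^q shifts the sequence a by one, so that
[card_subgroups_step] can be iterated L times. *)
Lemma card_subgroups_upper (gT : finGroupType) (L : nat) (A : {group gT}) (q : nat)
    (a : nat -> nat) :
  abelian A -> prime q -> q.-group A ->
  (forall m, #|'Ldiv_(q ^ m)(A)| = q ^ (\sum_(j < m) a j))%N ->
  A \subset 'Ldiv_(q ^ L)() ->
  (#|subgroups A| <= q ^ (\sum_(j < L) ((a j * a j) %/ 4 + 2 * a j)))%N.
Proof.
elim: L A a => [|L IH] A a abA pq qA hT eA.
  rewrite big_ord0 expn0; suff -> : subgroups A = [set 1%G] by rewrite cards1.
  have A1 : A :=: 1.
    apply/trivgP; apply/subsetP=> x /(subsetP eA); rewrite !inE expn0 expg1.
    by [].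
  by apply/setP=> H; rewrite !inE A1 subG1.
have hT1 : #|'Ldiv_q(A)| = (q ^ a 0)%N.
  by have := hT 1%N; rewrite expn1 big_ord1.
have := card_subgroups_step abA pq qA hT1.
set f := expg_morphism abA q; set B := (f @* A)%G => step.
have abB : abelian B by apply: morphim_abelian.
have sBA : B \subset A by apply: expg_morphism_sub.
have preL m : f @*^-1 'Ldiv_(q ^ m)(B) = 'Ldiv_(q ^ m.+1)(A).
  apply/setP=> x; rewrite !inE /= -expgM -expnS.
  case Ax : (x \in A) => //=.
  by have /= -> := mem_morphim f Ax Ax.
rewrite big_ord_recl expnD; apply: leq_trans step _; rewrite leq_mul2l.
apply/orP; right; apply: (IH B (fun j => a j.+1)) => // [|m|].
- exact: pgroupS sBA qA.
- have gL := group_Ldiv (q ^ m) abB.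
  have := @card_morphpre _ _ _ f (Group gL) (subsetIl _ _).
  rewrite /= preL hT ker_expg_morphism hT1 big_ord_recl expnD => /eqP.
  by rewrite eqn_pmul2l ?expn_gt0 ?prime_gt0 // => /eqP.
apply/subsetP=> _ /morphimP[x _ Ax ->].
by have := subsetP eA x Ax; rewrite !inE /= -expgM -expnS.
Qed.

(** * Torsion of the unit group modulo n *)

Definition unity_roots n d := [set x : 'I_n | (x ^ d == 1 %[mod n])%N].
Definition nroots n d := #|unity_roots n d|.

(** The Chinese remainder theorem. *)
Lemma nroots_mul m k d : coprime m k -> (0 < m)%N -> (0 < k)%N ->
  nroots (m * k) d = (nroots m d * nroots k d)%N.
Proof.
move=> cop m0 k0; rewrite /nroots -cardsX.
pose f (x : 'I_(m * k)) := (Ordinal (ltn_pmod x m0), Ordinal (ltn_pmod x k0)).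
have injf : injective f.
  move=> x y [e1 e2]; apply: val_inj => /=.
  rewrite -(modn_small (ltn_ord x)) -(modn_small (ltn_ord y)); apply/eqP.
  by rewrite chinese_remainder // e1 e2 !eqxx.
rewrite -(card_imset _ injf); congr #|pred_of_set _|.
apply/setP=> -[a b]; rewrite !inE /=; apply/imsetP/andP.
  move=> [x + [-> ->]]; rewrite inE chinese_remainder //= => /andP[h1 h2].
  by rewrite !modnXm.
move=> [ha hb]; have mk0 : (0 < m * k)%N by rewrite muln_gt0 m0.
exists (Ordinal (ltn_pmod (chinese m k a b) mk0)).
  rewrite inE /= modnXm chinese_remainder //.
  rewrite -(modnXm d m) -(modnXm d k) chinese_modl // chinese_modr //.
  by rewrite !modnXm ha hb.
congr (_, _); apply: val_inj => /=.
  by rewrite modn_dvdm ?dvdn_mulr // chinese_modl // modn_small.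
by rewrite modn_dvdm ?dvdn_mull // chinese_modr // modn_small.
Qed.

Lemma nroots_prod n d : (0 < n)%N ->
  nroots n d = (\prod_(p <- primes n) nroots (p ^ logn p n) d)%N.
Proof.
move=> n0; have [r er] : {r | r = primes n} by exists (primes n).
elim: r n n0 er => [|p r IH] n n0 er.
  rewrite -er big_nil; have -> : n = 1%N.
    by move: er; case: n n0 => [|[|n]] // _ /esym/eqP; rewrite primes_eq0.
  by rewrite /nroots (_ : unity_roots _ _ = setT) ?cardsT ?card_ord //;
    apply/setP=> x; rewrite !inE !modn1.
have pr : p \in primes n by rewrite -er mem_head.
move: (pr); rewrite mem_primes => /and3P[pp _ pn].
have un : uniq (p :: r) by rewrite er primes_uniq.
have e1 : n = (n`_p * n`_p^')%N by rewrite partnC.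
have e2 : r = primes (n`_p^')%N.
  rewrite primes_part -er /= !inE eqxx /=; apply/esym/all_filterP/allP => s sr.
  by rewrite !inE; apply/eqP => es; move: un => /=; rewrite -es sr.
rewrite {1}e1 nroots_mul ?part_gt0 ?coprime_partC // -er big_cons p_part.
rewrite (IH (n`_p^')%N) ?part_gt0 // -e2; congr (_ * _)%N.
apply: eq_big_seq => s sr.
have ns : s != p by apply/eqP => es; move: un => /=; rewrite -es sr.
have sP : prime s by move: sr; rewrite e2 mem_primes => /andP[].
have -> : logn s n = logn s (n`_p * n`_p^')%N by rewrite partnC.
by rewrite lognM ?part_gt0 // p_part lognX (logn_prime s pp) (negbTE ns) muln0.
Qed.

Lemma nroots1 d : nroots 1 d = 1%N.
Proof.
rewrite /nroots (_ : unity_roots _ _ = setT) ?cardsT ?card_ord //.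
by apply/setP=> x; rewrite !inE !modn1.
Qed.

Lemma card_Ldiv_units n d : (0 < n)%N -> (0 < d)%N ->
  #|'Ldiv_d([set: {unit 'Z_n}])| = nroots n d.
Proof.
case: n => [|[|n]] // _ d0.
  (* For n = 1 the ring 'Z_n is the field with two elements; its only unit
     corresponds to the only residue modulo 1. *)
  rewrite nroots1; apply/eqP; rewrite eqn_leq; apply/andP; split.
    apply: (@leq_trans #|units_Zp 1|); last by rewrite card_units_Zp.
    by apply: subset_leq_card; apply: subsetIl.
  by rewrite card_gt0; apply/set0Pn; exists 1; rewrite !inE expg1n eqxx.
rewrite /nroots -(card_imset _ (val_inj : injective (val : {unit 'Z_n.+2} -> 'Z_n.+2))).
congr #|pred_of_set _|; apply/setP=> x; rewrite !inE.
have powE (y : 'Z_n.+2) : (y ^+ d == 1)%R = ((y : nat) ^ d == 1 %[mod n.+2])%N.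
  rewrite -{1}(natr_Zp y) -GRing.natrX -val_eqE /=.
  by rewrite val_Zp_nat.
rewrite -[RHS]powE; apply/imsetP/idP.
  by move=> [u + ->]; rewrite !inE /= => /eqP h; rewrite -FinRing.val_unitX h.
move=> hx; have ux : (x : 'Z_n.+2) \is a GRing.unit.
  by rewrite -(GRing.unitrX_pos _ d0) (eqP hx) GRing.unitr1.
exists (FinRing.unit _ ux) => //; rewrite !inE -val_eqE FinRing.val_unitX /=.
exact: hx.
Qed.

Lemma nroots_exp1 n : (0 < n)%N -> nroots n 1 = 1%N.
Proof.
move=> n0; rewrite -card_Ldiv_units // (_ : 'Ldiv_1(_) = [set 1]) ?cards1 //.
by apply/setP=> u; rewrite !inE expg1.
Qed.

(** A q-group has subgroups of every order dividing its own. *)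
Lemma leq_card_Ldiv_pow (gT : finGroupType) (G : {group gT}) q j : 
  abelian G -> prime q -> (j <= logn q #|G|)%N -> (q ^ j <= #|'Ldiv_(q ^ j)(G)|)%N.
Proof.
move=> abG pq jle.
have nG : 'O_q(G) <| 'O_q(G) by apply: normal_refl.
have cO : logn q #|'O_q(G)| = logn q #|G|.
  rewrite (card_Hall (nilpotent_pcore_Hall q (abelian_nil abG))).
  by rewrite p_part pfactorK.
have [|Q [sQ _ cQ]] := normal_pgroup (r := j) (pcore_pgroup q G) nG.
  by rewrite cO.
rewrite -cQ; apply: subset_leq_card; apply/subsetP=> x Qx; apply/LdivP; split.
  by apply: (subsetP (pcore_sub q G)); apply: (subsetP sQ).
by apply/eqP; rewrite -order_dvdn order_dvdG.
Qed.

Lemma card_Ldiv_pnat (gT : finGroupType) (G : {group gT}) q j :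
  abelian G -> prime q -> exists2 c, #|'Ldiv_(q ^ j)(G)| = (q ^ c)%N & (c <= logn q #|G|)%N.
Proof.
move=> abG pq; pose T := Group (group_Ldiv (q ^ j) abG).
have qT : q.-group T.
  apply/pgroupP => r pr; case/Cauchy=> // x Tx ox.
  move: Tx; rewrite !inE => /andP[_ /eqP/eqP]; rewrite -order_dvdn ox.
  by rewrite Euclid_dvdX // => /andP[/prime_nt_dvdP -> //]; rewrite ?inE //; case: r pr ox => [|[]].
have [c ec] := p_natP qT.
exists c; first exact: ec.
have : (#|T| %| #|G|)%N by apply: cardSg; apply: subsetIl.
by rewrite ec pfactor_dvdn.
Qed.


Lemma nroots_leq n d e : (d %| e)%N -> (nroots n d <= nroots n e)%N.
Proof.
case/dvdnP=> k ->; apply: subset_leq_card; apply/subsetP=> x; rewrite !inE => /eqP h.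
by rewrite mulnC expnM -modnXm h modnXm exp1n.
Qed.

Lemma units_abelian n : abelian [set: {unit 'Z_n}].
Proof. exact: units_Zp_abelian. Qed.

Lemma card_units n : (0 < n)%N -> #|[set: {unit 'Z_n}]| = totient n.
Proof. exact: card_units_Zp. Qed.

Lemma nroots_pnat n q j : (0 < n)%N -> prime q -> 
  exists2 c, nroots n (q ^ j) = (q ^ c)%N & (c <= logn q (totient n))%N.
Proof.
move=> n0 pq; have [c] := card_Ldiv_pnat j (units_abelian n) pq.
rewrite card_Ldiv_units ?expn_gt0 ?(prime_gt0 pq) // => e1 e2; exists c => //.
by rewrite -(card_units n0).
Qed.

Lemma nroots_pnat_lower n q j : (0 < n)%N -> prime q -> (j <= logn q (totient n))%N ->
  (q ^ j <= nroots n (q ^ j))%N.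
Proof.
move=> n0 pq jle; rewrite -card_Ldiv_units ?expn_gt0 ?(prime_gt0 pq) //.
by apply: leq_card_Ldiv_pow => //; [exact: units_abelian | rewrite -(card_units n0) in jle].
Qed.

(** x^Q - y^Q is (x - y) times a sum that is congruent to Q x^(Q - 1) modulo p,
hence prime to p. *)
Lemma expn_eq_mod_inj p k Q x y : prime p -> coprime p Q -> (0 < k)%N -> 
  (x = y %[mod p])%N -> coprime p x ->
  (x ^ Q = y ^ Q %[mod p ^ k])%N -> (x = y %[mod p ^ k])%N.
Proof.
move=> pp cpQ k0; wlog yx : x y / (y <= x)%N => [th|] exy cpx eQ.
  case/orP: (leq_total y x) => h; first exact: th.
  by apply/esym; apply: th => //; rewrite -coprime_modr -exy coprime_modr.
apply/eqP; rewrite eqn_mod_dvd //.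
have : (p ^ k %| x ^ Q - y ^ Q)%N.
  rewrite -eqn_mod_dvd ?eQ //; case: (posnP Q) => Q0; first by rewrite Q0.
  by rewrite leq_exp2r.
rewrite subn_exp Gauss_dvdl // coprimeXl //.
have -> : coprime p (\sum_(i < Q) x ^ (Q.-1 - i) * y ^ i) =
          coprime p (\sum_(i < Q) x ^ Q.-1).
  rewrite -coprime_modr -[in RHS]coprime_modr; congr (coprime p _).
  rewrite -modn_summ -[RHS]modn_summ; congr (_ %% _)%N; apply: eq_bigr => i _.
  rewrite -modnMmr -(modnXm i p y) -exy modnXm modnMmr -expnD subnK //.
  by rewrite -ltnS prednK // (leq_ltn_trans _ (ltn_ord i)).
by rewrite sum_nat_const card_ord coprimeMr cpQ coprimeXr.
Qed.

(** By [expn_eq_mod_inj] the roots stay distinct modulo p, where they are roots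
of a polynomial of degree q^j over a field. *)
Lemma nroots_prime_power_le p k q j : prime p -> prime q -> (0 < k)%N -> p != q ->
  (nroots (p ^ k) (q ^ j) <= q ^ j)%N.
Proof.
move=> pp pq k0 pq'; set Q := (q ^ j)%N.
have Q0 : (0 < Q)%N by rewrite expn_gt0 prime_gt0.
have cpQ : coprime p Q by rewrite coprimeXr // prime_coprime // dvdn_prime2.
pose f (x : 'I_(p ^ k)) : 'F_p := (x : nat)%:R%R.
have p1 := prime_gt1 pp.
have pk1 : (1 < p ^ k)%N by rewrite -(exp1n k) ltn_exp2r.
have fE x : (f x : nat) = (x %% p)%N by rewrite /f val_Fp_nat.
have modE x : (x ^ Q = 1 %[mod p ^ k] -> x ^ Q = 1 %[mod p])%N.
  move=> h; rewrite -(modn_dvdm (x ^ Q) (dvdn_exp k0 (dvdnn p))) h modn_dvdm //.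
  by rewrite dvdn_exp.
have injf : {in unity_roots (p ^ k) Q &, injective f}.
  move=> x y; rewrite !inE => /eqP hx /eqP hy exy.
  apply: val_inj => /=; rewrite -(modn_small (ltn_ord x)) -(modn_small (ltn_ord y)).
  apply: (expn_eq_mod_inj pp cpQ k0); last by rewrite hx hy.
    by rewrite -!fE exy.
  have := modE _ hx; rewrite prime_coprime // => h; apply/negP => px.
  have := dvdn_exp Q0 px; rewrite /dvdn h modn_small //.
rewrite /nroots -(card_in_imset injf) cardE.
have : all (root ('X^Q - 1%:P)%R) (enum (f @: unity_roots (p ^ k) Q)).
  apply/allP=> z; rewrite mem_enum => /imsetP[x hx ->]; move: hx; rewrite inE => /eqP hx.
  rewrite rootE !hornerE /f -GRing.natrX GRing.subr_eq0.
  by apply/eqP/val_inj; rewrite /= val_Fp_nat // modE // pdiv_id // Zp_cast.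
move/max_poly_roots => /(_ _ (enum_uniq _)).
rewrite size_XnsubC // ltnS; apply.
by rewrite -size_poly_eq0 size_XnsubC.
Qed.

Lemma nb_prime_divisors1E q n :
  nb_prime_divisors1 q n = (\sum_(p <- primes n) (p == 1 %[mod q]))%N.
Proof.
by rewrite /nb_prime_divisors1; elim: (primes n) => [|p r IH]; rewrite ?big_nil ?big_cons //= IH.
Qed.

Section UnitsTorsion.
Variables (n q : nat) (n0 : (0 < n)%N) (pq : prime q).

Let c m := logn q (nroots (q ^ logn q n) (q ^ m)).

Let qn0 : (0 < q ^ logn q n)%N. Proof. by rewrite expn_gt0 prime_gt0. Qed.

Let cE m : nroots (q ^ logn q n) (q ^ m) = (q ^ c m)%N.
Proof. by rewrite /c; have [d -> _] := nroots_pnat m qn0 pq; rewrite pfactorK. Qed.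

Let c_le m : (c m <= (logn q n).-1)%N.
Proof.
have [d e le] := nroots_pnat m qn0 pq.
rewrite /c e pfactorK //; apply: leq_trans le _.
case k_: (logn q n) => [|k]; first by rewrite expn0 (_ : totient 1 = 1)%N // logn1.
have q10 : (0 < q.-1)%N by rewrite -subn1 subn_gt0 prime_gt1.
rewrite totient_pfactor // lognM // ?expn_gt0 ?(prime_gt0 pq) //.
rewrite pfactorK // logn_coprime ?add0n //=.
by rewrite coprimenP ?prime_gt0.
Qed.

Let c_mono m : (c m <= c m.+1)%N.
Proof.
by rewrite -(leq_exp2l _ _ (prime_gt1 pq)) -!cE nroots_leq // dvdn_exp2l.
Qed.

Let c0 : c 0 = 0%N.
Proof. by rewrite /c expn0 nroots_exp1 // logn1. Qed.

(** For p <> q the number of roots is at most q^m, and at most the q-part of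
p - 1; the minimum of the two bounds is attained. The prime q itself contributes
the q^(c m) roots modulo its power in n. *)
Lemma nroots_prime_component p m : p \in primes n ->
  nroots (p ^ logn p n) (q ^ m) =
    (q ^ (minn m (logn q p.-1) + (p == q) * c m))%N.
Proof.
move=> pn; have pp : prime p by move: pn; rewrite mem_primes => /and3P[].
have k0 : (0 < logn p n)%N by rewrite logn_gt0.
case: (eqVneq p q) => [->|neq].
  rewrite cE mul1n logn_coprime ?minn0 ?add0n //.
  by rewrite coprimenP ?prime_gt0.
rewrite mul0n addn0.
have pk0 : (0 < p ^ logn p n)%N by rewrite expn_gt0 prime_gt0.
have eT : logn q (totient (p ^ logn p n)) = logn q p.-1.
  have p10 : (0 < p.-1)%N by rewrite -subn1 subn_gt0 prime_gt1.
  rewrite totient_pfactor // lognM // ?expn_gt0 ?(prime_gt0 pp) //.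
  by rewrite lognX (logn_prime q pp) eq_sym (negbTE neq) muln0 addn0.
have [d e le] := nroots_pnat m pk0 pq; rewrite eT in le.
have dm : (d <= m)%N.
  by rewrite -(leq_exp2l _ _ (prime_gt1 pq)) -e nroots_prime_power_le.
have lo : (minn m (logn q p.-1) <= d)%N.
  rewrite -(leq_exp2l _ _ (prime_gt1 pq)) -e.
  apply: (@leq_trans (nroots (p ^ logn p n) (q ^ minn m (logn q p.-1)))).
    by apply: nroots_pnat_lower => //; rewrite eT geq_minr.
  by apply: nroots_leq; rewrite dvdn_exp2l // geq_minl.
by rewrite e; congr (q ^ _)%N; apply/eqP; rewrite eqn_leq lo leq_min dm le.
Qed.

Lemma sum_nb_prime_divisors1 m :
  (\sum_(i < m) nb_prime_divisors1 (q ^ i.+1) n =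
   \sum_(p <- primes n) minn m (logn q p.-1))%N.
Proof.
rewrite [LHS](eq_bigr _ (fun (i : 'I_m) _ => nb_prime_divisors1E (q ^ i.+1) n)).
rewrite exchange_big /=; apply: eq_big_seq => p pn.
have pp : prime p by move: pn; rewrite mem_primes => /and3P[].
have p10 : (0 < p.-1)%N by rewrite -subn1 subn_gt0 prime_gt1.
rewrite (eq_bigr (fun i : 'I_m => nat_of_bool (i < logn q p.-1)%N)).
  case: (leqP m (logn q p.-1)) => h; last by rewrite sum_ltn_nat // ltnW.
  rewrite -[RHS]card_ord -sum1_card; apply: eq_bigr => i _.
  by rewrite (leq_trans (ltn_ord i) h).
by move=> i _; rewrite eqn_mod_dvd ?prime_gt0 // subn1 pfactor_dvdn.
Qed.

(** The e i are the increments of c, that is, the share of the prime q in the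
q-torsion. It is bounded because the units modulo q^k have order (q - 1) q^(k - 1). *)
Lemma card_Ldiv_units_prime_power : 
  exists e : nat -> nat,
    (forall m, (\sum_(i < m) e i <= (logn q n).-1)%N) /\
    (forall m, #|'Ldiv_(q ^ m)([set: {unit 'Z_n}])| =
       q ^ (\sum_(i < m) (nb_prime_divisors1 (q ^ i.+1) n + e i)))%N.
Proof.
pose e i := (c i.+1 - c i)%N.
have se m : (\sum_(i < m) e i = c m)%N.
  elim: m => [|m IH]; first by rewrite big_ord0 c0.
  by rewrite big_ord_recr /= IH /e subnKC.
exists e; split=> m; first by rewrite se.
rewrite card_Ldiv_units ?expn_gt0 ?(prime_gt0 pq) // nroots_prod //.
rewrite (eq_big_seq _ (fun p pn => nroots_prime_component m pn)).
rewrite big_split /= se sum_nb_prime_divisors1 -expn_sum big_split /=.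
congr (q ^ (_ + _))%N; rewrite -big_distrl /=.
case: (boolP (q \in primes n)) => [qn|nqn].
  rewrite (bigD1_seq q) ?primes_uniq //= eqxx big1 ?mul1n //.
  by move=> i /negbTE ->.
have l0 : logn q n = 0%N by apply/eqP; rewrite -leqn0 leqNgt logn_gt0.
have -> : c m = 0%N by apply/eqP; rewrite -leqn0 (leq_trans (c_le m)) // l0.
by rewrite muln0.
Qed.

End UnitsTorsion.

(** * Subgroups of the Sylow subgroups of the unit group *)

Definition nb_Sylow_subgroups q n := #|subgroups 'O_q([set: {unit 'Z_n}])|.

Lemma nb_subgroups_unitsZE n : (0 < n)%N ->
  nb_subgroups_unitsZ n = (\prod_(q <- primes (totient n)) nb_Sylow_subgroups q n)%N.
Proof.
move=> n0; rewrite /nb_subgroups_unitsZ (card_subgroups_Sylow (units_abelian n)).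
by rewrite /= -(card_units n0).
Qed.

Lemma nb_prime_divisors1_mono q n i j : (i <= j)%N ->
  (nb_prime_divisors1 (q ^ j.+1) n <= nb_prime_divisors1 (q ^ i.+1) n)%N.
Proof.
move=> ij; apply: sub_count => p /= /eqP h; apply/eqP.
have d : (q ^ i.+1 %| q ^ j.+1)%N by rewrite dvdn_exp2l.
by rewrite -(modn_dvdm p d) h modn_dvdm.
Qed.

Lemma totient_leq n : (totient n <= n)%N.
Proof.
rewrite totient_count_coprime big_mkord -[leqRHS]card_ord -sum1_card.
by apply: leq_sum => i _; case: coprime.
Qed.

Lemma sum_sqr_leq (I : Type) (r : seq I) (e : I -> nat) :
  (\sum_(i <- r) e i * e i <= (\sum_(i <- r) e i) * (\sum_(i <- r) e i))%N.
Proof.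
elim: r => [|i r IH]; first by rewrite !big_nil.
rewrite !big_cons; move: IH; move: (\sum_(_ <- _) _)%N (\sum_(_ <- _) _)%N => x y; nia.
Qed.

Section SylowSubgroups.
Variables (n q L : nat) (n0 : (0 < n)%N) (pq : prime q) (nL : (n <= L)%N).
Let G := [set: {unit 'Z_n}]%G.
Let w i := nb_prime_divisors1 (q ^ i.+1) n.
Let v := (logn q n).-1.
Let abG : abelian G := units_abelian n.
Let abO : abelian 'O_q(G) := abelianS (pcore_sub q G) abG.
Let qO : q.-group 'O_q(G) := pcore_pgroup q G.

(** An element of q-power order lies in the Sylow q-subgroup. *)
Lemma Ldiv_pcore m : 'Ldiv_(q ^ m)('O_q(G)) = 'Ldiv_(q ^ m)(G).
Proof.
apply/eqP; rewrite eqEsubset setSI ?pcore_sub //=; apply/subsetP=> x Lx.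
rewrite inE; case/LdivP: (Lx) => Gx xq; rewrite inE xq eqxx andbT.
have /subsetP : <[x]> \subset 'O_q(G).
  apply: pcore_max; last by rewrite /normal cycle_subG Gx (sub_abelian_norm abG) ?cycle_subG.
  rewrite /pgroup; apply: (@pnat_dvd _ (q ^ m)); last by rewrite pnatX pnat_id ?orbT.
  by rewrite -orderE order_dvdn xq.
by apply; apply: cycle_id.
Qed.

Let card_O : #|'O_q(G)| = (q ^ logn q (totient n))%N.
Proof.
rewrite (card_Hall (nilpotent_pcore_Hall q (abelian_nil abG))) p_part.
by rewrite -(card_units n0).
Qed.

Let exp_O : 'O_q(G) \subset 'Ldiv_(q ^ L)().
Proof.
apply/subsetP=> x Ox; rewrite inE -order_dvdn.
apply: dvdn_trans (order_dvdG Ox) _; rewrite card_O dvdn_exp2l //.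
apply: leq_trans nL; apply: leq_trans (totient_leq n).
by apply: ltnW; apply: ltn_logl; rewrite totient_gt0.
Qed.

Lemma Sylow_subgroups_lower : exists2 E : nat,
  (q ^ E <= nb_Sylow_subgroups q n)%N & 
  (\sum_(i < L) w i * w i <= 4 * E + \sum_(i < L) w i)%N.
Proof.
exists (\sum_(j < L) (w j)./2 * (w j - (w j)./2))%N.
  apply: card_subgroups_lower => // [|i j ij|m mL]; first exact: prime_gt1.
    exact: nb_prime_divisors1_mono.
  have [e [_ ->]] : exists e : nat -> nat, True /\ #|'Ldiv_(q ^ m)('O_q(G))| = (q ^ (\sum_(i < m) (w i + e i)))%N.
    by have [e [_ he]] := card_Ldiv_units_prime_power n0 pq; exists e; rewrite Ldiv_pcore he.
  rewrite leq_exp2l ?prime_gt1 //; apply: leq_sum => i _; exact: leq_addr.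
rewrite big_distrr -big_split /=; apply: leq_sum => i _.
move: ((w i)./2) (odd (w i)) (odd_double_half (w i)) => y b <-.
rewrite -addnn addnA addnK.
by case: b => /=; nia.
Qed.

(** [card_subgroups_upper] with a_j = w_j + e_j. As w is nonincreasing, the sum
of w_j e_j is at most w_0 v, and the sum of the e_j^2 is at most v^2. *)
Lemma Sylow_subgroups_upper : exists2 U : nat,
  (nb_Sylow_subgroups q n <= q ^ U)%N & 
  (4 * U <= \sum_(i < L) w i * w i + 8 * \sum_(i < L) w i + 2 * w 0 * v + v * v + 8 * v)%N.
Proof.
have [e [se he]] := card_Ldiv_units_prime_power n0 pq.
pose a i := (w i + e i)%N.
exists (\sum_(j < L) ((a j * a j) %/ 4 + 2 * a j))%N.
  by apply: card_subgroups_upper => // m; rewrite Ldiv_pcore he.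
apply: (@leq_trans (\sum_(j < L) (w j * w j + 8 * w j + 2 * w 0 * e j + e j * e j + 8 * e j))%N).
  rewrite big_distrr /=; apply: leq_sum => j _.
  have w0 : (w j <= w 0)%N by apply: nb_prime_divisors1_mono.
  have := leq_trunc_div (a j * a j) 4; rewrite /a; move: (_ %/ 4)%N => d.
  move: (w j) (w 0) (e j) w0 => x y z; nia.
rewrite big_split big_split big_split big_split /= -!big_distrr /=; have := se L.
have := sum_sqr_leq (index_enum 'I_L) (fun j => e j).
rewrite -/v; move: (\sum_(i < L) e i * e i)%N (\sum_(i < L) e i)%N => x y xy yv.
have := leq_mul yv yv; have := leq_mul (leqnn (2 * w 0)) yv.
move: (w 0) (\sum_(i < L) w i * w i)%N (\sum_(i < L) w i)%N v xy yv => z t u v' *.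
lia.
Qed.

Lemma Sylow_subgroups_trivial : ~~ (q %| totient n) -> nb_Sylow_subgroups q n = 1%N.
Proof.
move=> ndq; rewrite /nb_Sylow_subgroups.
have l0 : logn q (totient n) = 0%N.
  by apply/eqP; rewrite -leqn0 leqNgt logn_gt0 mem_primes (negbTE ndq) !andbF.
have O1 : 'O_q(G) = 1 by apply: card1_trivg; rewrite card_O l0.
rewrite (_ : subgroups _ = [set 1%G]) ?cards1 //.
by apply/setP=> H; rewrite !inE O1 subG1.
Qed.

Lemma Sylow_subgroups_ge2 : (q %| totient n)%N -> (2 <= nb_Sylow_subgroups q n)%N.
Proof.
move=> dq; rewrite /nb_Sylow_subgroups.
have l0 : (0 < logn q (totient n))%N by rewrite logn_gt0 mem_primes pq totient_gt0 n0.
have neq : 1%G != 'O_q(G)%G.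
  apply/eqP => /(congr1 val) /= e; have := card_O; rewrite -e cards1 => /esym/eqP.
  by rewrite eqn_leq leqNgt -[1%N](expn0 q) ltn_exp2l ?prime_gt1 // l0.
rewrite -[2](_ : #|[set 1%G; 'O_q(G)%G]| = _); last by rewrite cards2 neq.
apply: subset_leq_card; apply/subsetP=> H; rewrite !inE.
by case/orP=> /eqP -> //=; apply: sub1G.
Qed.

(** Under this hypothesis the Sylow subgroup has order at most q. *)
Lemma Sylow_subgroups_le2 : (\sum_(i < L) w i + v <= 1)%N -> (nb_Sylow_subgroups q n <= 2)%N.
Proof.
move=> h; rewrite /nb_Sylow_subgroups.
have [e [se he]] := card_Ldiv_units_prime_power n0 pq.
have cO : (#|'O_q(G)| <= q)%N.
  have eO : 'Ldiv_(q ^ L)('O_q(G)) = 'O_q(G) by apply/setIidPl.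
  rewrite -eO Ldiv_pcore he -[leqRHS]expn1 leq_exp2l ?prime_gt1 // big_split /=.
  by apply: leq_trans h; rewrite leq_add2l se.
apply: (@leq_trans #|[set 1%G; 'O_q(G)%G]|); last by rewrite cards2; case: (_ != _).
apply: subset_leq_card; apply/subsetP=> H; rewrite !inE => sH.
case: (eqVneq (H : {group _}) 'O_q(G)%G) => [->|neq]; first by rewrite orbT.
have prH : H \proper 'O_q(G).
  by rewrite properEneq sH andbT; apply: contraNneq neq => /val_inj ->.
have := leq_trans (card_proper_pgroup pq qO prH) cO.
rewrite -[leqRHS]muln1 leq_pmul2l ?prime_gt0 // => H1.
rewrite orbF; apply/eqP/val_inj; apply: card1_trivg.
by apply/eqP; rewrite eqn_leq H1 cardG_gt0.
Qed.

End SylowSubgroups.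

Local Close Scope group_scope.

Import Order.TTheory GRing.Theory Num.Theory.
Local Open Scope ring_scope.

(** * Selberg's sieve for the progression 1 mod m *)

Section PeriodicSums.
Variable R : realFieldType.
Implicit Type f : nat -> R.

Lemma sum_block (V : nmodType) (f : nat -> V) n d :
  \sum_(k < n * d) f k = \sum_(i < n) \sum_(j < d) f (i * d + j)%N.
Proof.
elim: n => [|n IH]; first by rewrite mul0n !big_ord0.
by rewrite big_ord_recr /= -IH mulSn addnC big_split_ord.
Qed.

Lemma periodicM (f : nat -> R) T : (forall k, f (k + T)%N = f k) ->
  forall i k, f (i * T + k)%N = f k.
Proof.
move=> fT i k; elim: i => [|i IH]; first by rewrite mul0n.
by rewrite mulSn -addnA addnC fT.
Qed.

(** Only an incomplete period remains. *)
Lemma sum_periodic_norm f T B M : (0 < T)%N -> (forall k, f (k + T)%N = f k) ->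
  \sum_(k < T) f k = 0 -> (forall k, `|f k| <= B) -> 
  `|\sum_(k < M) f k| <= T%:R * B.
Proof.
move=> T0 fT s0 fB; rewrite [in X in X <= _](divn_eq M T) big_split_ord /= sum_block.
rewrite big1 ?add0r => [|i _]; last first.
  by under eq_bigr => j _ do rewrite periodicM //.
apply: le_trans (ler_norm_sum _ _ _) _.
apply: (@le_trans _ _ (\sum_(i < M %% T) B)); first by apply: ler_sum.
rewrite sumr_const card_ord -[B *+ _]mulr_natl; apply: ler_wpM2r.
  by apply: le_trans (fB 0%N).
by rewrite ler_nat ltnW // ltn_mod.
Qed.

Lemma sum_periodic_le f T B M : (0 < T)%N -> (forall k, f (k + T)%N = f k) ->
  (forall k, 0 <= f k) -> \sum_(k < T) f k <= B ->
  \sum_(k < M) f k <= (M%:R / T%:R + 1) * B.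
Proof.
move=> T0 fT f0 sB.
have B0 : 0 <= B by apply: le_trans sB; apply: sumr_ge0.
have MT : (M <= (M %/ T).+1 * T)%N by rewrite ltnW // ltn_ceil.
apply: (@le_trans _ _ (\sum_(k < (M %/ T).+1 * T) f k)).
  rewrite -(subnKC MT) big_split_ord /= lerDl; exact: sumr_ge0.
rewrite sum_block; under eq_bigr => i _ do under eq_bigr => j _ do rewrite periodicM //.
rewrite sumr_const card_ord -[_ *+ _]mulr_natl; apply: ler_pM => //.
  exact: sumr_ge0.
rewrite -addn1 natrD lerD2r ler_pdivlMr ?ltr0n // -natrM ler_nat.
exact: leq_trunc_div.
Qed.

End PeriodicSums.

Lemma coprime_prod_primes p r : prime p -> all prime r -> p \notin r ->
  coprime p (\prod_(q <- r) q)%N.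
Proof.
move=> pp ar pr; rewrite big_seq; elim/big_rec: _ => [|q x qr cx]; first by rewrite coprimen1.
have pq := allP ar q qr.
rewrite coprimeMr cx andbT prime_coprime // dvdn_prime2 //.
by apply: contraNneq pr => e; subst q.
Qed.

Section SieveWeights.
Variable R : realFieldType.

(** The Ramanujan sum c_p(a) up to sign. It has mean 0 over the residues modulo
p, which makes the products for different squarefree moduli orthogonal, and it is
1 when p does not divide a. *)
Definition sieve_factor (p a : nat) : R := if (p %| a)%N then 1 - p%:R else 1.

(** As u is prime to p, the map i |-> c + u i permutes the residues modulo p. *)
Lemma sum_dvdn_progression p c u : prime p -> coprime p u ->
  (\sum_(i < p) (p %| c + u * i) = 1)%N.
Proof.
move=> pp cpu; have p0 := prime_gt0 pp.
pose h (i : 'I_p) := Ordinal (ltn_pmod (c + u * i) p0).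
have injh : injective h.
  move=> i j [] /eqP; rewrite eqn_modDl.
  move=> e; apply: val_inj => /=; move: e.
  wlog ij : i j / (j <= i)%N => [th|].
    case/orP: (leq_total j i) => [|h1 h2]; first exact: th.
    by apply/esym/th => //; rewrite eq_sym.
  rewrite eqn_mod_dvd ?leq_mul2l ?ij ?orbT // -mulnBr Gauss_dvdr //.
  move=> /dvdn_leq h1; have := ltn_ord i.
  case: (posnP (i - j)%N) => [|/h1]; lia.
transitivity (\sum_(i < p) (h i == Ordinal p0))%N; first by apply: eq_bigr.
rewrite -(reindex_inj (P := xpredT) (F := fun j => nat_of_bool (j == Ordinal p0)) injh).
rewrite (bigD1 (Ordinal p0)) // big1 => [|i /negbTE -> //]; by rewrite eqxx.
Qed.

Lemma sum_sieve_factor p c u : prime p -> coprime p u ->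
  \sum_(i < p) sieve_factor p (c + u * i) = 0.
Proof.
move=> pp cpu.
have E i : sieve_factor p (c + u * i) = 1 - p%:R * (p %| c + u * i)%N%:R.
  by rewrite /sieve_factor; case: (_ %| _)%N; rewrite ?mulr1 // mulr0 subr0.
under eq_bigr => i _ do rewrite E.
rewrite sumrB sumr_const card_ord -mulr_sumr -natr_sum sum_dvdn_progression //.
by rewrite mulr1 subrr.
Qed.

Lemma sum_sieve_factor_sqr p c u : prime p -> coprime p u ->
  \sum_(i < p) sieve_factor p (c + u * i) ^+ 2 = p%:R * (p%:R - 1).
Proof.
move=> pp cpu.
have E i : sieve_factor p (c + u * i) ^+ 2 =
    1 + (p%:R * p%:R - p%:R *+ 2) * (p %| c + u * i)%N%:R.
  by rewrite /sieve_factor; case: (_ %| _)%N => /=; ring.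
under eq_bigr => i _ do rewrite E.
rewrite big_split /= sumr_const card_ord -mulr_sumr -natr_sum sum_dvdn_progression //.
ring.
Qed.

Lemma sieve_factor_norm p a : (0 < p)%N -> `|sieve_factor p a| <= p%:R.
Proof.
move=> p0; have p1 : (1 : R) <= p%:R by rewrite ler1n.
by rewrite /sieve_factor; case: ifP => _; rewrite ?normr1 // ler_norml; apply/andP; split; lra.
Qed.

Lemma sieve_factorD p a b : (p %| b)%N -> sieve_factor p (a + b) = sieve_factor p a.
Proof. by move=> pb; rewrite /sieve_factor dvdn_addl. Qed.

Definition sieve_weight (r : seq nat) (a : nat) : R := \prod_(p <- r) sieve_factor p a.

Lemma sieve_weightD r a b : (forall p, p \in r -> p %| b)%N ->
  sieve_weight r (a + b) = sieve_weight r a.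
Proof. by move=> h; apply: eq_big_seq => p pr; rewrite sieve_factorD ?h. Qed.

Lemma sieve_weight_norm r a : (forall p, p \in r -> 0 < p)%N ->
  `|sieve_weight r a| <= (\prod_(p <- r) p)%N%:R.
Proof.
move=> h; rewrite /sieve_weight normr_prod natr_prod.
rewrite [in leLHS]big_seq [in leRHS]big_seq.
by apply: ler_prod => p pr; rewrite normr_ge0 sieve_factor_norm ?h.
Qed.

(** Write k = i d + j. The factor F depends on j only, and for fixed j the
number m k + 1 runs through an arithmetic progression of difference m d, which is
prime to p. *)
Lemma sum_sieve_split (Phi : R -> R) (F : nat -> R) p m d s : prime p -> coprime p (m * d) ->
  (forall k, F (k + d)%N = F k) ->
  (forall c, \sum_(i < p) Phi (sieve_factor p (c + m * d * i)) = s) ->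
  \sum_(k < p * d) Phi (sieve_factor p (m * k + 1)) * F k = s * \sum_(k < d) F k.
Proof.
move=> pp cp Fd hs.
rewrite (sum_block (fun k => Phi (sieve_factor p (m * k + 1)) * F k)) exchange_big /= mulr_sumr; apply: eq_bigr => j _.
under eq_bigr => i _ do rewrite (periodicM Fd).
rewrite -mulr_suml -(hs (m * j + 1)%N); congr (_ * _); apply: eq_bigr => i _.
congr (Phi (sieve_factor p _)); ring.
Qed.

Lemma sum_sieve_weight_sqr r m : uniq r -> all prime r -> all (coprime m) r ->
  \sum_(k < (\prod_(p <- r) p)%N) sieve_weight r (m * k + 1) ^+ 2 
    <= (\prod_(p <- r) p)%N%:R ^+ 2.
Proof.
elim: r => [_ _ _|p r IH /= /andP[pr ur] /andP[pp ar] /andP[cp cr]].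
  by rewrite !big_nil big_ord1 /sieve_weight big_nil.
have cpr : coprime p (\prod_(q <- r) q)%N by apply: coprime_prod_primes.
rewrite !big_cons.
under eq_bigr => k _ do rewrite /sieve_weight big_cons exprMn.
rewrite (@sum_sieve_split (fun x => x ^+ 2) (fun k => sieve_weight r (m * k + 1) ^+ 2) 
   p m _ (p%:R * (p%:R - 1))) //; first last.
- by move=> c; rewrite sum_sieve_factor_sqr // coprimeMr coprime_sym cp.
- move=> k; congr (_ ^+ 2); rewrite mulnDr addnAC sieve_weightD // => q qr.
  by rewrite dvdn_mull // (big_rem q) //= dvdn_mulr.
- by rewrite coprimeMr coprime_sym cp.
rewrite natrM exprMn; apply: ler_pM.
- by rewrite mulr_ge0 // subr_ge0 ler1n prime_gt0.
- by apply: sumr_ge0 => k _; apply: sqr_ge0.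
- by rewrite expr2 ler_wpM2l // gerBl.
exact: IH.
Qed.

End SieveWeights.

Definition squarefree (e : nat) : bool := (\prod_(p <- primes e) p)%N == e.

Definition sieve_moduli (m z : nat) : seq nat :=
  [seq e <- iota 1 z | squarefree e && coprime m e].

Lemma sieve_moduliP m z e : e \in sieve_moduli m z ->
  [/\ (0 < e)%N, (e <= z)%N, (\prod_(p <- primes e) p)%N = e & coprime m e].
Proof.
rewrite mem_filter mem_iota => /andP[/andP[/eqP sq cop] /andP[e0 ez]].
by split=> //; rewrite -ltnS -add1n.
Qed.

Section Sieve.
Variable R : realFieldType.
Variables m z : nat.

(** The coefficient 1 / e of the weight of e makes the diagonal of the quadratic
form of the sieve a multiple of this same sum, up to a bounded term for each e. *)
Definition sieve_mass : R := \sum_(e <- sieve_moduli m z) e%:R^-1.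

Let W e k : R := sieve_weight R (primes e) (m * k + 1).

Let Wperiod e k : W e (k + e)%N = W e k.
Proof.
rewrite /W mulnDr addnAC sieve_weightD // => p.
by rewrite mem_primes => /and3P[_ _ pe]; rewrite dvdn_mull.
Qed.

Let WperiodM e d k : W e (k + d * e)%N = W e k.
Proof. by rewrite addnC (periodicM (Wperiod e)). Qed.

Let all_prime_primes e : all prime (primes e).
Proof. by apply/allP => p; rewrite mem_primes => /andP[]. Qed.

Let orthogonal_aux e e' p : e \in sieve_moduli m z -> e' \in sieve_moduli m z ->
  p \in primes e -> p \notin primes e' -> \sum_(k < e * e') W e k * W e' k = 0.
Proof.
move=> /sieve_moduliP[e0 _ sq ce] /sieve_moduliP[e'0 _ sq' ce'] pe pe'.
have pp := allP (all_prime_primes e) p pe.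
set r := rem p (primes e); set d := (\prod_(q <- r) q)%N.
have ed : e = (p * d)%N by rewrite -{1}sq (big_rem p).
have pr : p \notin r by rewrite mem_rem_uniqF ?primes_uniq.
have ar : all prime r by apply/allP => q /mem_rem; apply: (allP (all_prime_primes e)).
have cpd : coprime p d by apply: coprime_prod_primes.
have cpe' : coprime p e' by rewrite prime_coprime //; apply: contra pe' => h; rewrite mem_primes pp e'0.
have cpm : coprime p m.
  by rewrite coprime_sym; apply: coprime_dvdr ce; rewrite ed dvdn_mulr.
pose F k := sieve_weight R r (m * k + 1) * W e' k.
rewrite (_ : e * e' = p * (d * e'))%N; last by rewrite ed mulnA.
rewrite (eq_bigr (fun k : 'I_(p * (d * e')) => id (sieve_factor R p (m * k + 1)) * F k)); last first.
  by move=> k _; rewrite /F /W /sieve_weight (big_rem p pe) mulrA.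
rewrite (@sum_sieve_split _ id F p m (d * e')%N 0) ?mul0r //.
- by rewrite !coprimeMr cpm cpd cpe'.
- move=> k; rewrite /F WperiodM; congr (_ * _).
  rewrite mulnDr addnAC sieve_weightD // => q qr.
  by rewrite dvdn_mull // dvdn_mulr // /d (big_rem q) //= dvdn_mulr.
by move=> c; apply: sum_sieve_factor => //; rewrite !coprimeMr cpm cpd cpe'.
Qed.

Let orthogonal e e' : e \in sieve_moduli m z -> e' \in sieve_moduli m z ->
  e != e' -> \sum_(k < e * e') W e k * W e' k = 0.
Proof.
move=> he he' nee.
case: (boolP (all (mem (primes e')) (primes e))) => [/allP s1|/allPn[p pe pe']]; last first.
  exact: (orthogonal_aux he he' pe pe').
case: (boolP (all (mem (primes e)) (primes e'))) => [/allP s2|/allPn[p pe pe']]; last first.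
  rewrite mulnC; under eq_bigr => k _ do rewrite mulrC.
  exact: (orthogonal_aux he' he pe pe').
case/eqP: nee; have [_ _ <- _] := sieve_moduliP he; have [_ _ <- _] := sieve_moduliP he'.
apply: perm_big; apply: uniq_perm; rewrite ?primes_uniq // => p.
by apply/idP/idP => [/s1|/s2].
Qed.

Let Wnorm e k : e \in sieve_moduli m z -> `|W e k| <= e%:R.
Proof.
move=> /sieve_moduliP[_ _ sq _]; rewrite -[in leRHS]sq; apply: sieve_weight_norm => p.
by move/(allP (all_prime_primes e))/prime_gt0.
Qed.

Let cross e e' M : e \in sieve_moduli m z -> e' \in sieve_moduli m z -> e != e' ->
  e%:R^-1 * e'%:R^-1 * \sum_(k < M) W e k * W e' k <= z%:R ^+ 2.
Proof.
move=> he he' nee; have [e0 ez _ _] := sieve_moduliP he; have [e'0 ez' _ _] := sieve_moduliP he'.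
have e0R : (0 : R) < e%:R by rewrite ltr0n.
have e'0R : (0 : R) < e'%:R by rewrite ltr0n.
apply: (@le_trans _ _ (e%:R^-1 * e'%:R^-1 * ((e * e')%:R * (e * e')%:R))).
  apply: ler_wpM2l; first by rewrite mulr_ge0 ?invr_ge0 ?ler0n.
  apply: le_trans (ler_norm _) _.
  apply: (@sum_periodic_norm R (fun k => W e k * W e' k)); rewrite ?muln_gt0 ?e0 //.
  - by move=> k; rewrite WperiodM mulnC WperiodM.
  - exact: (orthogonal he he' nee).
  by move=> k; rewrite normrM natrM ler_pM ?Wnorm.
rewrite natrM -invfM mulrA mulVf ?mul1r ?mulf_neq0 ?gt_eqF // expr2.
by rewrite ler_pM ?ler_nat.
Qed.

Let diagonal e M : e \in sieve_moduli m z ->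
  e%:R^-1 * e%:R^-1 * \sum_(k < M) W e k * W e k <= M%:R * e%:R^-1 + 1.
Proof.
move=> he; have [e0 ez sq ce] := sieve_moduliP he.
have e0R : (0 : R) < e%:R by rewrite ltr0n.
apply: (@le_trans _ _ (e%:R^-1 * e%:R^-1 * ((M%:R / e%:R + 1) * e%:R ^+ 2))).
  apply: ler_wpM2l; first by rewrite mulr_ge0 ?invr_ge0 ?ler0n.
  apply: (@sum_periodic_le R (fun k => W e k * W e k)) => // [k|k|].
  - by rewrite !Wperiod.
  - by rewrite -expr2 sqr_ge0.
  have := @sum_sieve_weight_sqr R (primes e) m (primes_uniq _) (all_prime_primes _).
  rewrite sq => h; apply: le_trans (h _).
    by apply: ler_sum => k _; rewrite expr2.
  apply/allP => p; rewrite mem_primes => /and3P[pp _ pe].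
  by apply: coprime_dvdr ce.
by rewrite le_eqVlt; apply/orP; left; apply/eqP; field; rewrite gt_eqF.
Qed.

(** If all primes of m k + 1 exceed z, every weight W e k is 1 and the sum of
W e k / e is the mass J. So J^2 times the number of such k is at most the sum over
all k < M of the square of that sum. In the expanded square each of the at most
z^2 pairs e <> e' contributes at most z^2, by orthogonality over a full period, and
the diagonal contributes at most M / e + 1 for each e. *)
Lemma selberg_sieve M :
  sieve_mass ^+ 2 *
    (\sum_(k < M) all (fun p => ~~ (p <= z)%N) (primes (m * k + 1)))%N%:R
  <= M%:R * sieve_mass + 2 * z%:R ^+ 4.
Proof.
set S := sieve_moduli m z; set J := sieve_mass.
apply: (@le_trans _ _ (\sum_(k < M) (\sum_(e <- S) e%:R^-1 * W e k) ^+ 2)).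
  rewrite natr_sum mulr_sumr; apply: ler_sum => k _.
  case: allP => [h|_]; last by rewrite mulr0 sqr_ge0.
  rewrite mulr1 le_eqVlt; apply/orP; left; apply/eqP; congr (_ ^+ 2).
  rewrite /J /sieve_mass -/S; apply: eq_big_seq => e eS; have [e0 ez _ _] := sieve_moduliP eS.
  rewrite /W /sieve_weight big_seq big1 ?mulr1 // => p pe.
  rewrite /sieve_factor; case: ifP => // pk.
  move: pe; rewrite mem_primes => /and3P[pp _ pe].
  have /h/= : p \in primes (m * k + 1) by rewrite mem_primes pp pk addn1.
  by rewrite (leq_trans (dvdn_leq e0 pe) ez).
under eq_bigr => k _ do rewrite expr2 mulr_suml.
under eq_bigr => k _ do under eq_bigr => e _ do rewrite mulr_sumr.
rewrite exchange_big /=; under eq_bigr => e _ do rewrite exchange_big /=.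
have sz : (size S <= z)%N.
  by rewrite size_filter (leq_trans (count_size _ _)) // size_iota.
apply: (@le_trans _ _ (\sum_(e <- S) (\sum_(e' <- S) z%:R ^+ 2 + (M%:R * e%:R^-1 + 1)))).
  rewrite big_seq [leRHS]big_seq; apply: ler_sum => e eS.
  have uS : uniq S by rewrite filter_uniq // iota_uniq.
  rewrite (bigD1_seq e) //= addrC; apply: lerD.
    apply: (@le_trans _ _ (\sum_(e' <- S | e' != e) z%:R ^+ 2)).
      rewrite big_seq_cond [leRHS]big_seq_cond; apply: ler_sum => e' /andP[e'S nee].
      apply: le_trans (cross M eS e'S _); last by rewrite eq_sym.
      rewrite le_eqVlt; apply/orP; left; apply/eqP; rewrite mulr_sumr.
      by apply: eq_bigr => k _; ring.
    rewrite [leRHS](bigID (fun e' => e' != e)) /= lerDl.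
    by apply: sumr_ge0 => e' _; rewrite exprn_ge0.
  apply: le_trans (diagonal M eS).
  rewrite le_eqVlt; apply/orP; left; apply/eqP; rewrite mulr_sumr.
  by apply: eq_bigr => k _; ring.
rewrite big_split /= big_split /= !big_const_seq !count_predT !iter_addr_0.
have -> : \sum_(e <- S) M%:R * e%:R^-1 = M%:R * J by rewrite /J /sieve_mass mulr_sumr.
have -> : (z%:R ^+ 2 *+ size S) *+ size S = z%:R ^+ 2 * (size S)%:R * (size S)%:R :> R.
  by rewrite !mulr_natr.
have zz : (size S)%:R <= z%:R :> R by rewrite ler_nat.
have s0 : (0 : R) <= (size S)%:R by rewrite ler0n.
have z1 : (size S)%:R <= z%:R ^+ 4 :> R.
  apply: le_trans zz _; rewrite -natrX ler_nat.
  by case: z => [|y] //; rewrite -{1}[y.+1]expn1 leq_pexp2l.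
have z4 : z%:R ^+ 2 * (size S)%:R * (size S)%:R <= z%:R ^+ 4 :> R.
  rewrite -mulrA (_ : 4 = 2 + 2)%N // exprD; apply: ler_wpM2l; first by rewrite exprn_ge0.
  by rewrite expr2 ler_pM.
by lra.
Qed.

End Sieve.

Lemma squarefree_decomposition n : (0 < n)%N ->
  exists ek : nat * nat, [/\ squarefree ek.1, (0 < ek.2)%N & n = (ek.1 * ek.2 ^ 2)%N].
Proof.
have [b] := ubnP n; elim: b n => // b IH n nb n0.
case: (boolP (squarefree n)) => [sq|nsq]; first by exists (n, 1%N); rewrite /= exp1n muln1.
have [p pp pn] : exists2 p, prime p & (p ^ 2 %| n)%N.
  case: (altP (allP (s := primes n) (a := fun p => logn p n == 1%N))) => [h|/allPn[p pn np]].
    case/negP: nsq; rewrite /squarefree {2}(prod_prime_decomp n0) prime_decompE big_map /=.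
    by apply/eqP; apply: eq_big_seq => p /h/eqP ->; rewrite expn1.
  have pp : prime p by move: pn; rewrite mem_primes => /andP[].
  exists p => //; rewrite pfactor_dvdn //.
  by move: pn np; rewrite -logn_gt0; case: (logn p n) => [|[]].
case/dvdnP: pn => n' e; rewrite e muln_gt0 in n0; case/andP: n0 => n'0 _.
have ltn' : (n' < n)%N by rewrite e ltn_Pmulr // -[1%N](exp1n 2) ltn_exp2r // prime_gt1.
have [|[d k] /= [sd k0 ed]] := IH n' _ n'0; first exact: leq_trans ltn' _.
exists (d, k * p)%N => /=; split=> //; first by rewrite muln_gt0 k0 prime_gt0.
by rewrite e ed expnMn mulnA.
Qed.

Section Mass.
Variable R : realFieldType.

Lemma sum_inv_sqr n : \sum_(1 <= k < n.+1) (k%:R ^+ 2)^-1 <= 2 :> R.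
Proof.
suff h : (0 < n)%N -> \sum_(1 <= k < n.+1) (k%:R ^+ 2)^-1 <= 2 - n%:R^-1 :> R.
  case: (posnP n) => [->|/h/le_trans]; first by rewrite big_nil.
  by apply; rewrite gerBl invr_ge0 ler0n.
elim: n => [//|[|n] IH _]; first by rewrite big_nat1 expr1n; lra.
rewrite big_nat_recr //=; apply: le_trans (lerD (IH isT) (lexx _)) _.
have n1 : (0 : R) < n.+1%:R by rewrite ltr0n.
have e : n.+2%:R = n.+1%:R + 1 :> R by rewrite -natr1.
rewrite e; move: (n.+1%:R : R) n1 => x x0; rewrite -subr_ge0.
have -> : 2 - (x + 1)^-1 - (2 - x^-1 + ((x + 1) ^+ 2)^-1) = (x * (x + 1) ^+ 2)^-1 :> R.
  by field; apply/andP; split; apply: lt0r_neq0; lra.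
by rewrite invr_ge0 mulr_ge0 ?sqr_ge0 // ltW.
Qed.

Lemma ler_sum_subset_seq (T : eqType) (F : T -> R) (s1 s2 : seq T) :
  (forall x, x \in s2 -> 0 <= F x) -> uniq s1 -> {subset s1 <= s2} ->
  \sum_(x <- s1) F x <= \sum_(x <- s2) F x.
Proof.
elim: s1 s2 => [|x s1 IH] s2 F0 /=.
  by rewrite big_nil big_seq sumr_ge0.
move=> /andP[xs1 us1] sub; have xs2 : x \in s2 by apply: sub; rewrite mem_head.
rewrite big_cons (big_rem x xs2) /= lerD2l; apply: IH => // [y /mem_rem/F0 //|y ys1].
have ys2 : y \in s2 by apply: sub; rewrite inE ys1 orbT.
have := perm_mem (perm_to_rem xs2) y; rewrite ys2 inE => /esym/orP[/eqP e|//].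
by rewrite -e ys1 in xs1.
Qed.

Lemma dyadic_sum (f : nat -> R) K :
  \sum_(1 <= n < 2 ^ K) f n = \sum_(i < K) \sum_(2 ^ i <= n < 2 ^ i.+1) f n.
Proof.
elim: K => [|K IH]; first by rewrite big_ord0 big_geq.
rewrite big_ord_recr /= -IH -big_cat_nat //=; first by rewrite expn_gt0.
by rewrite leq_exp2l.
Qed.

(** Two consecutive integers are not both divisible by l. *)
Lemma count_not_dvdn_pairs l a K : (1 < l)%N ->
  (K <= \sum_(a <= n < a + K.*2) ~~ (l %| n))%N.
Proof.
move=> l1; elim: K => [//|K IH].
rewrite doubleS !addnS !big_nat_recr /=; try lia.
have : (~~ (l %| a + K.*2) + ~~ (l %| (a + K.*2).+1) >= 1)%N.
  case h : (l %| a + K.*2)%N => //.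
  have -> : (l %| (a + K.*2).+1)%N = false => //.
  by rewrite -addn1 (dvdn_addr _ h) dvdn1; case: eqP l1 => // ->.
lia.
Qed.

Lemma count_not_dvdn_block l i : (1 < l)%N ->
  (2 ^ i <= 2 * \sum_(2 ^ i <= n < 2 ^ i.+1) ~~ (l %| n))%N.
Proof.
move=> l1; case: i => [|i].
  by rewrite big_nat1 dvdn1; case: eqP l1 => // ->.
have -> : (2 ^ i.+2 = 2 ^ i.+1 + (2 ^ i).*2)%N by rewrite !expnS; lia.
by rewrite {1}expnS leq_mul2l /=; apply: count_not_dvdn_pairs.
Qed.

Lemma sum_inv_not_dvdn l s : (1 < l)%N ->
  s%:R / 4 <= \sum_(1 <= n < 2 ^ s) (~~ (l %| n)%N)%:R / n%:R :> R.
Proof.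
move=> l1; rewrite dyadic_sum mulrC mulr_natr -[in X in _ *+ X](card_ord s) -sumr_const.
apply: ler_sum => i _.
have p0 : (0 : R) < 2 ^+ i.+1 by rewrite exprn_gt0.
apply: (@le_trans _ _ (\sum_(2 ^ i <= n < 2 ^ i.+1) (~~ (l %| n)%N)%:R / 2 ^+ i.+1)).
  rewrite -mulr_suml ler_pdivlMr // -natr_sum.
  have := count_not_dvdn_block i l1; move: (\sum_(_ <= _ < _) _)%N => x h.
  have : (2 : R) ^+ i <= 2 * x%:R by rewrite -natrX -natrM ler_nat.
  by rewrite exprS; lra.
rewrite big_nat_cond [leRHS]big_nat_cond; apply: ler_sum => n /andP[/andP[h1 h2] _].
apply: ler_wpM2l; first exact: ler0n.
have n0 : (0 < n)%N by apply: leq_trans h1; rewrite expn_gt0.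
by rewrite lef_pV2 ?posrE ?ltr0n // -natrX ler_nat ltnW.
Qed.

(** Every n is e k^2 with e squarefree, so the sum of 1 / n over the n prime to l
is at most the mass times the sum of the 1 / k^2, which is at most 2. *)
Lemma sieve_mass_lower l a s : prime l -> 
  s%:R / 8 <= sieve_mass R (l ^ a) (2 ^ s).
Proof.
move=> pl; have l1 := prime_gt1 pl; set z := (2 ^ s)%N; set m := (l ^ a)%N.
have := sum_inv_not_dvdn s l1.
suff : \sum_(1 <= n < z) (~~ (l %| n)%N)%:R / n%:R <= sieve_mass R m z * 2 by rewrite -/z; lra.
have J0 : 0 <= sieve_mass R m z by apply: sumr_ge0 => e _; rewrite invr_ge0 ler0n.
apply: (@le_trans _ _ (sieve_mass R m z * \sum_(1 <= k < z.+1) (k%:R ^+ 2)^-1)); last first.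
  by apply: ler_wpM2l => //; apply: sum_inv_sqr.
rewrite /sieve_mass big_distrlr /= -(big_allpairs (F := fun u => u.1%:R^-1 * (u.2%:R ^+ 2)^-1)).
have ex n : exists u : nat * nat, (0 < n)%N ==> [&& squarefree u.1, (0 < u.2)%N & n == u.1 * u.2 ^ 2]%N.
  case: (posnP n) => [->|n0]; first by exists (0, 0)%N.
  have [u [h1 h2 h3]] := squarefree_decomposition n0; exists u.
  by apply/implyP => _; rewrite h1 h2 /= -h3.
pose h n := xchoose (ex n).
have hP n : (0 < n)%N -> [/\ squarefree (h n).1, (0 < (h n).2)%N & n = (h n).1 * (h n).2 ^ 2]%N.
  by move=> n0; have := implyP (xchooseP (ex n)) n0 => /and3P[-> -> /eqP].
pose L := [seq n <- index_iota 1 z | ~~ (l %| n)%N].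
have -> : \sum_(1 <= n < z) (~~ (l %| n)%N)%:R / n%:R = \sum_(n <- L) n%:R^-1 :> R.
  rewrite big_filter [RHS]big_mkcond /=; apply: eq_bigr => n _.
  by case: (_ %| _)%N; rewrite /= ?mul0r ?mul1r.
have LP n : n \in L -> [/\ (0 < n)%N, (n < z)%N & ~~ (l %| n)%N].
  by rewrite mem_filter mem_index_iota => /and3P[].
have -> : \sum_(n <- L) n%:R^-1 = \sum_(u <- map h L) u.1%:R^-1 * (u.2%:R ^+ 2)^-1 :> R.
  rewrite big_map; apply: eq_big_seq => n /LP[n0 _ _].
  by have [_ _ {1}->] := hP n n0; rewrite natrM natrX invfM.
apply: ler_sum_subset_seq.
- by move=> u _; rewrite mulr_ge0 // ?invr_ge0 ?sqr_ge0 ?ler0n.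
- rewrite map_inj_in_uniq ?filter_uniq ?iota_uniq // => n n' /LP[n0 _ _] /LP[n'0 _ _] e.
  by have [_ _ ->] := hP n n0; have [_ _ ->] := hP n' n'0; rewrite e.
move=> u /mapP[n /LP[n0 nz nl] ->]; have [sq k0 en] := hP n n0.
case: (h n) sq k0 en => d k /= sq k0 en.
have d0 : (0 < d)%N by move: n0; rewrite en muln_gt0 => /andP[].
have dn : (d <= n)%N by rewrite en leq_pmulr // expn_gt0 k0.
have kn : (k <= n)%N.
  rewrite en (@leq_trans (k ^ 2)) ?leq_pmull //; exact: leq_pmulr.
apply: allpairs_f.
  rewrite mem_filter sq mem_iota d0 add1n ltnS (ltnW (leq_ltn_trans dn nz)) !andbT /=.
  rewrite /m coprimeXl // prime_coprime //; apply: contra nl => ld.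
  by rewrite en dvdn_mulr.
by rewrite mem_index_iota k0 ltnS (ltnW (leq_ltn_trans kn nz)).
Qed.
End Mass.

(** * Primes congruent to 1 modulo a prime power *)

Definition primes_1mod (m a b : nat) : seq nat :=
  [seq p <- index_iota a b | prime p && (p == 1 %[mod m])%N].

Lemma primes_1modP m a b p : (1 < m)%N -> p \in primes_1mod m a b ->
  [/\ prime p, (a <= p < b)%N, (0 < p %/ m)%N & p = (m * (p %/ m) + 1)%N].
Proof.
move=> m1; rewrite mem_filter mem_index_iota => /andP[/andP[pp p1] pab].
have e : p = (m * (p %/ m) + 1)%N.
  by rewrite {1}(divn_eq p m) (eqP p1) modn_small // mulnC.
split=> //; rewrite lt0n; apply: contraL pp => /eqP k0.
by rewrite e k0 muln0.
Qed.

Lemma size_primes_1mod_le m a b s : (1 < m)%N -> uniq s -> 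
  (forall p, p \in primes_1mod m a b -> (p %/ m)%N \in s) ->
  (size (primes_1mod m a b) <= size s)%N.
Proof.
move=> m1 us h; rewrite -(size_map (fun p => p %/ m)%N); apply: uniq_leq_size.
  rewrite map_inj_in_uniq ?filter_uniq ?iota_uniq // => p p' /(primes_1modP m1)[_ _ _ e].
  by move=> /(primes_1modP m1)[_ _ _ e'] ee; rewrite e e' ee.
by move=> _ /mapP[p hp ->]; apply: h.
Qed.

Lemma size_primes_1mod_trivial m a b : (1 < m)%N ->
  (m * size (primes_1mod m a b) <= b)%N.
Proof.
move=> m1; rewrite mulnC -leq_divRL ?(ltnW m1) //.
rewrite -[leqRHS](size_iota 1); apply: size_primes_1mod_le => //; first exact: iota_uniq.
move=> p /(primes_1modP m1)[_ /andP[_ pb] k0 _]; rewrite mem_iota k0 add1n ltnS.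
by apply: leq_div2r; apply: ltnW.
Qed.

Lemma count_sum (T : Type) (P : pred T) (s : seq T) :
  count P s = (\sum_(x <- s) P x)%N.
Proof. by elim: s => [|x s IH]; rewrite ?big_nil // big_cons /= IH. Qed.

Lemma size_primes_1mod_sieve m z a b : (1 < m)%N -> (z < a)%N ->
  (size (primes_1mod m a b) <=
   \sum_(k < (b %/ m).+1) all (fun p => ~~ (p <= z)%N) (primes (m * k + 1)))%N.
Proof.
move=> m1 za; set P := fun k => all (fun p => ~~ (p <= z)%N) (primes (m * k + 1)).
rewrite -(big_mkord xpredT (fun k => nat_of_bool (P k))) -count_sum -size_filter.
apply: size_primes_1mod_le => //; first by rewrite filter_uniq ?iota_uniq.
move=> p /(primes_1modP m1)[pp /andP[ap pb] _ e].
rewrite mem_filter mem_index_iota /= ltnS leq_div2r ?(ltnW pb) // andbT /P -e.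
by rewrite primes_prime //= andbT -ltnNge (leq_trans za).
Qed.

Lemma sqr_le_exp2 y : (y ^ 2 <= 4 * 2 ^ y)%N.
Proof.
case: (leqP y 3) => [|y3]; first by case: y => [|[|[|[|]]]].
rewrite -(subnK y3); elim: (y - 4)%N => [//|k IH].
rewrite addSn (expnS 2 (k + 4)); apply: leq_trans (_ : 2 * (k + 4) ^ 2 <= _)%N; last by lia.
by rewrite -!mulnn; nia.
Qed.

Lemma leq_32_sixteenth i : (16 <= i)%N -> (i <= 32 * (i %/ 16))%N.
Proof. lia. Qed.

(** With s = i / 16, both sides squared: z^8 m^2 i^2 <= 2^(8 s) 2^i i^2, and i is at most
2 (i - 8 s), whose square is dominated by 2^(i - 8 s) up to a constant. *)
Lemma sieve_error_leq m i : (m ^ 2 <= 2 ^ i)%N ->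
  ((2 ^ (i %/ 16)) ^ 4 * m * i <= 4 * 2 ^ i)%N.
Proof.
move=> mi; set s := (i %/ 16)%N; set z := (2 ^ s)%N; rewrite -(@leq_exp2r _ _ 2) //.
have is_ : (i <= (i - 8 * s).*2)%N by rewrite /s; lia.
have e8 : (8 * s + (i - 8 * s) = i)%N by rewrite /s; lia.
have -> : ((z ^ 4 * m * i) ^ 2 = 2 ^ (8 * s) * m ^ 2 * i ^ 2)%N.
  rewrite expnMn (expnMn (z ^ 4)) /z -!(expnM 2); congr (2 ^ _ * _ * _)%N.
  by rewrite -!mulnA mulnC.
have -> : ((4 * 2 ^ i) ^ 2 = 2 ^ (8 * s) * 2 ^ i * (16 * 2 ^ (i - 8 * s)))%N.
  have -> : (2 ^ (8 * s) * 2 ^ i * (16 * 2 ^ (i - 8 * s)) =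
             16 * (2 ^ i * (2 ^ (8 * s) * 2 ^ (i - 8 * s))))%N by ring.
  by rewrite -expnD e8 mulnn expnMn.
have := sqr_le_exp2 (i - 8 * s).
move: (i - 8 * s)%N is_ => y iy y2; apply: leq_mul; first by rewrite leq_mul2l mi orbT.
have : (i ^ 2 <= y.*2 ^ 2)%N by rewrite leq_exp2r.
by rewrite -mul2n expnMn; move: (2 ^ y)%N (y ^ 2)%N (i ^ 2)%N y2; clear; lia.
Qed.

Section BrunTitchmarsh.
Variable R : realFieldType.

(** The Brun-Titchmarsh inequality. Sieving up to z = 2^s with s about i / 16
gives a mass of order at least i, and an error 2 z^4 of size at most 2^(i / 4 + 1). This is
harmless because m <= 2^(i / 2). For i < 16 the trivial bound is enough. *)
Lemma size_primes_1mod_dyadic l a i : prime l -> (0 < a)%N -> (0 < i)%N ->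
  ((l ^ a) ^ 2 <= 2 ^ i)%N ->
  (size (primes_1mod (l ^ a) (2 ^ i) (2 ^ i.+1)))%:R * (l ^ a)%:R * i%:R <= 1040 * 2 ^+ i :> R.
Proof.
move=> pl a0 i0; set m := (l ^ a)%N => mi.
have m1 : (1 < m)%N by rewrite -(exp1n a) ltn_exp2r // prime_gt1.
set D := size _.
have m0R : (0 : R) < m%:R by rewrite ltr0n ltnW.
have i0R : (0 : R) < i%:R by rewrite ltr0n.
have twoi : (2 : R) ^+ i = (2 ^ i)%N%:R by rewrite natrX.
have triv : m%:R * D%:R <= 2 * (2 : R) ^+ i.
  by rewrite twoi -!natrM ler_nat -expnS size_primes_1mod_trivial.
have [i16|i16] := ltnP i 16.
  have : i%:R <= 16 :> R by rewrite ler_nat ltnW.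
  move=> i16R; apply: (@le_trans _ _ (2 * 2 ^+ i * 16)).
    by rewrite (mulrC D%:R); apply: ler_pM => //; rewrite ?mulr_ge0 ?ler0n.
  by have : (0 : R) < 2 ^+ i; [rewrite exprn_gt0 | lra].
set s := (i %/ 16)%N; set z := (2 ^ s)%N; set J := sieve_mass R m z.
have s0 : (0 < s)%N by rewrite divn_gt0.
have si : (s < i)%N by rewrite ltn_Pdiv.
have J8 : s%:R / 8 <= J by apply: sieve_mass_lower.
have J1 : 1 <= J.
  rewrite /J /sieve_mass (big_rem 1%N) /=; last first.
    by rewrite mem_filter mem_iota coprimen1 /= /squarefree big_nil /= add1n ltnS expn_gt0.
  by rewrite invr1 lerDl; apply: sumr_ge0 => e _; rewrite invr_ge0 ler0n.
set M := ((2 ^ i.+1) %/ m).+1.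
(* A prime in the block is at least 2^i > z, so that the sieve does not remove it. *)
have DM : J ^+ 2 * D%:R <= M%:R * J + 2 * z%:R ^+ 4.
  apply: le_trans (selberg_sieve R m z M); apply: ler_wpM2l; first exact: sqr_ge0.
  by rewrite ler_nat; apply: size_primes_1mod_sieve => //; rewrite ltn_exp2l.
have Mm : M%:R * m%:R <= 4 * (2 : R) ^+ i.
  rewrite twoi -!natrM ler_nat /M mulSn.
  have m2i : (m <= 2 ^ i)%N by apply: leq_trans mi; rewrite expnS leq_pmulr // expn1 ltnW.
  apply: leq_trans (leq_add m2i (leq_trunc_div (2 ^ i.+1) m)) _.
  by rewrite expnS -mulSn leq_mul2r orbT.
have zm : z%:R ^+ 4 * m%:R * i%:R <= 4 * (2 : R) ^+ i.
  by rewrite twoi -natrX -!natrM ler_nat sieve_error_leq.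
have JD : J * D%:R <= M%:R + 2 * z%:R ^+ 4.
  rewrite -(ler_pM2l (lt_le_trans ltr01 J1)) mulrA -expr2; apply: le_trans DM _.
  rewrite mulrDr (mulrC J M%:R) lerD2l ler_peMl // mulr_ge0 // exprn_ge0 // ler0n.
(* With the bounds on M m and z^4 m i above, the constant needed is 4 * 256 + 8. *)
have iJ : i%:R <= 256 * J.
  apply: (@le_trans _ _ (256 * (s%:R / 8))); last by rewrite ler_wpM2l.
  rewrite mulrCA (_ : 256 / 8 = 32%:R); last by field.
  by rewrite -natrM ler_nat mulnC; apply: leq_32_sixteenth.
have J0 : 0 < J := lt_le_trans ltr01 J1.
rewrite -(ler_pM2l J0).
have -> : J * (D%:R * m%:R * i%:R) = (J * D%:R) * (m%:R * i%:R) by ring.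
apply: (@le_trans _ _ ((M%:R + 2 * z%:R ^+ 4) * (m%:R * i%:R))).
  by apply: ler_wpM2r => //; rewrite mulr_ge0 // ltW.
have -> : (M%:R + 2 * z%:R ^+ 4) * (m%:R * i%:R) =
  (M%:R * m%:R) * i%:R + 2 * (z%:R ^+ 4 * m%:R * i%:R) :> R by ring.
have y0 : (0 : R) < 2 ^+ i by rewrite exprn_gt0.
have h1 : M%:R * m%:R * i%:R <= 4 * 2 ^+ i * (256 * J).
  by apply: ler_pM => //; rewrite ?mulr_ge0 ?ler0n.
have h2 : 2 * (4 * (2 : R) ^+ i) <= 2 * (4 * 2 ^+ i) * J by rewrite ler_peMr // !mulr_ge0 // ltW.
move: h1 h2 zm; move: (M%:R * m%:R * i%:R) (z%:R ^+ 4 * m%:R * i%:R) (2 ^+ i) y0 => x y u u0.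
lra.
Qed.

Definition recip_primes_1mod m N : R := \sum_(p <- primes_1mod m 1 N.+1) p%:R^-1.

(** The dyadic blocks with i < 2 t are bounded trivially, by 2 / m each; in all
others m^2 <= 2^i and the Brun-Titchmarsh inequality applies. *)
Lemma recip_primes_1mod_le l a t N K : prime l -> (0 < a)%N -> 
  (l ^ a <= 2 ^ t)%N -> (N < 2 ^ K)%N ->
  (l ^ a)%:R * recip_primes_1mod (l ^ a) N <= 4 * t%:R + 1040 * \sum_(1 <= i < K) i%:R^-1.
Proof.
move=> pl a0; set m := (l ^ a)%N => mt NK.
have m1 : (1 < m)%N by rewrite -(exp1n a) ltn_exp2r // prime_gt1.
have m0R : (0 : R) < m%:R by rewrite ltr0n ltnW.
apply: (@le_trans _ _ (m%:R * recip_primes_1mod m (2 ^ K).-1)).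
  apply: ler_wpM2l; first exact: ltW.
  apply: ler_sum_subset_seq; first by move=> x _; rewrite invr_ge0 ler0n.
    by rewrite filter_uniq ?iota_uniq.
  move=> p; rewrite !mem_filter !mem_index_iota => /andP[-> /andP[-> pN]] /=.
  by rewrite prednK ?expn_gt0 // (leq_trans pN).
have K0 : (0 < 2 ^ K)%N by rewrite expn_gt0.
rewrite /recip_primes_1mod prednK // big_filter big_mkcond /= dyadic_sum mulr_sumr.
pose D i := size (primes_1mod m (2 ^ i) (2 ^ i.+1)).
apply: (@le_trans _ _ (\sum_(i < K) m%:R * (D i)%:R / 2 ^+ i)).
  apply: ler_sum => i _; rewrite -mulrA; apply: ler_wpM2l; first exact: ltW.
  rewrite -big_mkcond -big_filter /=.
  rewrite /D -/(primes_1mod m (2 ^ i) (2 ^ i.+1)) big_seq.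
  apply: (@le_trans _ _ (\sum_(p <- primes_1mod m (2 ^ i) (2 ^ i.+1)) (2 ^+ i)^-1)).
    rewrite [leRHS]big_seq; apply: ler_sum => p /(primes_1modP m1)[_ /andP[ip _] _ _].
    by rewrite lef_pV2 ?posrE ?exprn_gt0 ?ltr0n -?natrX ?ler_nat // (leq_trans _ ip) ?expn_gt0.
  by rewrite big_const_seq count_predT iter_addr_0 mulrC mulr_natr.
have p2 i : (0 : R) < 2 ^+ i by rewrite exprn_gt0.
rewrite -(big_mkord xpredT (fun i => m%:R * (D i)%:R / 2 ^+ i)).
have b1 i : m%:R * (D i)%:R / 2 ^+ i <= 2 :> R.
  by rewrite ler_pdivrMr // -exprS -natrX -natrM ler_nat size_primes_1mod_trivial.
have b2 i : (2 * t <= i)%N -> (0 < i)%N -> m%:R * (D i)%:R / 2 ^+ i <= 1040 * i%:R^-1 :> R.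
  move=> ti i0; rewrite ler_pdivrMr // mulrAC ler_pdivlMr ?ltr0n // (mulrC m%:R).
  apply: size_primes_1mod_dyadic => //.
  by rewrite -/m; apply: leq_trans (_ : (2 ^ t) ^ 2 <= _)%N; rewrite ?leq_exp2r // -expnM leq_exp2l // mulnC.
apply: (@le_trans _ _ (\sum_(0 <= i < K) ((if (i < 2 * t)%N then 2 else 0) + (if (0 < i)%N then 1040 * i%:R^-1 else 0)))).
  apply: ler_sum => i _; case: ltnP => hi; last first.
    case: (posnP i) => i0; last by rewrite add0r b2.
    have : (2 ^ 0 < 2 ^ t)%N by apply: leq_trans mt; rewrite expn0.
    by rewrite ltn_exp2l //; lia.
  apply: le_trans (b1 i) _; rewrite lerDl; case: ifP => // i0.
  by rewrite mulr_ge0 // invr_ge0 ler0n.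
rewrite big_split /=; apply: lerD.
  rewrite -big_mkcond /= big_const_seq iter_addr_0 -mulr_natr.
  have : (count (fun i => (i < 2 * t)%N) (index_iota 0 K) <= 2 * t)%N.
    rewrite -size_filter -[leqRHS](size_iota 0); apply: uniq_leq_size.
      by rewrite filter_uniq ?iota_uniq.
    by move=> i; rewrite mem_filter mem_iota add0n => /andP[].
  by rewrite -(ler_nat R) natrM; lra.
case: K NK K0 => [|K] _ _; first by rewrite !big_geq // mulr0.
rewrite big_nat_recl // add0r /= -mulr_sumr.
by rewrite (big_add1 _ _ 0%N K.+1) /=.
Qed.
End BrunTitchmarsh.

(** * Averages over n <= N *)

Section Means.
Variable R : realFieldType.
Variable N : nat.

Lemma sum_dvdn_le d : (0 < d)%N ->
  \sum_(1 <= n < N.+1) (d %| n)%N%:R <= N%:R / d%:R :> R.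
Proof.
move=> d0; rewrite ler_pdivlMr ?ltr0n // -natr_sum -natrM ler_nat.
rewrite -leq_divRL // -count_sum -size_filter -[leqRHS](size_iota 1).
rewrite -(size_map (fun n => n %/ d)%N); apply: uniq_leq_size.
  rewrite map_inj_in_uniq ?filter_uniq ?iota_uniq // => x y.
  rewrite !mem_filter => /andP[dx _] /andP[dy _] e.
  by rewrite -(divnK dx) -(divnK dy) e.
move=> _ /mapP[n + ->]; rewrite mem_filter mem_index_iota => /and3P[dn n1 nN].
rewrite mem_iota divn_gt0 // (dvdn_leq n1 dn) add1n ltnS.
exact: leq_div2r.
Qed.

Lemma logn_pred_sum q n : prime q -> (0 < n <= N)%N -> 
  (logn q n).-1 = (\sum_(1 <= j < N) (q ^ j.+1 %| n))%N.
Proof.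
move=> pq /andP[n0 nN]; rewrite -count_sum -size_filter -[LHS](size_iota 1).
apply: perm_size; apply: uniq_perm; rewrite ?filter_uniq ?iota_uniq // => j.
rewrite mem_filter mem_index_iota mem_iota pfactor_dvdn //.
have := ltn_logl q n0; case: (logn q n) => [|k] /=; lia.
Qed.

(** If q^(k + 2) is the exact power of q in n then the single term j = k + 1 of
the sum is (k + 2)^2, already more than the (k + 1)^2 required. *)
Lemma mean_logn_pred_sqr q : prime q ->
  \sum_(1 <= n < N.+1) ((logn q n).-1)%:R ^+ 2 <=
    N%:R * \sum_(1 <= j < N) j.+1%:R ^+ 2 / (q ^ j.+1)%:R :> R.
Proof.
move=> pq; apply: (@le_trans _ _ (\sum_(1 <= n < N.+1) \sum_(1 <= j < N) j.+1%:R ^+ 2 * (q ^ j.+1 %| n)%N%:R)).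
  rewrite big_nat_cond [leRHS]big_nat_cond; apply: ler_sum => n.
  rewrite ltnS andbT => /andP[n0 nN].
  have ge0 (j : nat) : (0 : R) <= j.+1%:R ^+ 2 * (q ^ j.+1 %| n)%N%:R by rewrite mulr_ge0 ?sqr_ge0.
  case k_: (logn q n) => [|[|k]]; rewrite /= ?expr0n /= ?sumr_ge0 //.
  have kN : (1 <= k.+1 < N)%N by have := ltn_logl q n0; rewrite k_; lia.
  rewrite (bigD1_seq k.+1) ?mem_index_iota ?iota_uniq //= pfactor_dvdn // k_ ltnSn mulr1.
  apply: (@le_trans _ _ (k.+2%:R ^+ 2)); first by rewrite -!natrX ler_nat leq_exp2r.
  by rewrite lerDl sumr_ge0.
rewrite exchange_big /= mulr_sumr; apply: ler_sum => j _.
rewrite -mulr_sumr mulrCA; apply: ler_wpM2l; first exact: sqr_ge0.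
by apply: sum_dvdn_le; rewrite expn_gt0 prime_gt0.
Qed.

Variable m : nat.
Hypothesis m1 : (1 < m)%N.
Let P := primes_1mod m 1 N.+1.
Let w n : nat := nb_prime_divisors1 m n.
Let beta := recip_primes_1mod R m N.

Lemma nb_prime_divisors1_sum n : (0 < n <= N)%N -> w n = (\sum_(p <- P) (p %| n))%N.
Proof.
move=> /andP[n0 nN]; rewrite /w /nb_prime_divisors1 -count_sum -!size_filter.
apply: perm_size; apply: uniq_perm.
- by rewrite filter_uniq ?primes_uniq.
- by rewrite !filter_uniq ?iota_uniq.
move=> p; rewrite !mem_filter mem_primes mem_index_iota n0 /=.
case pn : (p %| n)%N; rewrite ?andbF //=.
case: (boolP (prime p)) => pp; rewrite ?andbF ?andbT //=.
by rewrite prime_gt0 //= ltnS (leq_trans (dvdn_leq n0 pn) nN) andbT.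
Qed.

Let PP p : p \in P -> prime p /\ (0 < p)%N.
Proof. by move/(primes_1modP m1) => [pp _ _ _]; rewrite prime_gt0. Qed.

Lemma mean_nb_prime_divisors1 : \sum_(1 <= n < N.+1) (w n)%:R <= N%:R * beta.
Proof.
rewrite big_nat_cond (eq_bigr (fun n => \sum_(p <- P) (p %| n)%N%:R)); last first.
  by move=> n; rewrite ltnS andbT => h; rewrite nb_prime_divisors1_sum // natr_sum.
rewrite -big_nat_cond exchange_big /= mulr_sumr big_seq [leRHS]big_seq.
by apply: ler_sum => p /PP[_ p0]; apply: sum_dvdn_le.
Qed.

(** w (w - 1) counts the ordered pairs of distinct primes, and two distinct
primes divide n when their product does. *)
Lemma mean_nb_prime_divisors1_pairs :
  \sum_(1 <= n < N.+1) (w n)%:R * ((w n)%:R - 1) <= N%:R * beta ^+ 2.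
Proof.
have uP : uniq P by rewrite filter_uniq ?iota_uniq.
rewrite big_nat_cond (eq_bigr (fun n => \sum_(p <- P) \sum_(p' <- P | p' != p) (p * p' %| n)%N%:R)); last first.
  move=> n; rewrite ltnS andbT => h; rewrite nb_prime_divisors1_sum // natr_sum.
  rewrite mulr_suml; apply: eq_big_seq => p pP.
  rewrite (bigD1_seq p) //= -big_filter; case pn : (p %| n)%N; last first.
    rewrite mul0r big1_seq // => p' _; apply/eqP; rewrite pnatr_eq0 eqb0.
    by apply: contraFN pn; apply: dvdn_trans; apply: dvdn_mulr.
  rewrite mul1r addrAC subrr add0r big_filter; rewrite big_seq_cond [RHS]big_seq_cond.
  apply: eq_bigr => p' /andP[p'P nee]; rewrite Gauss_dvd ?pn //.
  by rewrite prime_coprime ?(PP pP).1 // dvdn_prime2 ?(PP pP).1 ?(PP p'P).1 // eq_sym.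
rewrite -big_nat_cond exchange_big /= expr2 mulrA mulr_sumr big_seq [leRHS]big_seq.
apply: ler_sum => p /PP[_ p0].
rewrite exchange_big /=.
have -> : N%:R * beta / p%:R = \sum_(p' <- P) N%:R * p%:R^-1 * p'%:R^-1 by rewrite -mulr_sumr mulrAC.
apply: (@le_trans _ _ (\sum_(p' <- P | p' != p) N%:R * p%:R^-1 * p'%:R^-1)).
  rewrite big_seq_cond [leRHS]big_seq_cond; apply: ler_sum => p' /andP[/PP[_ p'0] _].
  by apply: le_trans (sum_dvdn_le _) _; rewrite ?muln_gt0 ?p0 // natrM invfM mulrA.
rewrite [leLHS]big_mkcond; apply: ler_sum => p' _; case: ifP => // _.
by rewrite !mulr_ge0 ?invr_ge0 ?ler0n.
Qed.

Lemma mean_nb_prime_divisors1_sqr :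
  \sum_(1 <= n < N.+1) (w n)%:R ^+ 2 <= N%:R * (beta ^+ 2 + beta).
Proof.
rewrite (eq_bigr (fun n => (w n)%:R * ((w n)%:R - 1) + (w n)%:R)); last by move=> n _; ring.
by rewrite big_split /= mulrDr lerD ?mean_nb_prime_divisors1_pairs ?mean_nb_prime_divisors1.
Qed.

(** The hypothesis makes q^(j + 1) and p coprime, so that they divide n together
exactly when their product does. *)
Lemma mean_logn_pred_mul q : prime q -> (forall p, p \in P -> p != q) ->
  \sum_(1 <= n < N.+1) ((logn q n).-1)%:R * (w n)%:R <=
    N%:R * (beta * \sum_(1 <= j < N) (q ^ j.+1)%:R^-1).
Proof.
move=> pq pneq; rewrite big_nat_cond (eq_bigr (fun n => \sum_(1 <= j < N) \sum_(p <- P) (q ^ j.+1 * p %| n)%N%:R)); last first.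
  move=> n; rewrite ltnS andbT => h; rewrite nb_prime_divisors1_sum // logn_pred_sum // !natr_sum.
  rewrite mulr_suml; apply: eq_bigr => j _; rewrite mulr_sumr; apply: eq_big_seq => p pP.
  rewrite -natrM mulnb Gauss_dvd // coprimeXl // prime_coprime // dvdn_prime2 ?(PP pP).1 //.
  by rewrite eq_sym pneq.
rewrite -big_nat_cond exchange_big /= mulrCA !mulr_sumr; apply: ler_sum => j _.
rewrite exchange_big /= mulrCA mulr_suml mulr_sumr big_seq [leRHS]big_seq.
have qj : (0 < q ^ j.+1)%N by rewrite expn_gt0 prime_gt0.
apply: ler_sum => p /PP[_ p0].
apply: le_trans (sum_dvdn_le _) _; rewrite ?muln_gt0 ?p0 ?qj // natrM invfM.
by rewrite (mulrC (p%:R^-1)).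
Qed.
End Means.

From mathcomp Require Import all_classical all_reals all_analysis.
Import numFieldNormedType.Exports.
Local Open Scope ring_scope.

(** * The contribution of one prime to the logarithm *)

Section Pointwise.
Variable R : realType.

Lemma ln_mono (x y : R) : 0 < x -> x <= y -> ln x <= ln y.
Proof. by move=> x0 xy; rewrite ler_ln ?posrE // (lt_le_trans x0). Qed.

Definition primes_below B : seq nat := [seq q <- index_iota 0 B | prime q].

Lemma primes_belowP B q : q \in primes_below B -> prime q /\ (q < B)%N.
Proof. by rewrite mem_filter mem_index_iota => /andP[]. Qed.

Lemma ln_prod_nat (I : eqType) (r : seq I) (F : I -> nat) :
  (forall i, i \in r -> 0 < F i)%N ->
  ln (\prod_(i <- r) F i)%N%:R = \sum_(i <- r) ln (F i)%:R :> R.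
Proof.
elim: r => [_|i r IH h]; first by rewrite !big_nil ln1.
have h' j : j \in r -> (0 < F j)%N by move=> jr; apply: h; rewrite inE jr orbT.
have pr : (0 < \prod_(j <- r) F j)%N.
  by rewrite big_seq; elim/big_rec: _ => // j x jr x0; rewrite muln_gt0 h' ?x0.
rewrite !big_cons natrM lnM ?posrE ?ltr0n ?IH //.
by apply: h; rewrite mem_head.
Qed.

Lemma nb_Sylow_subgroups_gt0 q n : (0 < nb_Sylow_subgroups q n)%N.
Proof.
by rewrite /nb_Sylow_subgroups card_gt0; apply/set0Pn; exists 1%G; rewrite inE sub1G.
Qed.

Lemma primes_totient_sub n B q : (0 < n < B)%N -> 
  (q \in primes (totient n)) = (q \in [seq q <- primes_below B | q %| totient n])%N.
Proof.
move=> /andP[n0 nB]; rewrite mem_primes !mem_filter mem_index_iota totient_gt0 n0 /=.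
case: (boolP (prime q)) => //= pq; case qd : (q %| totient n)%N => //=.
have t0 : (0 < totient n)%N by rewrite totient_gt0.
by rewrite (leq_ltn_trans (dvdn_leq t0 qd)) // (leq_ltn_trans (totient_leq n)).
Qed.

Lemma perm_primes_totient n B : (0 < n < B)%N -> 
  perm_eq (primes (totient n)) [seq q <- primes_below B | q %| totient n]%N.
Proof.
move=> h; apply: uniq_perm; rewrite ?primes_uniq ?filter_uniq ?iota_uniq //.
by move=> q; apply: primes_totient_sub.
Qed.

Lemma ln_nb_subgroups_sum n B : (0 < n < B)%N ->
  ln (nb_subgroups_unitsZ n)%:R =
    \sum_(q <- primes_below B) ln (nb_Sylow_subgroups q n)%:R :> R.
Proof.
move=> h; have /andP[n0 _] := h; rewrite nb_subgroups_unitsZE // ln_prod_nat; last first.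
  by move=> q _; apply: nb_Sylow_subgroups_gt0.
rewrite (perm_big _ (perm_primes_totient h)) /= big_filter big_mkcond /=.
apply: eq_big_seq => q /primes_belowP[pq _]; case: ifPn => // nd.
by rewrite Sylow_subgroups_trivial // ln1.
Qed.

Lemma nb_prime_divisors_totient n B : (0 < n < B)%N ->
  (nb_prime_divisors (totient n) = \sum_(q <- primes_below B) (q %| totient n))%N.
Proof.
move=> h; rewrite /nb_prime_divisors (perm_size (perm_primes_totient h)).
by rewrite size_filter count_sum.
Qed.

(** A prime power determines its prime and its exponent. *)
Lemma sum_vonMangoldt (F : nat -> R) M B L : (M <= B)%N -> (M <= 2 ^ L)%N ->
  \sum_(1 <= m < M) F m * vonMangoldt R m =
  \sum_(q <- primes_below B) ln q%:R * \sum_(0 <= j < L | (q ^ j.+1 < M)%N) F (q ^ j.+1)%N.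
Proof.
move=> MB ML.
have E m : (0 < m < M)%N -> F m * vonMangoldt R m =
    \sum_(q <- primes_below B) \sum_(0 <= j < L) if m == (q ^ j.+1)%N then ln q%:R * F m else 0.
  move=> /andP[m0 mM].
  case: (boolP (size (primes m) == 1%N)) => [|nsz].
    case pm : (primes m) => [|p [|]] // _.
    have : p \in primes m by rewrite pm mem_head.
    rewrite mem_primes => /andP[pp _].
    have em : m = (p ^ logn p m)%N by rewrite [LHS](prod_prime_decomp m0) prime_decompE pm /= big_seq1.
    have k0 : (0 < logn p m)%N by rewrite logn_gt0 pm mem_head.
    have pM : (p < M)%N by apply: leq_ltn_trans mM; rewrite em -{1}[p]expn1 leq_exp2l // prime_gt1.
    have kL : (logn p m <= L)%N.
      rewrite -(leq_exp2l _ _ (isT : 1 < 2)%N); apply: leq_trans ML.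
      by apply: ltnW; apply: leq_ltn_trans mM; rewrite {2}em leq_exp2r // prime_gt1.
    rewrite /vonMangoldt pm (bigD1_seq p) /=; first last.
    - by rewrite filter_uniq ?iota_uniq.
    - by rewrite mem_filter pp mem_index_iota (leq_trans pM).
    rewrite [X in _ + X]big1_seq ?addr0; last first.
      move=> q /andP[qp /primes_belowP[pq _]]; rewrite big1 // => j _; case: eqP => // e.
      by move: pm; rewrite e primesX // primes_prime // => -[e']; rewrite e' eqxx in qp.
    rewrite (bigD1_seq (logn p m).-1) ?mem_index_iota ?iota_uniq ?prednK //=.
    rewrite -em eqxx big1 ?addr0 1?mulrC // => j nj; case: eqP => // e.
    by case/eqP: nj; rewrite e pfactorK.
  have -> : vonMangoldt R m = 0.
    by rewrite /vonMangoldt; case: (primes m) nsz => [|p [|]].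
  rewrite mulr0 big1_seq // => q /primes_belowP[pq _]; rewrite big1 // => j _; case: eqP => // e.
  by move: nsz; rewrite e primesX // primes_prime.
rewrite (eq_big_nat _ _ E) exchange_big /=; apply: eq_big_seq => q /primes_belowP[pq _].
rewrite exchange_big /= mulr_sumr [RHS]big_mkcond /=; apply: eq_bigr => j _.
have qj : (0 < q ^ j.+1)%N by rewrite expn_gt0 prime_gt0.
case: ifPn => h.
  rewrite (bigD1_seq (q ^ j.+1)%N) ?mem_index_iota ?iota_uniq ?qj //= eqxx.
  by rewrite big1 ?addr0 // => m /negbTE ->.
rewrite big_nat_cond big1 // => m /andP[/andP[_ mM] _]; case: eqP => // e.
by rewrite -e mM in h.
Qed.

Lemma ln_lower_aux (a x y e l : R) :
  a * x <= a * (4 * e + y) -> e * a <= l -> a * (x - y) <= 4 * l.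
Proof. lra. Qed.

Lemma ln_upper_aux (a y e l : R) :
  a * (4 * e) <= a * y -> l <= e * a -> 4 * l <= a * y.
Proof. lra. Qed.

Section OnePrime.
Variables (n q L : nat).
Hypotheses (n0 : (0 < n)%N) (pq : prime q) (nL : (n <= L)%N).
Let w j : R := (nb_prime_divisors1 (q ^ j.+1) n)%:R.
Let v : R := ((logn q n).-1)%:R.
Let S : R := (nb_Sylow_subgroups q n)%:R.
Let W1 : R := \sum_(1 <= j < L) w j.
Let W2 : R := \sum_(1 <= j < L) w j ^+ 2.

Let L0 : (0 < L)%N := leq_trans n0 nL.

Let sum0 (F : nat -> R) : \sum_(0 <= j < L) F j = F 0%N + \sum_(1 <= j < L) F j.
Proof. by rewrite big_ltn. Qed.

Let lnq0 : 0 <= ln q%:R :> R.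
Proof. by rewrite ln_ge0 // ler1n prime_gt0. Qed.

Let S1 : 1 <= S. Proof. by rewrite ler1n nb_Sylow_subgroups_gt0. Qed.

Let w_ge0 j : 0 <= w j. Proof. exact: ler0n. Qed.
Let v_ge0 : 0 <= v. Proof. exact: ler0n. Qed.
Let v_sqr : v <= v ^+ 2. Proof. by rewrite -natrX ler_nat; case: (logn q n).-1 => // k; rewrite -{1}[k.+1]expn1 leq_pexp2l. Qed.
Let w_sqr j : w j <= w j ^+ 2.
Proof. by rewrite -natrX ler_nat; case: nb_prime_divisors1 => // k; rewrite -{1}[k.+1]expn1 leq_pexp2l. Qed.
Let W1_sqr : W1 <= W2. Proof. exact: ler_sum. Qed.
Let W1_ge0 : 0 <= W1. Proof. exact: sumr_ge0. Qed.

Let lower : ln q%:R * (w 0%N ^+ 2 + W2 - (w 0%N + W1)) <= 4 * ln S.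
Proof.
have [E h1 h2] := Sylow_subgroups_lower n0 pq nL.
have : E%:R * ln q%:R <= ln S.
  rewrite mulr_natl -lnXn ?ltr0n ?prime_gt0 //; apply: ln_mono; last by rewrite -natrX ler_nat.
  by rewrite exprn_gt0 // ltr0n prime_gt0.
have : w 0%N ^+ 2 + W2 <= 4 * E%:R + (w 0%N + W1).
  rewrite -!sum0 !big_mkord; move: h2; rewrite -(ler_nat R) natrD natrM !natr_sum.
  by move=> h2; apply: le_trans h2; apply: ler_sum => j _; rewrite natrM expr2.
by move=> /(ler_wpM2l lnq0) h3 h4; apply: ln_lower_aux h3 h4.
Qed.

Let upper : 4 * ln S <= ln q%:R * (w 0%N ^+ 2 + W2 + 8 * (w 0%N + W1) + 2 * w 0%N * v + v ^+ 2 + 8 * v).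
Proof.
have [U h1 h2] := Sylow_subgroups_upper n0 pq nL.
have : ln S <= U%:R * ln q%:R.
  rewrite mulr_natl -lnXn ?ltr0n ?prime_gt0 //; apply: ln_mono; last by rewrite -natrX ler_nat.
  exact: lt_le_trans ltr01 S1.
have : 4 * U%:R <= w 0%N ^+ 2 + W2 + 8 * (w 0%N + W1) + 2 * w 0%N * v + v ^+ 2 + 8 * v.
  rewrite -!sum0 !big_mkord; move: h2; rewrite -(ler_nat R) (natrM R 4 U).
  (* Four rewrites exactly: a product by a numeral would unfold to a sum. *)
  rewrite natrD natrD natrD natrD !natrM !natr_sum.
  rewrite (eq_bigr (fun i : 'I_L => w i ^+ 2)); last by move=> i _; rewrite natrM expr2.
  by rewrite -(expr2 (logn q n).-1%:R).
by move=> /(ler_wpM2l lnq0) h3 h4; apply: ln_upper_aux h3 h4.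
Qed.

(** The bounds of [Sylow_subgroups_lower] and [Sylow_subgroups_upper], with
v <= v^2 used to absorb the linear terms in v. *)
Lemma ln_Sylow_subgroups_quarter :
  `|ln S - ln q%:R / 4 * (w 0%N ^+ 2 + W2)| <= ln q%:R * (2 * (w 0%N + W1) + w 0%N * v + 3 * v ^+ 2).
Proof.
have := lower; have := upper.
have := mulr_ge0 lnq0 (mulr_ge0 (w_ge0 0) v_ge0).
have := ler_wpM2l lnq0 v_sqr.
have := mulr_ge0 lnq0 (w_ge0 0); have := mulr_ge0 lnq0 W1_ge0; have := mulr_ge0 lnq0 v_ge0.
move: (ln q%:R) (ln S) (w 0%N) => a b c *.
by rewrite ler_norml; apply/andP; split; lra.
Qed.

(** A Sylow subgroup of order 1 or q has 1 or 2 subgroups, and the left-hand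
side vanishes. Otherwise the sum of the w_j and of v is at least 2, so that
w_0 >= 2, or w_j >= 1 for some j >= 1, or v >= 1. In all cases
w_0^2 <= 2 w_0 (w_0 - 1) + W1 + v, which turns the upper bound for the number of
subgroups into the stated one. *)
Lemma ln_Sylow_subgroups_ln2 :
  `|ln S - ln 2 * (q %| totient n)%N%:R| <=
     ln q%:R * (5 * (w 0%N * (w 0%N - 1)) + 5 * W2 + 5 * (w 0%N * v) + 5 * v ^+ 2).
Proof.
have w0 : 0 <= w 0%N * (w 0%N - 1).
  by rewrite mulrBr mulr1 -expr2 subr_ge0.
have rhs0 : 0 <= 5 * (w 0%N * (w 0%N - 1)) + 5 * W2 + 5 * (w 0%N * v) + 5 * v ^+ 2.
  have := mulr_ge0 (w_ge0 0) v_ge0; have := sqr_ge0 v; have : 0 <= W2 by apply: le_trans W1_sqr.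
  lra.
case: (boolP (q %| totient n)%N) => qd; last first.
  by rewrite /S Sylow_subgroups_trivial // ln1 mulr0 subr0 normr0 mulr_ge0.
rewrite mulr1.
have S2 : 2 <= S by rewrite ler_nat Sylow_subgroups_ge2.
have lnS2 : ln 2 <= ln S by apply: ln_mono => //; lra.
have ln20 : 0 <= ln 2 :> R by rewrite ln_ge0 //; lra.
rewrite ger0_norm ?subr_ge0 //.
case: (leqP (\sum_(i < L) nb_prime_divisors1 (q ^ i.+1) n + (logn q n).-1)%N 1) => [h|h].
  have : nb_Sylow_subgroups q n = 2.
    apply/eqP; rewrite eqn_leq (Sylow_subgroups_le2 n0 pq nL h).
    exact: Sylow_subgroups_ge2.
  by rewrite /S => ->; rewrite subrr mulr_ge0.
have key : w 0%N ^+ 2 <= 2 * (w 0%N * (w 0%N - 1)) + W1 + v.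
  have : (2 : R) <= w 0%N + W1 + v.
    move: h; rewrite -(ler_nat R) natrD natr_sum.
    by rewrite -(big_mkord xpredT w) sum0.
  move: W1 v W1_ge0 v_ge0 => a b a0 b0; rewrite /w.
  case: (nb_prime_divisors1 (q ^ 1) n) => [|[|k]] h1.
  - by rewrite expr0n /=; lra.
  - by rewrite mulr1n in h1 *; lra.
  have : (0 : R) <= k%:R by rewrite ler0n.
  rewrite -(natr1 k.+1) -(natr1 k); move: (k%:R : R) => x x0; nra.
have e : 4 * (ln S - ln 2) <= 4 * (ln q%:R * (5 * (w 0%N * (w 0%N - 1)) + 5 * W2 + 5 * (w 0%N * v) + 5 * v ^+ 2)).
  apply: (@le_trans _ _ (4 * ln S)); first by lra.
  apply: le_trans upper _; rewrite mulrCA; apply: ler_wpM2l => //.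
  have := w_sqr 0; have := mulr_ge0 (w_ge0 0) v_ge0; have := w_ge0 0; have := v_sqr; have := W1_sqr.
  have := W1_ge0; have := v_ge0.
  move: (w 0%N) key w0 => x *; lra.
by rewrite ler_pM2l in e.
Qed.

End OnePrime.
End Pointwise.

(** * Logarithmic sums *)

Section Logs.
Variable R : realType.

Lemma ln2_le1 : ln 2 <= 1 :> R.
Proof. by have := @le_ln1Dx R 1; rewrite (_ : 1 + 1 = 2) //; apply; lra. Qed.

Lemma ln2_gehalf : 2^-1 <= ln 2 :> R.
Proof.
have := @le_ln1Dx R (- 2^-1); rewrite (_ : 1 + - 2^-1 = 2^-1); last by field.
by rewrite lnV ?posrE // => h; have := h ltac:(lra); lra.
Qed.

Lemma trunc_log2_le_ln n : (0 < n)%N -> (trunc_log 2 n)%:R <= 2 * ln n%:R :> R.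
Proof.
move=> n0; have : (2 ^ trunc_log 2 n)%N%:R <= n%:R :> R by rewrite ler_nat trunc_logP.
move/(ln_mono _); rewrite natrX lnXn // -[_ *+ trunc_log 2 n]mulr_natl => h.
have {}h := h ltac:(by rewrite exprn_gt0).
by have := ler_wpM2l (ler0n R (trunc_log 2 n)) ln2_gehalf; lra.
Qed.

Lemma ln_lt_exp2 n i : (0 < n)%N -> (n < 2 ^ i)%N -> ln n%:R <= i%:R :> R.
Proof.
move=> n0 ni; apply: (@le_trans _ _ (ln (2 ^ i)%N%:R)).
  by apply: ln_mono; rewrite ?ltr0n // ler_nat ltnW.
rewrite natrX lnXn // -[_ *+ i]mulr_natl -[leRHS]mulr1; apply: ler_wpM2l => //; exact: ln2_le1.
Qed.

Lemma harmonic_sum_le K : (0 < K)%N -> \sum_(1 <= i < K.+1) i%:R^-1 <= 1 + ln K%:R :> R.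
Proof.
case: K => // K _; elim: K => [|K IH]; first by rewrite big_nat1 invr1 ln1 addr0.
rewrite big_nat_recr //=; apply: (le_trans (lerD IH (lexx _))).
rewrite -addrA lerD2l; have K0 : (0 : R) < K.+1%:R by rewrite ltr0n.
have e : K.+2%:R = K.+1%:R + 1 :> R by rewrite -natr1.
move: e K0; move: (K.+1%:R : R) => x -> x0.
have := @le_ln1Dx R (- (x + 1)^-1).
rewrite (_ : 1 + - (x + 1)^-1 = x / (x + 1)); last by field; lra.
rewrite ln_div ?posrE //; last by lra.
move=> h; have : (x + 1)^-1 < 1 by rewrite invf_lt1; lra.
by move=> h'; have := h ltac:(lra); lra.
Qed.

Lemma recip_primes_1mod_ln (x : R) l a : 1 <= ln (ln x) -> prime l -> (0 < a)%N ->
  recip_primes_1mod R (l ^ a) (Num.truncn x) <= 4200 * (ln (ln x) + ln (l ^ a)%N%:R) / (l ^ a)%N%:R.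
Proof.
move=> lam1 pl a0; set m := (l ^ a)%N; set N := Num.truncn x; set lam := ln (ln x) in lam1 *.
have m0 : (0 < m)%N by rewrite expn_gt0 prime_gt0.
have lnx1 : 1 < ln x.
  by rewrite ltNge; apply/negP => /ln_le0; rewrite -/lam; lra.
have x1 : 1 < x by rewrite ltNge; apply/negP => /ln_le0; lra.
have N0 : (0 < N)%N by rewrite /N truncn_gt0 ltW.
have Nx : N%:R <= x by rewrite truncn_le // ltW // (lt_trans ltr01).
(* K is at most 3 ln x, so that the harmonic sum below K is at most ln ln x + 3,
   hence at most 4 ln ln x; and 4 t is at most 8 ln m + 4. This gives the constant. *)
pose K := (trunc_log 2 N).+1; pose t := (trunc_log 2 m).+1.
have NK : (N < 2 ^ K)%N by apply: trunc_log_ltn.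
have mt : (m <= 2 ^ t)%N by apply/ltnW/trunc_log_ltn.
have := @recip_primes_1mod_le R l a t N K pl a0 mt NK; rewrite -/m.
have h1 : \sum_(1 <= i < K) i%:R^-1 <= 1 + ln K%:R :> R.
  apply: le_trans (harmonic_sum_le (ltn0Sn _)).
  by rewrite [leRHS]big_nat_recr //= lerDl invr_ge0 ler0n.
have KL : K%:R <= 3 * ln x.
  rewrite /K -natr1; have := trunc_log2_le_ln N0.
  have : ln N%:R <= ln x by apply: ln_mono; rewrite ?ltr0n.
  lra.
have lnK : ln K%:R <= 2 + lam.
  apply: (@le_trans _ _ (ln (3 * ln x))); first by apply: ln_mono; rewrite ?ltr0n.
  rewrite lnM ?posrE //; last by lra.
  rewrite lerD2r; have := @le_ln1Dx R 2; rewrite (_ : 1 + 2 = 3); last by ring.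
  by apply; lra.
have tl : t%:R <= 2 * ln m%:R + 1 :> R by rewrite /t -natr1; have := trunc_log2_le_ln m0; lra.
have lm : 0 <= ln m%:R :> R by rewrite ln_ge0 // ler1n.
move=> h; rewrite ler_pdivlMr ?ltr0n // mulrC; apply: le_trans h _; lra.
Qed.

Lemma geometric_sum_le L : \sum_(0 <= i < L) (3 / 4) ^+ i <= 4 :> R.
Proof.
suff -> : \sum_(0 <= i < L) (3 / 4) ^+ i = 4 - 4 * (3 / 4) ^+ L :> R.
  by rewrite gerBl mulr_ge0 // exprn_ge0 // divr_ge0.
elim: L => [|L IH]; first by rewrite big_geq // expr0; ring.
by rewrite big_nat_recr //= IH exprS; field.
Qed.

Lemma geometric_half_sum_le i0 K : \sum_(i0 <= i < K) (2 ^+ i)^-1 <= 2 / 2 ^+ i0 :> R.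
Proof.
have [K0|K0] := leqP K i0; first by rewrite big_geq // divr_ge0 // exprn_ge0.
rewrite -(subnKC (ltnW K0)); move: (K - i0)%N => d.
suff -> : \sum_(i0 <= i < i0 + d) (2 ^+ i)^-1 = 2 / 2 ^+ i0 - 2 / 2 ^+ (i0 + d) :> R.
  by rewrite gerBl divr_ge0 // exprn_ge0.
elim: d => [|d IH]; first by rewrite addn0 big_geq // subrr.
rewrite addnS big_nat_recr ?leq_addr //= IH exprS; field.
by rewrite !expf_neq0.
Qed.

(** Compares (i + 2)^2 / 2^i with a geometric series of ratio 3 / 4; likewise
[cube_exp_bound] below. *)
Lemma sqr_exp_bound i : ((i + 2) ^ 2 * 2 ^ i <= 8 * 3 ^ i)%N.
Proof.
have [i3|] := ltnP i 3; first by case: i i3 => [|[|[|]]].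
move=> /subnK <-; elim: (i - 3)%N => [//|k IH].
rewrite addSn (expnS 2 (k + 3)) (expnS 3 (k + 3)).
move: (2 ^ (k + 3))%N (3 ^ (k + 3))%N IH => x y; rewrite -!mulnn; nia.
Qed.

Lemma cube_exp_bound i : ((i + 2) ^ 3 * 2 ^ i <= 46 * 3 ^ i)%N.
Proof.
have [i3|] := ltnP i 6; first by case: i i3 => [|[|[|[|[|[|]]]]]].
move=> /subnK <-; elim: (i - 6)%N => [//|k IH].
rewrite addSn (expnS 2 (k + 6)) (expnS 3 (k + 6)).
have h : (2 * (k + 6).+1.+2 ^ 3 <= 3 * (k + 6).+2 ^ 3)%N by rewrite !expnS; nia.
rewrite !addn2 in IH *; move: (2 ^ (k + 6))%N (3 ^ (k + 6))%N IH h => x y.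
move: (_ ^ 3)%N (_ ^ 3)%N => a b; nia.
Qed.

Lemma sum_prime_powers_le q L : (1 < q)%N ->
  \sum_(1 <= j < L) j.+1%:R ^+ 2 / (q ^ j.+1)%N%:R <= 32 / q%:R ^+ 2 :> R.
Proof.
move=> q1; have q0 : (0 : R) < q%:R by rewrite ltr0n ltnW.
have q2 : (2 : R) <= q%:R by rewrite ler_nat.
case: L => [|L]; first by rewrite big_geq // divr_ge0 // exprn_ge0.
rewrite big_add1 /=.
apply: (@le_trans _ _ (\sum_(0 <= i < L) 8 / q%:R ^+ 2 * (3 / 4) ^+ i)); last first.
  rewrite -mulr_sumr; have := geometric_sum_le L => h.
  apply: (@le_trans _ _ (8 / q%:R ^+ 2 * 4)); last by rewrite le_eqVlt; apply/orP; left; apply/eqP; field; lra.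
  by apply: ler_wpM2l => //; rewrite divr_ge0 // exprn_ge0 // ltW.
apply: ler_sum => i _.
have h := sqr_exp_bound i; rewrite addn2 in h.
have {}h : (i.+2)%:R ^+ 2 * 2 ^+ i <= 8 * 3 ^+ i :> R.
  by move: h; rewrite -(ler_nat R) !natrM !natrX.
have q2i : 2 ^+ i <= q%:R ^+ i :> R by apply: lerXn2r; rewrite ?nnegrE // ltW.
have p2 : (0 : R) < 2 ^+ i by rewrite exprn_gt0.
have p4 : (0 : R) < q%:R ^+ 2 by rewrite exprn_gt0.
have pq : (0 : R) < q%:R ^+ i by rewrite exprn_gt0.
rewrite natrX -(addn2 i) exprD (mulrC (q%:R ^+ i)) ler_pdivrMr ?mulr_gt0 //.
rewrite addn2 expr_div_n (_ : 4 ^+ i = 2 ^+ i * 2 ^+ i); last by rewrite -exprMn -natrM.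
apply: (@le_trans _ _ (8 * 3 ^+ i / 2 ^+ i)); first by rewrite ler_pdivlMr.
have -> : 8 / q%:R ^+ 2 * (3 ^+ i / (2 ^+ i * 2 ^+ i)) * (q%:R ^+ 2 * q%:R ^+ i) =
   8 * 3 ^+ i / 2 ^+ i * (q%:R ^+ i / 2 ^+ i) :> R.
  by field; rewrite !gt_eqF.
by rewrite ler_peMr // ler_pdivlMr // mul1r.
Qed.

Lemma sum_ln_cube_sqr_le B :
  \sum_(1 <= n < B) (1 + ln n%:R) ^+ 3 / n%:R ^+ 2 <= 184 :> R.
Proof.
have t0 n : (0 < n)%N -> 0 <= (1 + ln n%:R) ^+ 3 / n%:R ^+ 2 :> R.
  by move=> n0; rewrite divr_ge0 ?exprn_ge0 // addr_ge0 // ln_ge0 // ler1n.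
apply: (@le_trans _ _ (\sum_(1 <= n < 2 ^ B) (1 + ln n%:R) ^+ 3 / n%:R ^+ 2)).
  have BB : (B <= 2 ^ B)%N by rewrite ltnW // ltn_expl.
  case: (posnP B) => [->|B0]; first by rewrite !big_geq.
  rewrite [leRHS](big_cat_nat B0 BB) //= lerDl big_nat_cond; apply: sumr_ge0 => n /andP[/andP[h _] _].
  by apply: t0; apply: leq_trans h.
rewrite dyadic_sum.
apply: (@le_trans _ _ (\sum_(0 <= i < B) 46 * (3 / 4) ^+ i)); last first.
  by rewrite -mulr_sumr; have := geometric_sum_le B; lra.
rewrite big_mkord; apply: ler_sum => i _.
apply: (@le_trans _ _ (\sum_(2 ^ i <= n < 2 ^ i.+1) (i%:R + 2) ^+ 3 / (2 ^+ i) ^+ 2)).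
  rewrite big_nat_cond [leRHS]big_nat_cond; apply: ler_sum => n /andP[/andP[h1 h2] _].
  have n0 : (0 < n)%N by apply: leq_trans h1; rewrite expn_gt0.
  have l0 : 0 <= ln n%:R :> R by rewrite ln_ge0 // ler1n.
  have l1 := ln_lt_exp2 n0 h2; rewrite -natr1 in l1.
  apply: ler_pM; rewrite ?exprn_ge0 ?invr_ge0 ?exprn_ge0 //; first by lra.
    by apply: lerXn2r; rewrite ?nnegrE //; lra.
  rewrite lef_pV2 ?posrE ?exprn_gt0 ?ltr0n //.
  by apply: lerXn2r; rewrite ?nnegrE ?exprn_ge0 // -natrX ler_nat.
rewrite big_const_nat iter_addr_0 expnS mul2n -addnn addnK -[_ *+ 2 ^ i]mulr_natr natrX.
have h := cube_exp_bound i.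
have {}h : (i%:R + 2) ^+ 3 * 2 ^+ i <= 46 * 3 ^+ i :> R.
  by move: h; rewrite -(ler_nat R) !natrM !natrX natrD.
have p2 : (0 : R) < 2 ^+ i by rewrite exprn_gt0.
rewrite expr_div_n (_ : 4 ^+ i = 2 ^+ i * 2 ^+ i); last by rewrite -exprMn -natrM.
rewrite expr2 mulrA ler_pdivlMr ?mulr_gt0 //.
suff -> : (i%:R + 2) ^+ 3 / (2 ^+ i * 2 ^+ i) * 2 ^+ i * (2 ^+ i * 2 ^+ i) =
  (i%:R + 2) ^+ 3 * 2 ^+ i :> R by [].
by field; rewrite gt_eqF.
Qed.

Lemma sum_ln_div_below M : (0 < M)%N ->
  \sum_(1 <= n < M) (1 + ln n%:R) ^+ 2 / n%:R <= (1 + ln M%:R) ^+ 3 :> R.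
Proof.
move=> M0; have lM : 0 <= ln M%:R :> R by rewrite ln_ge0 // ler1n.
apply: (@le_trans _ _ (\sum_(1 <= n < M) (1 + ln M%:R) ^+ 2 * n%:R^-1)).
  rewrite big_nat_cond [leRHS]big_nat_cond; apply: ler_sum => n /andP[/andP[h1 h2] _].
  apply: ler_wpM2r; first by rewrite invr_ge0 ler0n.
  have ln0 : 0 <= ln n%:R :> R by rewrite ln_ge0 // ler1n.
  have : ln n%:R <= ln M%:R :> R by apply: ln_mono; rewrite ?ltr0n // ler_nat ltnW.
  by move=> h; apply: lerXn2r; rewrite ?nnegrE; lra.
rewrite -mulr_sumr [leRHS]exprSr; apply: ler_wpM2l; first by rewrite exprn_ge0 //; lra.
apply: le_trans (harmonic_sum_le M0).
by rewrite [leRHS]big_nat_recr //= lerDl invr_ge0 ler0n.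
Qed.

(** The sieve with modulus 2 bounds the number of primes in the block starting
at 2^i by O(2^i / i), and the factor 1 / i cancels ln q. *)
Lemma sum_primes_ln_sqr_tail M B : (8 <= M)%N ->
  \sum_(q <- primes_below B | (M <= q)%N) ln q%:R / q%:R ^+ 2 <= 4160 / M%:R :> R.
Proof.
move=> M8; have M0 : (0 < M)%N by apply: leq_trans M8.
pose f q : R := if prime q && (M <= q)%N then ln q%:R / q%:R ^+ 2 else 0.
have f0 q : 0 <= f q.
  rewrite /f; case: ifP => // /andP[pq _].
  by rewrite divr_ge0 ?exprn_ge0 // ln_ge0 // ler1n prime_gt0.
apply: (@le_trans _ _ (\sum_(1 <= q < 2 ^ B) f q)).
  rewrite big_filter_cond big_mkcond /=.
  have BB : (B <= 2 ^ B)%N by rewrite ltnW // ltn_expl.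
  case: (posnP B) => [->|B0]; first by rewrite !big_geq.
  rewrite big_ltn //= add0r [leRHS](big_cat_nat B0 BB) //= lerDl.
  exact: sumr_ge0.
rewrite dyadic_sum -(big_mkord xpredT (fun i => \sum_(2 ^ i <= n < 2 ^ i.+1) f n)).
set i0 := trunc_log 2 M.
have i3 : (3 <= i0)%N by apply: trunc_log_max.
have Mi : (M < 2 ^ i0.+1)%N by apply: trunc_log_ltn.
have blk i : \sum_(2 ^ i <= n < 2 ^ i.+1) f n <= if (i0 <= i)%N then 1040 * (2 ^+ i)^-1 else 0.
  case: ifPn => h; last first.
    rewrite big_nat_cond big1 // => n /andP[/andP[_ h2] _].
    rewrite /f; case: ifP => // /andP[_ Mn].
    have : (2 ^ i.+1 <= 2 ^ i0)%N by rewrite leq_exp2l // ltnNge.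
    by have := trunc_logP (isT : 1 < 2)%N M0; rewrite -/i0; lia.
  have i0' : (0 < i)%N by apply: leq_trans h; apply: leq_trans i3.
  have p2 : (0 : R) < 2 ^+ i by rewrite exprn_gt0.
  have := @size_primes_1mod_dyadic R 2 1 i isT isT i0' _.
  rewrite expn1 => /(_ _); set D := size _ => hD.
  have {}hD : D%:R * 2 * i%:R <= 1040 * 2 ^+ i :> R.
    by apply: hD; rewrite leq_exp2l //; apply: leq_trans h; apply: leq_trans i3.
  apply: (@le_trans _ _ (\sum_(q <- primes_1mod 2 (2 ^ i) (2 ^ i.+1)) i.+1%:R / (2 ^+ i) ^+ 2)).
    rewrite big_filter [leRHS]big_mkcond /=.
    apply: ler_sum_nat => q /andP[h1 h2]; rewrite /f.
    case: ifP => [/andP[pq Mq]|_]; last first.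
      by case: ifP => // _; rewrite divr_ge0 ?exprn_ge0.
    have -> : (q == 1 %[mod 2])%N.
      rewrite !modn2 /= eqb1; apply: contraTT pq => ev.
      apply/negP => pq; case: (even_prime pq) => [e|o]; last by rewrite o in ev.
      by move: Mq M8; rewrite e; lia.
    rewrite pq /=; apply: ler_pM.
    - by rewrite ln_ge0 // ler1n prime_gt0.
    - by rewrite invr_ge0 exprn_ge0.
    - by apply: ln_lt_exp2; rewrite ?prime_gt0.
    rewrite lef_pV2 ?posrE ?exprn_gt0 ?ltr0n ?prime_gt0 //.
    by apply: lerXn2r; rewrite ?nnegrE ?exprn_ge0 // -natrX ler_nat.
  rewrite big_const_seq count_predT iter_addr_0 -/D -[_ *+ D]mulr_natr.
  rewrite -(ler_pM2r p2) -[leRHS]mulrA mulVf ?gt_eqF // mulr1.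
  have -> : i.+1%:R / (2 ^+ i) ^+ 2 * D%:R * 2 ^+ i = (i.+1%:R * D%:R) / 2 ^+ i :> R.
    by field; rewrite gt_eqF.
  rewrite ler_pdivrMr //; apply: le_trans hD.
  have : i.+1%:R <= 2 * i%:R :> R by rewrite -natrM ler_nat mul2n -addnn -addn1 leq_add2l.
  by have : (0 : R) <= D%:R by []; nra.
apply: (@le_trans _ _ (\sum_(0 <= i < B) if (i0 <= i)%N then 1040 * (2 ^+ i)^-1 else 0)).
  exact: ler_sum.
rewrite -big_mkcond /=.
apply: (@le_trans _ _ (\sum_(i0 <= i < B) 1040 * (2 ^+ i)^-1)).
  have [Bi|Bi] := leqP B i0.
    rewrite big_nat_cond big_pred0 ?big_geq // => i; apply/negP => /andP[/andP[_ h1] h2].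
    by lia.
  rewrite (big_cat_nat (leq0n i0) (ltnW Bi)) /= [X in X + _]big_nat_cond big_pred0 ?add0r; last first.
    by move=> i; apply/negP => /andP[/andP[_ h1] h2]; lia.
  rewrite big_nat_cond [leRHS]big_nat_cond le_eqVlt; apply/orP; left; apply/eqP.
  by apply: eq_bigl => i; rewrite andbT; case: (i0 <= i)%N; rewrite ?andbT ?andbF.
rewrite -mulr_sumr; have := geometric_half_sum_le i0 B.
have : 2 / 2 ^+ i0 <= 4 / M%:R :> R.
  rewrite ler_pdivrMr ?exprn_gt0 // mulrAC ler_pdivlMr ?ltr0n //.
  have : M%:R <= 2 * 2 ^+ i0 :> R by rewrite -exprS -natrX ler_nat ltnW.
  by lra.
lra.
Qed.
End Logs.

(** * The error term and its mean *)

Section Error.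
Variable R : realType.
Variables N M : nat.

Let w q j n : R := (nb_prime_divisors1 (q ^ j.+1) n)%:R.
Let v q n : R := ((logn q n).-1)%:R.

(** The first term is the main error of the prime q. The cut M separates the
small primes, whose contribution to the approximation is a quarter of a sum of
squares, from the large ones, whose contribution is ln 2. The last bracket collects
the proper prime powers beyond the cut and the effect of powers of q dividing n. *)
Definition prime_error q n : R :=
  (if (q < M)%N then 1 + 2 * (ln q%:R * w q 0 n)
   else 5 * (ln q%:R * (w q 0 n * (w q 0 n - 1))))
  + 5 * ln q%:R * (\sum_(1 <= j < N | (M <= q ^ j.+1)%N) w q j n ^+ 2
                   + \sum_(1 <= j < N) w q j n + v q n * w q 0 n + v q n ^+ 2).

(** For q < M the squares beyond the cut must be removed from the sum in
[ln_Sylow_subgroups_quarter]; they have exponent at least 2. For q >= M all powers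
of q are beyond the cut. *)
Lemma prime_error_bound q n : prime q -> (0 < n <= N)%N ->
  `|ln (nb_Sylow_subgroups q n)%:R - ln 2 * (q %| totient n)%N%:R
    - ln q%:R / 4 * \sum_(0 <= j < N | (q ^ j.+1 < M)%N) w q j n ^+ 2| <= prime_error q n.
Proof.
move=> pq /andP[n0 nN].
have lq : 0 <= ln q%:R :> R by rewrite ln_ge0 // ler1n prime_gt0.
have N0 : (0 < N)%N := leq_trans n0 nN.
set T := \sum_(1 <= j < N | (M <= q ^ j.+1)%N) w q j n ^+ 2.
have T0 : 0 <= T by apply: sumr_ge0 => j _; apply: sqr_ge0.
have W10 : 0 <= \sum_(1 <= j < N) w q j n by apply: sumr_ge0 => j _; apply: ler0n.
have vw : 0 <= v q n * w q 0 n by rewrite mulr_ge0.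
have v2 := sqr_ge0 (v q n).
have lW := mulr_ge0 lq W10; have lT := mulr_ge0 lq T0; have lvw := mulr_ge0 lq vw.
have lv2 := mulr_ge0 lq v2.
rewrite /prime_error -/T; case: ltnP => qM.
  have split_sum : \sum_(0 <= j < N | (q ^ j.+1 < M)%N) w q j n ^+ 2 =
      w q 0 n ^+ 2 + \sum_(1 <= j < N) w q j n ^+ 2 - T.
    rewrite big_mkcond big_ltn //= expn1 qM -addrA; congr (_ + _).
    rewrite [X in _ = X - _](bigID (fun j => (q ^ j.+1 < M)%N)) /= -big_mkcond /=.
    rewrite [X in _ = _ + X - _](eq_bigl (fun j => M <= q ^ j.+1)%N); last by move=> j; rewrite -leqNgt.
    by rewrite addrK.
  rewrite split_sum; have := ln_Sylow_subgroups_quarter R n0 pq nN.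
  have d1 : 0 <= ln 2 * (q %| totient n)%N%:R :> R by rewrite mulr_ge0 // ln_ge0 //; lra.
  have d2 : ln 2 * (q %| totient n)%N%:R <= 1 :> R.
    by have := ln2_le1 R; case: (_ %| _)%N; rewrite /= ?mulr1 ?mulr0 //; lra.
  rewrite -/(w q 0 n) -/(v q n).
  have w0 : 0 <= ln q%:R * w q 0 n by rewrite mulr_ge0.
  rewrite !ler_norml => /andP[h1 h2]; apply/andP; split; lra.
have -> : \sum_(0 <= j < N | (q ^ j.+1 < M)%N) w q j n ^+ 2 = 0.
  rewrite big_pred0 // => j; apply/negbTE; rewrite -leqNgt (leq_trans qM) //.
  by rewrite -{1}[q]expn1 leq_exp2l // prime_gt1.
have TE : T = \sum_(1 <= j < N) w q j n ^+ 2.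
  rewrite /T; apply: eq_bigl => j; rewrite (leq_trans qM) //.
  by rewrite -{1}[q]expn1 leq_exp2l // prime_gt1.
have := ln_Sylow_subgroups_ln2 R n0 pq nN.
rewrite -/(v q n) -/(w q 0 n) -/(\sum_(1 <= j < N) w q j n ^+ 2) -TE mulr0 subr0 => h.
by apply: le_trans h _; lra.
Qed.

Lemma error_bound n : (0 < n <= N)%N -> (M <= N.+1)%N ->
  `|ln (nb_subgroups_unitsZ n)%:R -
     (ln 2 * (nb_prime_divisors (totient n))%:R +
      1 / 4 * \sum_(1 <= q < M) ((nb_prime_divisors1 q n)%:R ^+ 2 * vonMangoldt R q))|
  <= \sum_(q <- primes_below N.+1) prime_error q n.
Proof.
move=> nN MN; have nB : (0 < n < N.+1)%N by rewrite ltnS.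
have M2 : (M <= 2 ^ N)%N by apply: leq_trans MN _; apply: ltn_expl.
rewrite (ln_nb_subgroups_sum R nB) (nb_prime_divisors_totient nB) natr_sum.
rewrite (sum_vonMangoldt (fun q => (nb_prime_divisors1 q n)%:R ^+ 2) MN M2).
rewrite !mulr_sumr -big_split /= -sumrB big_seq [leRHS]big_seq.
apply: le_trans (ler_norm_sum _ _ _) _; apply: ler_sum => q /primes_belowP[pq _].
apply: le_trans (prime_error_bound pq nN); rewrite le_eqVlt; apply/orP; left.
by apply/eqP; congr `|_|; rewrite opprD addrA; congr (_ - _); ring.
Qed.

Let beta m := recip_primes_1mod R m N.
Let c q j : R := j.+1%:R ^+ 2 / (q ^ j.+1)%N%:R.

Definition prime_error_mean q : R :=
  (if (q < M)%N then 1 + 2 * (ln q%:R * beta q) else 5 * (ln q%:R * beta q ^+ 2))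
  + 5 * ln q%:R * (\sum_(1 <= j < N | (M <= q ^ j.+1)%N) (beta (q ^ j.+1) ^+ 2 + beta (q ^ j.+1))
       + \sum_(1 <= j < N) beta (q ^ j.+1)
       + beta q * \sum_(1 <= j < N) (q ^ j.+1)%N%:R^-1 + \sum_(1 <= j < N) c q j).

Lemma mean_prime_error q : prime q ->
  \sum_(1 <= n < N.+1) prime_error q n <= N%:R * prime_error_mean q.
Proof.
move=> pq; have q1 := prime_gt1 pq.
have lq : 0 <= ln q%:R :> R by rewrite ln_ge0 // ler1n prime_gt0.
have qj1 j : (1 < q ^ j.+1)%N by rewrite -(exp1n j.+1) ltn_exp2r.
have wE n : w q 0 n = (nb_prime_divisors1 q n)%:R by rewrite /w expn1.
rewrite big_split /= /prime_error_mean mulrDr; apply: lerD.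
  case: ltnP => _.
    rewrite big_split /= sumr_const_nat subn1 /= mulrDr mulr1; apply: lerD => //.
    rewrite -!mulr_sumr (mulrCA N%:R) (mulrCA N%:R (ln _)); do 2!apply: ler_wpM2l => //.
    under eq_bigr => n _ do rewrite wE; exact: mean_nb_prime_divisors1.
  rewrite -!mulr_sumr (mulrCA N%:R) (mulrCA N%:R (ln _)); do 2!apply: ler_wpM2l => //.
  under eq_bigr => n _ do rewrite wE; exact: mean_nb_prime_divisors1_pairs.
rewrite -mulr_sumr (mulrCA N%:R); apply: ler_wpM2l; first by rewrite mulr_ge0.
rewrite !big_split /= !mulrDr; apply: lerD; first apply: lerD; first apply: lerD.
- rewrite exchange_big /= -mulrDr -big_split mulr_sumr /=; apply: ler_sum => j _.
  exact: mean_nb_prime_divisors1_sqr.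
- rewrite exchange_big /= mulr_sumr; apply: ler_sum => j _.
  exact: mean_nb_prime_divisors1.
- under eq_bigr => n _ do rewrite wE.
  apply: mean_logn_pred_mul => // p /(primes_1modP q1)[pp _ k0 e].
  apply/eqP => ep; move: e k0; rewrite ep divnn prime_gt0 //; lia.
exact: mean_logn_pred_sqr.
Qed.

Variables C lam : R.
Hypothesis C1 : 1 <= C.
Hypothesis lam1 : 1 <= lam.
Hypothesis betaC : forall l a, prime l -> (0 < a)%N ->
  beta (l ^ a) <= C * (lam + ln (l ^ a)%N%:R) / (l ^ a)%N%:R.

Let ell q : R := 1 + ln q%:R.

Let beta_ge0 m : 0 <= beta m.
Proof. by apply: sumr_ge0 => p _; rewrite invr_ge0 ler0n. Qed.

Let C0 : 0 < C := lt_le_trans ltr01 C1.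
Let lam0 : 0 < lam := lt_le_trans ltr01 lam1.

(** lam + (j + 1) ln q is at most lam (j + 1) (1 + ln q), as lam >= 1. *)
Lemma beta_power q j : prime q ->
  beta (q ^ j.+1) <= C * lam * ell q * (j.+1%:R / (q ^ j.+1)%N%:R).
Proof.
move=> pq; apply: le_trans (betaC pq (ltn0Sn j)) _.
rewrite mulrA; apply: ler_wpM2r; first by rewrite invr_ge0 ler0n.
rewrite -!mulrA; apply: ler_wpM2l; first exact: ltW.
have lq : 0 <= ln q%:R :> R by rewrite ln_ge0 // ler1n prime_gt0.
rewrite natrX lnXn ?ltr0n ?prime_gt0 // -[_ *+ j.+1]mulr_natl /ell.
have j1 : (1 : R) <= j.+1%:R by rewrite ler1n.
move: (j.+1%:R : R) (ln q%:R) j1 lq => y l y1 l0.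
have h1 : lam * 1 <= lam * y by rewrite ler_wpM2l // ltW.
have h2 : 1 * (y * l) <= lam * (y * l) by rewrite ler_wpM2r // mulr_ge0 //; lra.
lra.
Qed.

(** Everything here involves squares or higher powers of q. The extra factor
1 / q^(j + 1) <= 1 / M in the terms beyond the cut pays for lam^2. *)
Lemma prime_error_tail q : prime q -> (0 < M)%N ->
  5 * ln q%:R * (\sum_(1 <= j < N | (M <= q ^ j.+1)%N) (beta (q ^ j.+1) ^+ 2 + beta (q ^ j.+1))
       + \sum_(1 <= j < N) beta (q ^ j.+1)
       + beta q * \sum_(1 <= j < N) (q ^ j.+1)%N%:R^-1 + \sum_(1 <= j < N) c q j)
  <= 160 * (C ^+ 2 * lam ^+ 2 / M%:R + 4 * (C * lam)) * (ell q ^+ 3 / q%:R ^+ 2).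
Proof.
move=> pq M0.
have lq : 0 <= ln q%:R :> R by rewrite ln_ge0 // ler1n prime_gt0.
have q1 : (1 : R) <= q%:R by rewrite ler1n prime_gt0.
have l1 : 1 <= ell q by rewrite /ell; lra.
have MR : (0 : R) < M%:R by rewrite ltr0n.
have cge0 j : 0 <= c q j by rewrite /c divr_ge0 ?sqr_ge0 ?ler0n.
set Z := \sum_(1 <= j < N) c q j.
have Z0 : 0 <= Z by apply: sumr_ge0.
have Z32 : Z <= 32 / q%:R ^+ 2 by apply: sum_prime_powers_le; apply: prime_gt1.
have CL0 : 0 <= C * lam * ell q.
  apply: mulr_ge0; last exact: le_trans ler01 l1.
  by apply: mulr_ge0; apply: ltW.
have bj j : beta (q ^ j.+1) <= C * lam * ell q * c q j.
  apply: le_trans (beta_power j pq) _; apply: ler_wpM2l => //.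
  apply: ler_wpM2r; first by rewrite invr_ge0 ler0n.
  by rewrite -natrX ler_nat -{1}[j.+1]expn1 leq_pexp2l.
have bj2 j : (M <= q ^ j.+1)%N -> beta (q ^ j.+1) ^+ 2 <= (C * lam * ell q) ^+ 2 / M%:R * c q j.
  move=> Mq; have qj : (0 : R) < (q ^ j.+1)%N%:R by rewrite ltr0n expn_gt0 prime_gt0.
  apply: (@le_trans _ _ ((C * lam * ell q * (j.+1%:R / (q ^ j.+1)%N%:R)) ^+ 2)).
    apply: lerXn2r; rewrite ?nnegrE //; last exact: beta_power.
    by rewrite mulr_ge0 // divr_ge0 ?ler0n.
  rewrite exprMn -[leRHS]mulrA; apply: ler_wpM2l; first exact: sqr_ge0.
  rewrite /c expr_div_n mulrCA; apply: ler_wpM2l; first exact: sqr_ge0.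
  rewrite expr2 invfM; apply: ler_wpM2r; first by rewrite invr_ge0 ltW.
  by rewrite lef_pV2 ?posrE // ler_nat.
have t1 : \sum_(1 <= j < N | (M <= q ^ j.+1)%N) (beta (q ^ j.+1) ^+ 2 + beta (q ^ j.+1))
    <= ((C * lam * ell q) ^+ 2 / M%:R + C * lam * ell q) * Z.
  rewrite /Z mulr_sumr big_mkcond; apply: ler_sum => j _; case: ifPn => h.
    by rewrite mulrDl lerD ?bj2 ?bj.
  by rewrite mulr_ge0 // addr_ge0 // divr_ge0 ?sqr_ge0 // ltW.
have t2 : \sum_(1 <= j < N) beta (q ^ j.+1) <= C * lam * ell q * Z.
  by rewrite /Z mulr_sumr; apply: ler_sum.
have t3 : beta q * \sum_(1 <= j < N) (q ^ j.+1)%N%:R^-1 <= C * lam * ell q * Z.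
  apply: ler_pM => //; first by apply: sumr_ge0 => j _; rewrite invr_ge0 ler0n.
    have := beta_power 0 pq; rewrite expn1 => /le_trans; apply.
    by rewrite ler_piMr // ler_pdivrMr ?mul1r //; lra.
  apply: ler_sum => j _; rewrite /c ler_peMl ?invr_ge0 ?ler0n //.
  by rewrite -natrX ler1n expn_gt0.
set P := ell q in l1 CL0 t1 t2 t3 *.
have PP : P <= P ^+ 3 by rewrite -[leLHS]expr1 ler_weXn2l.
have key : \sum_(1 <= j < N | (M <= q ^ j.+1)%N) (beta (q ^ j.+1) ^+ 2 + beta (q ^ j.+1))
       + \sum_(1 <= j < N) beta (q ^ j.+1)
       + beta q * \sum_(1 <= j < N) (q ^ j.+1)%N%:R^-1 + Z
   <= (C ^+ 2 * lam ^+ 2 / M%:R + 4 * (C * lam)) * P ^+ 2 * Z.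
  apply: (@le_trans _ _ (((C * lam * P) ^+ 2 / M%:R + C * lam * P + C * lam * P + C * lam * P + 1) * Z)).
    by rewrite !mulrDl mul1r -!mulrDl; lra.
  apply: ler_wpM2r => //.
  have P2 : P <= P ^+ 2 by rewrite -[leLHS]expr1 ler_weXn2l.
  have P21 : 1 <= P ^+ 2 by apply: le_trans l1 P2.
  have CL1 : 1 <= C * lam by rewrite -[1]mulr1 ler_pM.
  have e1 : (C * lam * P) ^+ 2 / M%:R = C ^+ 2 * lam ^+ 2 / M%:R * P ^+ 2.
    by rewrite !exprMn; ring.
  have h1 : C * lam * P <= C * lam * P ^+ 2 by rewrite ler_wpM2l //; lra.
  have h2 : 1 * 1 <= C * lam * P ^+ 2 by rewrite ler_pM.
  rewrite e1; move: (C ^+ 2 * lam ^+ 2 / M%:R) (C * lam) h1 h2 => x y; lra.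
set Y := C ^+ 2 * lam ^+ 2 / M%:R + 4 * (C * lam) in key *.
have Y0 : 0 <= Y.
  have a1 : 0 <= C ^+ 2 * lam ^+ 2 / M%:R.
    by apply: divr_ge0 => //; apply: mulr_ge0; apply: sqr_ge0.
  have a2 : 0 <= C * lam by rewrite mulr_ge0 // ltW.
  by rewrite /Y; lra.
apply: (@le_trans _ _ (5 * ln q%:R * (Y * P ^+ 2 * Z))); first by rewrite ler_wpM2l // mulr_ge0.
have lP : ln q%:R <= P by rewrite /P /ell; lra.
apply: (@le_trans _ _ (5 * P * (Y * P ^+ 2 * (32 / q%:R ^+ 2)))).
  have YP : 0 <= Y * P ^+ 2 by rewrite mulr_ge0 // sqr_ge0.
  apply: ler_pM; [exact: mulr_ge0 | exact: mulr_ge0 | exact: ler_wpM2l |].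
  exact: ler_wpM2l.
by rewrite le_eqVlt; apply/orP; left; apply/eqP; field; lra.
Qed.

(** The term in lam^2 / M that comes from [sum_primes_ln_sqr_tail] is the
decisive one. It needs the bound for beta q as a sum lam + ln q: replacing it by the
product lam (1 + ln q) of [beta_power] would cost a factor (ln M)^2. *)
Lemma sum_prime_error_mean : (8 <= M)%N -> 
  \sum_(q <- primes_below N.+1) prime_error_mean q <=
    M%:R + 2 * (C * lam) * (1 + ln M%:R) ^+ 3
    + 10 * C ^+ 2 * (lam ^+ 2 * (4160 / M%:R) + 184)
    + 160 * (C ^+ 2 * lam ^+ 2 / M%:R + 4 * (C * lam)) * 184.
Proof.
move=> M8; have M0 : (0 < M)%N by apply: leq_trans M8.
rewrite big_split /=; apply: lerD; last first.
  apply: (@le_trans _ _ (\sum_(q <- primes_below N.+1)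
     160 * (C ^+ 2 * lam ^+ 2 / M%:R + 4 * (C * lam)) * (ell q ^+ 3 / q%:R ^+ 2))).
    rewrite big_seq [leRHS]big_seq; apply: ler_sum => q /primes_belowP[pq _].
    exact: prime_error_tail.
  have a1 : 0 <= C ^+ 2 * lam ^+ 2 / M%:R.
    by apply: divr_ge0 => //; apply: mulr_ge0; apply: sqr_ge0.
  have a2 : 0 <= C * lam by rewrite mulr_ge0 // ltW.
  rewrite -mulr_sumr; apply: ler_wpM2l; first by lra.
  apply: le_trans (sum_ln_cube_sqr_le R N.+1); rewrite big_filter.
  rewrite big_mkcond /= big_ltn //= add0r; apply: ler_sum_nat => n /andP[n0 _].
  by case: ifP => // _; rewrite divr_ge0 ?sqr_ge0 // exprn_ge0 // addr_ge0 // ln_ge0 // ler1n.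
rewrite (bigID (fun q => (q < M)%N)) /=; apply: lerD.
  apply: (@le_trans _ _ (\sum_(q <- primes_below N.+1 | (q < M)%N)
      (1 + 2 * (C * lam) * ((1 + ln q%:R) ^+ 2 / q%:R)))).
    rewrite big_seq_cond [leRHS]big_seq_cond; apply: ler_sum => q /andP[/primes_belowP[pq _] ->].
    rewrite lerD2l -!mulrA ler_pM2l //.
    have lq : 0 <= ln q%:R :> R by rewrite ln_ge0 // ler1n prime_gt0.
    have q0 : (0 : R) < q%:R by rewrite ltr0n prime_gt0.
    have := beta_power 0 pq; rewrite expn1 mul1r /ell => h.
    apply: (@le_trans _ _ ((1 + ln q%:R) * (C * lam * (1 + ln q%:R) / q%:R))).
      by apply: ler_pM => //; lra.
    by rewrite le_eqVlt; apply/orP; left; apply/eqP; field; lra.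
  rewrite big_split /=; apply: lerD.
    rewrite big_const_seq iter_addr_0 -[1 *+ _]/(_%:R) ler_nat.
    rewrite -size_filter -[leqRHS](size_iota 0); apply: uniq_leq_size.
      by rewrite !filter_uniq ?iota_uniq.
    by move=> q; rewrite mem_filter mem_iota => /andP[].
  rewrite -mulr_sumr; apply: ler_wpM2l.
    by apply: mulr_ge0 => //; apply: mulr_ge0; apply: ltW.
  apply: le_trans (sum_ln_div_below R M0); rewrite -big_filter.
  apply: ler_sum_subset_seq.
  - by move=> q; rewrite mem_index_iota => /andP[q0 _]; rewrite divr_ge0 ?sqr_ge0.
  - by rewrite !filter_uniq ?iota_uniq.
  move=> q; rewrite !mem_filter mem_index_iota mem_index_iota => /andP[qM /andP[pq _]].
  by rewrite prime_gt0.
apply: (@le_trans _ _ (\sum_(q <- primes_below N.+1 | ~~ (q < M)%N)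
      (10 * C ^+ 2 * lam ^+ 2 * (ln q%:R / q%:R ^+ 2) + 10 * C ^+ 2 * ((1 + ln q%:R) ^+ 3 / q%:R ^+ 2)))).
  rewrite big_seq_cond [leRHS]big_seq_cond; apply: ler_sum => q /andP[/primes_belowP[pq _] /negbTE ->].
  have lq : 0 <= ln q%:R :> R by rewrite ln_ge0 // ler1n prime_gt0.
  have q0 : (0 : R) < q%:R by rewrite ltr0n prime_gt0.
  have := betaC pq (ltn0Sn 0); rewrite expn1 => h.
  apply: (@le_trans _ _ (5 * (ln q%:R * (C * (lam + ln q%:R) / q%:R) ^+ 2))).
    rewrite ler_pM2l //; apply: ler_wpM2l => //; apply: lerXn2r; rewrite ?nnegrE //.
    exact: le_trans h.
  have -> : 5 * (ln q%:R * (C * (lam + ln q%:R) / q%:R) ^+ 2) =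
     5 * C ^+ 2 * (ln q%:R * (lam + ln q%:R) ^+ 2) / q%:R ^+ 2 :> R by field; lra.
  have -> : 10 * C ^+ 2 * lam ^+ 2 * (ln q%:R / q%:R ^+ 2) + 10 * C ^+ 2 * ((1 + ln q%:R) ^+ 3 / q%:R ^+ 2)
    = 5 * C ^+ 2 * (2 * (lam ^+ 2 * ln q%:R + (1 + ln q%:R) ^+ 3)) / q%:R ^+ 2 :> R by field; lra.
  apply: ler_wpM2r; first by rewrite invr_ge0 sqr_ge0.
  apply: ler_wpM2l; first by apply: mulr_ge0 => //; apply: sqr_ge0.
  move: (ln q%:R) lq => l l0.
  have h1 : 0 <= l * (lam - l) ^+ 2 by rewrite mulr_ge0 ?sqr_ge0.
  have h2 : 0 <= l ^+ 2 by apply: sqr_ge0.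
  lra.
rewrite big_split /= -!mulr_sumr.
have g1 := sum_primes_ln_sqr_tail R N.+1 M8.
have g2 : \sum_(q <- primes_below N.+1 | ~~ (q < M)%N) (1 + ln q%:R) ^+ 3 / q%:R ^+ 2 <= 184 :> R.
  apply: le_trans (sum_ln_cube_sqr_le R N.+1); rewrite -big_filter.
  apply: ler_sum_subset_seq.
  - move=> q; rewrite mem_index_iota => /andP[q0 _].
    by rewrite divr_ge0 ?sqr_ge0 // exprn_ge0 // addr_ge0 // ln_ge0 // ler1n.
  - by rewrite !filter_uniq ?iota_uniq.
  move=> q; rewrite !mem_filter !mem_index_iota => /andP[_ /andP[pq]].
  by rewrite prime_gt0.
have g1' : \sum_(q <- primes_below N.+1 | ~~ (q < M)%N) ln q%:R / q%:R ^+ 2 <= 4160 / M%:R :> R.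
  by apply: le_trans g1; rewrite le_eqVlt; apply/orP; left; apply/eqP; apply: eq_bigl => q; rewrite -leqNgt.
have c0 : 0 <= 10 * C ^+ 2 by apply: mulr_ge0 => //; apply: sqr_ge0.
rewrite mulrDr; apply: lerD; last exact: ler_wpM2l.
rewrite -[leLHS]mulrA; apply: ler_wpM2l => //.
by apply: ler_wpM2l => //; apply: sqr_ge0.
Qed.
End Error.

(** * Size of the mean and conclusion *)

Section Asymptotics.
Variable R : realType.

(** Beyond this value of u one has 2 u^5 <= e^(u / 2), by the term of degree 6
of the exponential series. *)
Definition threshold : R := 128 * (6`!)%:R.

Lemma threshold_ge : 128 <= threshold.
Proof. by rewrite /threshold ler_peMr // ler1n fact_gt0. Qed.

Lemma expR_half_ge (u : R) : threshold <= u -> 2 * u ^+ 5 <= expR (u / 2).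
Proof.
move=> hu; have u0 : 0 < u by apply: lt_le_trans hu; have := threshold_ge; lra.
apply: le_trans (_ : (u / 2) ^+ 6 / (6`!)%:R <= _).
  have F0 : (0 : R) < (6`!)%:R by rewrite ltr0n fact_gt0.
  rewrite ler_pdivlMr // (_ : (u / 2) ^+ 6 = u ^+ 5 * (u / 64)); last by field.
  rewrite mulrAC (mulrC _ (u ^+ 5)); apply: ler_wpM2l; first by rewrite exprn_ge0 // ltW.
  by rewrite ler_pdivlMr //; move: hu; rewrite /threshold; lra.
have := @expR_ge1Dxn R (u / 2) 5 ltac:(lra); lra.
Qed.

Definition total_constant (C : R) : R :=
  1 + 2 * C * 125 + 10 * C ^+ 2 * (4160 + 184) + 160 * (C ^+ 2 + 4 * C) * 184.

(** Here u is ln ln ln x and E is the square root of ln ln x, so that the cutoff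
is E u^2 and the target is T = E^3 / u^2. The terms in E^4 / M are at most T because
M is at least the cutoff, and all others because u^5 <= E. *)
Lemma total_error_le (C u E : R) (M : nat) :
  1 <= C -> 1 <= u -> 2 * u ^+ 5 <= E -> E = expR (u / 2) ->
  E * u ^+ 2 <= M%:R -> M%:R <= E * u ^+ 2 + 1 ->
  M%:R + 2 * (C * E ^+ 2) * (1 + ln M%:R) ^+ 3
    + 10 * C ^+ 2 * ((E ^+ 2) ^+ 2 * (4160 / M%:R) + 184)
    + 160 * (C ^+ 2 * (E ^+ 2) ^+ 2 / M%:R + 4 * (C * E ^+ 2)) * 184
  <= total_constant C * (E ^+ 3 / u ^+ 2).
Proof.
move=> C1 u1 uE eE M1 M2; set T := E ^+ 3 / u ^+ 2.
have u0 : 0 < u by lra.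
have u2 : 0 < u ^+ 2 by rewrite exprn_gt0.
have u21 : 1 <= u ^+ 2 by rewrite exprn_ege1.
have u51 : 1 <= u ^+ 5 by rewrite exprn_ege1.
have u45 : u ^+ 4 <= u ^+ 5 by rewrite ler_weXn2l.
have u25 : u ^+ 2 <= u ^+ 5 by rewrite ler_weXn2l.
have E2 : 2 <= E by lra.
have E0 : 0 < E by lra.
have EE : E <= E ^+ 2 by rewrite -[leLHS]expr1 ler_weXn2l //; lra.
have X1 : 1 <= E * u ^+ 2 by rewrite -[1]mulr1 ler_pM //; lra.
have M0 : 0 < M%:R :> R by apply: lt_le_trans M1; lra.
have b1 : E * u ^+ 2 + 1 <= T.
  apply: (@le_trans _ _ (2 * (E * u ^+ 2))); first by lra.
  rewrite ler_pdivlMr // (_ : 2 * (E * u ^+ 2) * u ^+ 2 = E * (2 * u ^+ 4)); last by ring.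
  by rewrite (exprS E 2) ler_wpM2l //; lra.
have b2 : E ^+ 2 * (1 + ln M%:R) ^+ 3 <= 125 * T.
  have lM : ln M%:R <= 1 + u / 2 + 2 * u.
    apply: (@le_trans _ _ (ln (2 * (E * u ^+ 2)))); first by apply: ln_mono => //; lra.
    rewrite lnM ?posrE //; last by apply: mulr_gt0.
    rewrite lnM ?posrE // eE expRK lnXn //.
    have := ln2_le1 R; have := @le_ln1Dx R (u - 1); rewrite (_ : 1 + (u - 1) = u); last by ring.
    by move=> /(_ ltac:(lra)); rewrite -[ln u *+ 2]mulr_natl; lra.
  have lM0 : 0 <= ln M%:R :> R by rewrite ln_ge0 //; apply: le_trans M1.
  apply: (@le_trans _ _ (E ^+ 2 * (5 * u) ^+ 3)).
    apply: ler_wpM2l; first exact: sqr_ge0.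
    by apply: lerXn2r; rewrite ?nnegrE; lra.
  rewrite /T mulrA ler_pdivlMr // (_ : E ^+ 2 * (5 * u) ^+ 3 * u ^+ 2 = 125 * (E ^+ 2 * u ^+ 5)); last by ring.
  by rewrite (exprSr E 2) ler_pM2l // ler_wpM2l ?sqr_ge0 //; lra.
have b3 : (E ^+ 2) ^+ 2 / M%:R <= T.
  rewrite ler_pdivrMr // /T mulrAC ler_pdivlMr //.
  rewrite (_ : (E ^+ 2) ^+ 2 * u ^+ 2 = E ^+ 3 * (E * u ^+ 2)); last by ring.
  by rewrite ler_wpM2l // exprn_ge0 // ltW.
have b4 : E ^+ 2 <= T.
  by rewrite /T ler_pdivlMr // (exprSr E 2) ler_wpM2l ?sqr_ge0 //; lra.
have b5 : 1 <= T by lra.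
have C0 : 0 <= C by lra.
have CC0 : 0 <= C ^+ 2 by apply: sqr_ge0.
have k1 := ler_wpM2l C0 b2; have k2 := ler_wpM2l CC0 b3; have k3 := ler_wpM2l C0 b4.
have k4 := ler_wpM2l CC0 b5.
rewrite /total_constant.
have -> : (E ^+ 2) ^+ 2 * (4160 / M%:R) = 4160 * ((E ^+ 2) ^+ 2 / M%:R) by rewrite mulrCA.
have -> : C ^+ 2 * (E ^+ 2) ^+ 2 / M%:R = C ^+ 2 * ((E ^+ 2) ^+ 2 / M%:R) by rewrite mulrA.
move: (le_trans M2 b1) k1 k2 k3 k4; clear.
move: T ((E ^+ 2) ^+ 2 / M%:R) (E ^+ 2) ((1 + ln M%:R) ^+ 3) => t a b c.
move: (M%:R : R) => m; lra.
Qed.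

Lemma total_constant_ge1 C : 1 <= C -> 1 <= total_constant C.
Proof. by move=> C1; have := sqr_ge0 C; rewrite /total_constant; lra. Qed.

Lemma ln_le_self (y : R) : 0 < y -> ln y <= y.
Proof.
move=> y0; have := @le_ln1Dx R (y - 1); rewrite (_ : 1 + (y - 1) = y); last by ring.
by move=> /(_ ltac:(lra)); lra.
Qed.

(** Markov's inequality: the pointwise error has mean at most K E^3 / u^2, and
the tolerance is K E^3 / u. *)
Lemma count_exceptional_le (C x : R) : 1 <= C ->
  (forall l a, prime l -> (0 < a)%N ->
    recip_primes_1mod R (l ^ a) (Num.truncn x) <=
      C * (lnln x + ln (l ^ a)%N%:R) / (l ^ a)%N%:R) ->
  expR (expR (expR threshold)) <= x ->
  (count (fun n : nat =>
            ~~ (`|ln (nb_subgroups_unitsZ n)%:R - approx_ln_nb_subgroups x n|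
                  <= total_constant C * (lnln x `^ (3 / 2) / lnlnln x)))
         (iota 1 (Num.truncn x)))%:R
    <= x / lnlnln x.
Proof.
move=> C1 betaC hx; have x0 : 0 < x by apply: lt_le_trans hx; apply: expR_gt0.
have K1 : 1 <= total_constant C := total_constant_ge1 C1.
set K := total_constant C in K1 *.
have lx : expR (expR (threshold)) <= ln x.
  by rewrite -[leLHS]expRK; apply: ln_mono => //; apply: expR_gt0.
have lx0 : 0 < ln x by apply: lt_le_trans lx; apply: expR_gt0.
have llx : expR (threshold) <= lnln x.
  by rewrite -[leLHS]expRK; apply: ln_mono => //; apply: expR_gt0.
have llx0 : 0 < lnln x by apply: lt_le_trans llx; apply: expR_gt0.
have hu : threshold <= lnlnln x.
  by rewrite -[leLHS]expRK; apply: ln_mono => //; apply: expR_gt0.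
set u := lnlnln x in hu *; pose E := expR (u / 2).
have u128 : 128 <= u := le_trans threshold_ge hu.
have u1 : 1 <= u by apply: le_trans u128; rewrite ler1n.
have u0 : 0 < u := lt_le_trans ltr01 u1.
have u8 : 8 <= u by apply: le_trans u128; rewrite ler_nat.
have uE := expR_half_ge hu.
have lamE : lnln x = E ^+ 2.
  by rewrite -[LHS](@lnK R) ?posrE // -/(lnlnln x) -/u /E -expRM_natr; congr expR; field.
have pow32 : lnln x `^ (3 / 2) = E ^+ 3.
  by rewrite /powR gt_eqF // -/(lnlnln x) -/u /E -expRM_natr; congr expR; field.
have pow12 : lnln x `^ (1 / 2) = E.
  by rewrite /powR gt_eqF // -/(lnlnln x) -/u /E; congr expR; field.
have u51 : 1 <= u ^+ 5 by rewrite exprn_ege1.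
have u5E : u ^+ 5 <= E by apply: le_trans uE; rewrite ler_peMl ?exprn_ge0 ?(ltW u0) // ler1n.
have E1 : 1 <= E := le_trans u51 u5E.
have cutE : cutoff x = E * u ^+ 2 by rewrite /cutoff pow12.
set M := (Num.truncn (cutoff x)).+1; set N := Num.truncn x.
have cut0 : 0 <= cutoff x by rewrite cutE mulr_ge0 ?sqr_ge0 // expR_ge0.
have M1 : E * u ^+ 2 <= M%:R by rewrite -cutE ltW // truncnS_gt.
have M2 : M%:R <= E * u ^+ 2 + 1 by rewrite -cutE /M -natr1 lerD2r truncn_le.
have M8 : (8 <= M)%N.
  rewrite -(ler_nat R); apply: le_trans M1; rewrite -[8%:R]mul1r; apply: ler_pM => //.
  by apply: le_trans u8 _; rewrite -[leLHS]expr1 ler_weXn2l.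
have MN : (M <= N.+1)%N.
  rewrite ltnS; apply: le_truncn; rewrite cutE.
  apply: (@le_trans _ _ (lnln x)).
    rewrite lamE (expr2 E); apply: ler_wpM2l; first by rewrite expR_ge0.
    by apply: le_trans u5E; rewrite ler_weXn2l.
  by apply: le_trans (ln_le_self lx0) (ln_le_self x0).
have lam1 : 1 <= lnln x by rewrite lamE exprn_ege1.
pose err n := \sum_(q <- primes_below N.+1) prime_error R N M q n.
have mean : \sum_(1 <= n < N.+1) err n <= x * (K * (E ^+ 3 / u ^+ 2)).
  rewrite exchange_big /=.
  apply: (@le_trans _ _ (N%:R * \sum_(q <- primes_below N.+1) prime_error_mean R N M q)).
    rewrite mulr_sumr big_seq [leRHS]big_seq; apply: ler_sum => q /primes_belowP[pq _].
    exact: mean_prime_error.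
  have h1 := sum_prime_error_mean C1 lam1 betaC M8.
  rewrite lamE in h1.
  have h2 := total_error_le C1 u1 uE erefl M1 M2.
  have T0 : 0 <= K * (E ^+ 3 / u ^+ 2).
    rewrite mulr_ge0 ?(le_trans ler01 K1) //.
    by rewrite divr_ge0 ?sqr_ge0 // exprn_ge0 // expR_ge0.
  have h3 := le_trans h1 h2.
  apply: (@le_trans _ _ (N%:R * (K * (E ^+ 3 / u ^+ 2)))); first by apply: ler_wpM2l.
  by apply: ler_wpM2r => //; rewrite truncn_le ltW.
set B := count _ _.
have markov : B%:R * (K * (E ^+ 3 / u)) <= \sum_(1 <= n < N.+1) err n.
  rewrite /B count_sum natr_sum mulr_suml /index_iota subn1 /=.
  rewrite big_seq [leRHS]big_seq; apply: ler_sum => n; rewrite mem_iota add1n ltnS => nN.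
  have hn := @error_bound R N M n nN MN.
  rewrite -/(approx_ln_nb_subgroups x n) -/(err n) in hn.
  rewrite pow32 -/u.
  case: (boolP (`|ln (nb_subgroups_unitsZ n)%:R - approx_ln_nb_subgroups x n| <= K * (E ^+ 3 / u))).
    by move=> _; rewrite mul0r (le_trans _ hn).
  by rewrite -ltNge mul1r => h; apply: le_trans hn; apply: ltW.
have {markov}key := le_trans markov mean.
have E30 : 0 < E ^+ 3 by rewrite exprn_gt0 // expR_gt0.
have K0 : 0 < K := lt_le_trans ltr01 K1.
rewrite ler_pdivlMr //.
have KE : 0 < K * (E ^+ 3 / u ^+ 2) by rewrite mulr_gt0 // divr_gt0 // exprn_gt0.
rewrite -(ler_pM2r KE); apply: le_trans key; rewrite le_eqVlt; apply/orP; left; apply/eqP.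
by field; rewrite gt_eqF.
Qed.

End Asymptotics.

Theorem proposition1p2 (R : realType) :
  exists2 K : R, 0 < K &
    \forall x \near +oo,
      (count (fun n : nat =>
                ~~ (`|ln (nb_subgroups_unitsZ n)%:R - approx_ln_nb_subgroups x n|
                      <= K * (lnln x `^ (3 / 2) / lnlnln x)))
             (iota 1 (Num.truncn x)))%:R
        <= K * x / lnlnln x.
Proof.
have C1 : 1 <= 4200 :> R by rewrite ler1n.
have K1 := total_constant_ge1 C1.
exists (total_constant (4200 : R)); first exact: lt_le_trans K1.
near=> x.
have hx : expR (expR (expR (threshold R))) <= x.
  by near: x; apply: nbhs_pinfty_ge; apply: num_real.
have x0 : 0 < x := lt_le_trans (expR_gt0 _) hx.
have lx : expR (expR (threshold R)) <= ln x.
  by rewrite -[leLHS]expRK; apply: ln_mono => //; apply: expR_gt0.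
have llx : expR (threshold R) <= lnln x.
  by rewrite -[leLHS]expRK; apply: ln_mono => //; apply: expR_gt0.
have lllx : threshold R <= lnlnln x.
  by rewrite -[leLHS]expRK; apply: ln_mono => //; apply: expR_gt0.
have t1 : 1 <= threshold R by apply: le_trans (threshold_ge R); rewrite ler1n.
have lam1 : 1 <= lnln x.
  by apply: le_trans llx; apply: le_trans (expR_ge1Dx _); rewrite lerDl (le_trans ler01).
apply: (@le_trans _ _ (x / lnlnln x)).
  apply: count_exceptional_le => // l a pl a0; exact: recip_primes_1mod_ln.
rewrite -mulrA ler_peMl // divr_ge0 ?ltW // (lt_le_trans _ lllx) //.
exact: lt_le_trans ltr01 t1.
Unshelve. all: by end_near.
Qed.
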